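(* Fix $r\in(0,\infty)$. Let $(s_n)$ be a sequence of integers with $1\le s_n\le n$ and $\eta_n=s_n/n\to 0$ as $n\to\infty$. Let $\hat p_{\mathsf G}$ be the Bayes predictive density estimate based on the product grid prior $\pi_{\mathsf G,n}(d\boldsymbol\theta)=\prod_{i=1}^n\pi_{\mathsf G}[\eta_n](d\theta_i)$. Then, as $n\to\infty$, $$\max_{\boldsymbol\theta\in\Theta_n[s_n]}\rho(\boldsymbol\theta,\hat p_{\mathsf G})=R_N(\Theta_n[s_n])\,\bigl(1+h_r^+ +o(1)\bigr),$$ where $h_r=(1+2r)(1+r)^{-2}(1-2r-4r^2)/4$ and $h_r^+=\max(h_r,0)$.
   Context: Model: $\boldsymbol X\sim N_n(\boldsymbol\theta,\boldsymbol I)$ and $\boldsymbol Y\sim N_n(\boldsymbol\theta,r\boldsymbol I)$ are independent given the unknown $\boldsymbol\theta\in\mathbb R^n$; $r>0$ is known and fixed. Put $v=(1+r^{-1})^{-1}=r/(1+r)$. Let $p(\boldsymbol x|\boldsymbol\theta,1)$ and $p(\boldsymbol y|\boldsymbol\theta,r)$ denote the Gaussian densities of $\boldsymbol X$ and $\boldsymbol Y$. A predictive density estimator $\hat p(\boldsymbol y|\boldsymbol x)$ is, for each $\boldsymbol x\in\mathbb R^n$, a probability density in $\boldsymbol y\in\mathbb R^n$ (jointly measurable). Its Kullback–Leibler loss is $L(\boldsymbol\theta,\hat p(\cdot|\boldsymbol x))=\int p(\boldsymbol y|\boldsymbol\theta,r)\log\frac{p(\boldsymbol y|\boldsymbol\theta,r)}{\hat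 p(\boldsymbol y|\boldsymbol x)}\,d\boldsymbol y$ and its risk is $\rho(\boldsymbol\theta,\hat p)=\int L(\boldsymbol\theta,\hat p(\cdot|\boldsymbol x))\,p(\boldsymbol x|\boldsymbol\theta,1)\,d\boldsymbol x$. For a prior $\pi$ on $\mathbb R^n$ the Bayes predictive density estimate is $\hat p_\pi(\boldsymbol y|\boldsymbol x)=\int p(\boldsymbol y|\boldsymbol\theta,r)\,\pi(d\boldsymbol\theta|\boldsymbol x)$, with $\pi(d\boldsymbol\theta|\boldsymbol x)$ the posterior given $\boldsymbol X=\boldsymbol x$. Let $\|\boldsymbol\theta\|_0=\#\{i:\theta_i\ne0\}$, $\Theta_n[s]=\{\boldsymbol\theta\in\mathbb R^n:\|\boldsymbol\theta\|_0\le s\}$, and $R_N(\Theta)=\inf_{\hat p}\sup_{\boldsymbol\theta\in\Theta}\rho(\boldsymbol\theta,\hat p)$, the infimum being over all predictive density estimators. ''$\max$'' denotes supremum. Grid prior: for $\eta\in(0,1)$ let $\lambda=\lambda(\eta)=\sqrt{2\log\eta^{-v}}$, $\nu_{\mathsf G}^+=(1-\eta^v)\sum_{j=1}^\infty\eta^{(j-1)v}\delta_{\lambda j}$, let $\nu_{\mathsf G}^-$ be the reflection of $\nu_{\mathsf G}^+$ about $0$, and $\pi_{\mathsf G}[\eta]=(1-\eta)\delta_0+\tfrac12\eta(\nu_{\mathsf G}^++\nu_{\mathsf G}^-)$, where $\delta_a$ is the unit point mass at $a$. *)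

(* Defs.v *)
From HB Require Import structures.
From mathcomp Require Import all_boot all_order all_algebra.
From mathcomp Require Import all_classical all_reals all_analysis measurable_realfun.

Set Implicit Arguments.
Unset Strict Implicit.
Unset Printing Implicit Defensive.
Import Order.TTheory GRing.Theory Num.Theory.
Import numFieldNormedType.Exports.

Local Open Scope classical_set_scope.
Local Open Scope ring_scope.

(* R^n, with the product sigma-algebra of the Borel sigma-algebra of R. *)
Notation vec R n := (n.-tuple (measurableTypeR R)).

Section iid_product.
Context d (T : measurableType d) (R : realType).

Definition tcons n (p : T * n.-tuple T) : n.+1.-tuple T := [tuple of p.1 :: p.2].

(* The n-fold product measure m \x ... \x m on n.-tuple T. *)
Fixpoint nfold (m : set T -> \bar R) n : set (n.-tuple T) -> \bar R :=
  match n with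
  | 0 => \d_[tuple]
  | n'.+1 => pushforward (m \x @nfold m n')%E (@tcons n')
  end.
Arguments nfold : clear implicits.

Lemma measurable_tcons n : measurable_fun setT (@tcons n).
Proof.
apply: (@measurable_cons _ _ (T * n.-tuple T)%type T fst n snd).
  exact: measurable_fst.
exact: measurable_snd.
Qed.

Lemma measurable_tuncons n :
  measurable_fun setT (fun t : n.+1.-tuple T => (thead t, [tuple of behead t])).
Proof.
apply/measurable_fun_pairP; split; first exact: measurable_tnth.
exact: measurable_behead.
Qed.

Section sigma_finite_step.
Variables (m : {sigma_finite_measure set T -> \bar R}) (n : nat).
Variable nu : {sigma_finite_measure set (n.-tuple T) -> \bar R}.

Definition nfold_step : set (n.+1.-tuple T) -> \bar R :=
  pushforward (m \x nu)%E (@tcons n).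

Let step0 : nfold_step set0 = 0%E.
Proof. by rewrite /nfold_step /pushforward preimage_set0 measure0. Qed.

Let step_ge0 A : (0 <= nfold_step A)%E.
Proof. by apply: integral_ge0. Qed.

Let step_sigma_additive : semi_sigma_additive nfold_step.
Proof.
have mc := @measurable_tcons n.
move=> F mF tF mUF; rewrite /nfold_step /pushforward preimage_bigcup.
apply: measure_semi_sigma_additive.
- by move=> k; rewrite -[X in measurable X]setTI; exact: mc.
- apply/trivIsetP => /= i j _ _ ij; rewrite -preimage_setI.
  by move/trivIsetP : tF => /(_ _ _ _ _ ij) ->//; rewrite preimage_set0.
- by rewrite -preimage_bigcup -[X in measurable X]setTI; exact: mc.
Qed.

HB.instance Definition _ := isMeasure.Build _ _ _ nfold_step
  step0 step_ge0 step_sigma_additive.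

Let step_sigma_finite : sigma_finite setT nfold_step.
Proof.
have /sigma_finiteP[F [TF ndF Foo]] := sigma_finiteT m.
have /sigma_finiteP[G [TG ndG Goo]] := sigma_finiteT nu.
pose u (t : n.+1.-tuple T) := (thead t, [tuple of behead t]).
have uK : u \o @tcons n = id.
  apply/funext => -[x t]; rewrite /u /tcons /= theadE; congr pair.
  exact: val_inj.
have UFG : \bigcup_k (F k `*` G k) = setT.
  apply/seteqP; split => // -[x y] _.
  have [i _ Fix] : (\bigcup_k F k) x by rewrite -TF.
  have [j _ Gjy] : (\bigcup_k G k) y by rewrite -TG.
  exists (maxn i j) => //; split => /=.
    by move: x Fix; exact/subsetPset/ndF/leq_maxl.
  by move: y Gjy; exact/subsetPset/ndG/leq_maxr.
exists (fun k => u @^-1` (F k `*` G k)).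
  by rewrite -preimage_bigcup UFG preimage_setT.
move=> k; have [mFk Fkoo] := Foo k; have [mGk Gkoo] := Goo k; split.
  rewrite -[X in measurable X]setTI; apply: measurable_tuncons => //.
  exact: measurableX.
rewrite /= /nfold_step /pushforward.
rewrite (_ : @tcons n @^-1` _ = F k `*` G k).
  by rewrite product_measure1E// lte_mul_pinfty// ge0_fin_numE.
by rewrite -comp_preimage uK preimage_id.
Qed.

HB.instance Definition _ :=
  Measure_isSigmaFinite.Build _ _ _ nfold_step step_sigma_finite.

End sigma_finite_step.

Lemma nfold_bundled (m : {sigma_finite_measure set T -> \bar R}) n :
  {nu : {sigma_finite_measure set (n.-tuple T) -> \bar R} | nfold m n = nu}.
Proof.
elim: n => [|n [nu IH]]; first by exists \d_[tuple].
by exists (nfold_step m nu); rewrite /= IH.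
Qed.

Section nfold_measure.
Variables (m : {sigma_finite_measure set T -> \bar R}) (n : nat).

Let nfold0 : nfold m n set0 = 0%E.
Proof. by case: (nfold_bundled m n) => nu ->; exact: measure0. Qed.

Let nfold_ge0 A : (0 <= nfold m n A)%E.
Proof. by case: (nfold_bundled m n) => nu ->; exact: measure_ge0. Qed.

Let nfold_sigma_additive : semi_sigma_additive (nfold m n).
Proof.
by case: (nfold_bundled m n) => nu ->; exact: measure_semi_sigma_additive.
Qed.

HB.instance Definition _ := isMeasure.Build _ _ _ (nfold m n)
  nfold0 nfold_ge0 nfold_sigma_additive.

Let nfold_sigma_finite : sigma_finite setT (nfold m n).
Proof. by case: (nfold_bundled m n) => nu ->; exact: sigma_finiteT. Qed.

HB.instance Definition _ :=
  Measure_isSigmaFinite.Build _ _ _ (nfold m n) nfold_sigma_finite.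

End nfold_measure.

Lemma nfold_box (m : {sigma_finite_measure set T -> \bar R}) n
    (A : 'I_n -> set T) : (forall i, measurable (A i)) ->
  nfold m n [set t | forall i, A i (tnth t i)] = (\prod_(i < n) m (A i))%E.
Proof.
elim: n A => [|n IH] A mA.
  by rewrite big_ord0 /= diracE mem_set//= => -[].
rewrite big_ord_recl -IH//= /pushforward -product_measure1E//.
  congr ((m \x nfold m n)%E _); apply/seteqP; split => -[x t] /=.
    by move=> At; split => [|i]; [have := At ord0|have := At (lift ord0 i)];
      rewrite /tcons ?tnth0 ?tnthS.
  move=> [Ax At] i; case: (unliftP ord0 i) => [j|] ->.
    by rewrite /tcons tnthS; exact: At.
  by rewrite /tcons tnth0.
rewrite (_ : [set _ | _] =
    \bigcap_(i in [set: 'I_n]) ((@tnth _ T ^~ i) @^-1` A (lift ord0 i))).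
  apply: fin_bigcap_measurable => // i _.
  by rewrite -[X in measurable X]setTI; exact: measurable_tnth.
by apply/seteqP; split => t /= At i => [_|]; exact: At.
Qed.

Section nfold_probability.
Variables (P : probability T R) (n : nat).

Let nfold_setT : nfold P n [set: n.-tuple T] = 1%E.
Proof.
have := @nfold_box P n (fun=> setT) (fun=> measurableT).
rewrite big1 => [<-|i _]; last exact: probability_setT.
by congr (nfold P n _); apply/seteqP; split.
Qed.

HB.instance Definition _ :=
  Measure_isProbability.Build _ _ _ (nfold P n) nfold_setT.

End nfold_probability.

End iid_product.
Arguments nfold {d T R} m n.

Section gaussian_model.
Variable R : realType.

Definition lebesgue_vec n : {sigma_finite_measure set (vec R n) -> \bar R} :=
  nfold lebesgue_measure n.

(* Density of N_n(theta, s2 I); the library's normal_pdf takes the standard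
   deviation. *)
Definition gauss_pdf n (theta : vec R n) (s2 : R) (x : vec R n) : R :=
  \prod_(i < n) normal_pdf (tnth theta i) (Num.sqrt s2) (tnth x i).

Definition predictive_density n (phat : vec R n -> vec R n -> R) : Prop :=
  [/\ measurable_fun setT (fun xy : vec R n * vec R n => phat xy.1 xy.2),
      forall x y, 0 <= phat x y &
      forall x, (\int[@lebesgue_vec n]_y (phat x y)%:E = 1)%E].

(* The quotient is taken in \bar R, where p / 0 = +oo for p > 0: the loss is
   +oo when q vanishes on a set of positive measure. *)
Definition kl_loss n (r : R) (theta : vec R n) (q : vec R n -> R) : \bar R :=
  (\int[@lebesgue_vec n]_y ((gauss_pdf theta r y)%:E *
     lne ((gauss_pdf theta r y)%:E / (q y)%:E)))%E.

Definition risk n (r : R) (theta : vec R n) (phat : vec R n -> vec R n -> R)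
    : \bar R :=
  (\int[@lebesgue_vec n]_x
     (kl_loss r theta (phat x) * (gauss_pdf theta 1 x)%:E))%E.

Definition max_risk n (r : R) (Theta : set (vec R n))
    (phat : vec R n -> vec R n -> R) : \bar R :=
  ereal_sup [set risk r theta phat | theta in Theta].

Definition minimax_risk n (r : R) (Theta : set (vec R n)) : \bar R :=
  ereal_inf [set max_risk r Theta phat | phat in @predictive_density n].

Definition norm0 n (theta : vec R n) : nat :=
  #|[set i : 'I_n | tnth theta i != 0]%SET|.

Definition sparse n (s : nat) : set (vec R n) :=
  [set theta | (norm0 theta <= s)%N].

Lemma measurable_gauss_pdf_mean n s2 (x : vec R n) :
  measurable_fun setT (fun theta : vec R n => gauss_pdf theta s2 x).
Proof.
apply: measurable_prod => i _.
have [s0|s0] := eqVneq (Num.sqrt s2) 0.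
  by rewrite s0 /normal_pdf eqxx; exact: measurable_cst.
rewrite (_ : (fun _ => _) =
    normal_pdf (tnth x i) (Num.sqrt s2) \o (@tnth n (measurableTypeR R) ^~ i)).
  by apply: measurableT_comp; [exact: measurable_normal_pdf|exact: measurable_tnth].
apply/funext => theta /=; rewrite !normal_pdfE// /normal_fun.
by rewrite -[in RHS]sqrrN opprB.
Qed.

Lemma gauss_pdf_ge0 n (theta : vec R n) s2 x : 0 <= gauss_pdf theta s2 x.
Proof. by apply: prodr_ge0 => i _; exact: normal_pdf_ge0. Qed.

Section posterior.
Variables (n : nat) (prior : probability (vec R n) R) (x : vec R n).

(* p(x|theta,1) prior(dtheta), as a measure in theta *)
Definition joint (A : set (vec R n)) : \bar R :=
  (\int[prior]_(theta in A) (gauss_pdf theta 1 x)%:E)%E.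

Let joint0 : joint set0 = 0%E.
Proof. exact: integral_set0. Qed.

Let joint_ge0 A : (0 <= joint A)%E.
Proof. by apply: integral_ge0 => theta _; rewrite lee_fin gauss_pdf_ge0. Qed.

Let joint_sigma_additive : semi_sigma_additive joint.
Proof.
move=> F mF tF mUF; rewrite /joint ge0_integral_bigcup//=.
- apply: is_cvg_ereal_nneg_natsum => k _; exact: joint_ge0.
- apply: measurable_funTS; apply/measurable_EFinP.
  exact: measurable_gauss_pdf_mean.
- by move=> theta _; rewrite lee_fin gauss_pdf_ge0.
Qed.

HB.instance Definition _ := isMeasure.Build _ _ _ joint
  joint0 joint_ge0 joint_sigma_additive.

(* mnormalize divides by the evidence joint setT, which is positive and finite
   here, so that its default value (the second argument) is never used. *)
Definition posterior : probability (vec R n) R := mnormalize joint prior.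

End posterior.

Definition bayes_density n (r : R) (prior : probability (vec R n) R)
    (x y : vec R n) : R :=
  \int[posterior prior x]_theta gauss_pdf theta r y.

End gaussian_model.

Section grid_prior.
Variables (R : realType) (r eta : R).

Definition grid_v : R := (1 + r^-1)^-1.

Definition grid_spacing : R := Num.sqrt (2 * ln (eta `^ (- grid_v))).

Definition grid_pos (A : set (measurableTypeR R)) : \bar R :=
  ((1 - eta `^ grid_v)%:E *
   \sum_(1 <= j <oo) ((eta `^ ((j%:R - 1) * grid_v))%:E *
                       \d_(grid_spacing * j%:R)%R A))%E.

Definition grid_neg : set (measurableTypeR R) -> \bar R :=
  pushforward grid_pos (-%R : measurableTypeR R -> measurableTypeR R).

(* The grid prior is only meant for 0 < r and 0 < eta < 1; the default value
   makes it a probability for all parameters. *)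
Definition grid_prior (A : set (measurableTypeR R)) : \bar R :=
  if [&& 0 < r, 0 < eta & eta < 1] then
    ((1 - eta)%:E * \d_(0 : R)%R A + (eta / 2)%:E * (grid_pos A + grid_neg A))%E
  else \d_(0 : R)%R A.

Let c := eta `^ grid_v.

Let grid_branch (sg : R) (c1 : 0 <= 1 - c) :
    {measure set (measurableTypeR R) -> \bar R} :=
  mscale (NngNum c1) (mseries (fun j =>
    mscale (NngNum (powR_ge0 eta ((j%:R - 1) * grid_v)))
      \d_(sg * (grid_spacing * j%:R) : measurableTypeR R)) 1).

Let grid_negE A : grid_neg A =
  ((1 - c)%:E * \sum_(1 <= j <oo) ((eta `^ ((j%:R - 1) * grid_v))%:E *
                                   \d_(- (grid_spacing * j%:R))%R A))%E.
Proof. by []. Qed.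

Let c_lt1 : 0 < r -> 0 < eta -> eta < 1 -> c < 1.
Proof.
move=> r0 e0 e1; rewrite /c /powR gt_eqF// -[ltRHS]expR0 ltr_expR.
rewrite pmulr_rlt0 ?ln_lt0 ?e0//.
by rewrite /grid_v invr_gt0 addr_gt0// invr_gt0.
Qed.

Let grid_bundled : exists m : {measure set (measurableTypeR R) -> \bar R},
  grid_prior = m :> (set _ -> _) /\ m setT = 1%E.
Proof.
have [/and3P[r0 e0 e1]|cond] := boolP [&& 0 < r, 0 < eta & eta < 1]; last first.
  exists \d_(0 : measurableTypeR R); split; last exact: diracT.
  by apply/funext => A; rewrite /grid_prior (negbTE cond).
have c1 := c_lt1 r0 e0 e1.
have c1' : 0 <= 1 - c by rewrite subr_ge0 ltW.
have e1' : 0 <= 1 - eta by rewrite subr_ge0 ltW.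
have e2' : 0 <= eta / 2 by rewrite divr_ge0// ltW.
have c0 : 0 <= c by exact: powR_ge0.
have branch1 sg : grid_branch sg c1' setT = 1%E.
  rewrite /= /mscale/= /mseries.
  rewrite (_ : limn _ = ((1 - c)^-1)%:E).
    by rewrite -EFinM divff// subr_eq0 gt_eqF.
  apply/cvg_lim => //; rewrite -cvg_shiftS /=.
  rewrite (_ : (fun n => _) = EFin \o series (geometric 1 c)).
    apply: cvg_EFin; first exact: nearW.
    by rewrite -[X in _ --> X]mul1r; apply: cvg_geometric_series; rewrite ger0_norm.
  apply/funext => k /=; rewrite big_add1 /= /series/= -sumEFin.
  apply: eq_bigr => i _; rewrite /mscale/= diracT mule1 mul1r.
  by rewrite -natr1 addrK mulrC powRrM powR_mulrn.
exists (measure_add (mscale (NngNum e1') \d_(0 : measurableTypeR R))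
  (mscale (NngNum e2') (measure_add (grid_branch 1 c1') (grid_branch (-1) c1')))).
split.
  apply/funext => A; rewrite /grid_prior r0 e0 e1 [RHS]measure_addE [LHS]/=.
  rewrite [X in _ = (_ + X)%E](_ : _ = ((eta / 2)%:E *
    measure_add (grid_branch 1 c1') (grid_branch (-1) c1') A)%E)//.
  rewrite measure_addE; congr (_ + _ * (_ + _))%E.
    rewrite /grid_pos /= /mscale/=; congr (_ * _)%E.
    by apply: eq_eseriesr => j _; rewrite mul1r.
  rewrite grid_negE /= /mscale/=; congr (_ * _)%E.
  by apply: eq_eseriesr => j _; rewrite mulN1r.
rewrite [LHS]measure_addE.
rewrite [X in (X + _)%E](_ : _ = ((1 - eta)%:E * \d_(0 : R)%R setT)%E)//.
rewrite [X in (_ + X)%E](_ : _ = ((eta / 2)%:E *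
  measure_add (grid_branch 1 c1') (grid_branch (-1) c1') setT)%E)//.
rewrite measure_addE !branch1 diracT mule1.
by rewrite -EFinD -mulrA (_ : 1 + 1 = 2%:R)// mulVf// mulr1 subrK.
Qed.

Let grid0 : grid_prior set0 = 0%E.
Proof. by case: grid_bundled => m [-> _]; exact: measure0. Qed.

Let grid_ge0 A : (0 <= grid_prior A)%E.
Proof. by case: grid_bundled => m [-> _]; exact: measure_ge0. Qed.

Let grid_sigma_additive : semi_sigma_additive grid_prior.
Proof.
by case: grid_bundled => m [-> _]; exact: measure_semi_sigma_additive.
Qed.

HB.instance Definition _ := isMeasure.Build _ _ _ grid_prior
  grid0 grid_ge0 grid_sigma_additive.

Let grid_setT : grid_prior setT = 1%E.
Proof. by case: grid_bundled => m [-> ->]. Qed.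

HB.instance Definition _ :=
  Measure_isProbability.Build _ _ _ grid_prior grid_setT.

End grid_prior.

Definition product_grid_prior (R : realType) (r eta : R) n :
  probability (vec R n) R := nfold (grid_prior r eta) n.

Definition h_const (R : realType) (r : R) : R :=
  (1 + 2 * r) * (1 + r) ^- 2 * (1 - 2 * r - 4 * r ^+ 2) / 4.

(* Main.v *)
Require Import Defs.
From mathcomp Require Import all_boot all_order all_algebra.
From mathcomp Require Import all_classical all_reals all_analysis measurable_realfun.
From mathcomp Require Import ring lra.
Import Order.TTheory GRing.Theory Num.Theory.
Import numFieldNormedType.Exports.

Set Implicit Arguments.
Unset Strict Implicit.
Unset Printing Implicit Defensive.

Local Open Scope classical_set_scope.
Local Open Scope ring_scope.

(** Write [L = - ln eta]; both risks turn out to be of exact order [s L].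

    Coordinatewise, the log-likelihood loss of a mixture predictor is a
    difference of two log-mixtures: the one under the variance of [X] and the
    one under the variance [v] of the pair [(X, Y)]. On the scale
    [theta = lambda * alpha] the atoms of the grid have mass
    [exp (- L * atom_exp k)], so up to O(sqrt L) the loss is [L] times
    [min_k (atom_exp k + (alpha - k)^2) - min_j (atom_exp j + v (alpha - j)^2)],
    whose supremum over [alpha] is [(1 - v) (1 + h_r^+)]: the value [1 - v] is
    reached at [alpha = 1] and the value [(1 - v) (1 + h_r)] at the tie
    [alpha = (3 + v) / 2] between the first two atoms. The upper bound is made
    pointwise in [x], choosing [k] as a function of [x] rather than of the
    unknown [theta], so that no control of the fluctuations of [X] is needed.
    Null coordinates cost only O(eta) each, by [ln z <= z - 1] and the fact that
    likelihood ratios have mean one.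

    The minimax risk is [(1 - v) s L (1 + o(1))]. An upper bound is given by a
    two-component predictor centred at 0 and at [x]. For the lower bound, put one
    spike of height about [lambda] at a uniform position in each of [s] blocks of
    [n / s] coordinates and compare any predictor with this finite prior by
    Gibbs' inequality. *)

(** The unit of the exponents comes from the precision [1 + r^-1 = v^-1] that the pair carries about
    the mean. Since [lambda ^+ 2 = 2 v L], a displacement by [alpha] grid steps costs [L alpha^2]
    for the pair and [v L alpha^2] for [X] alone, while one more step along the grid costs [v L] in
    prior mass. Nonzero atoms [j] and [j + 1] therefore tie at [alpha = j + 1] in the mixture of
    [X], but at [alpha = j + (1 + v) / 2] in that of the pair; the dominant nonzero atoms of the two
    mixtures differ by at most one step.

    The obstacle is the loss itself, an integral in [\bar R] of a function of both signs whose
    integrability is not at hand. No risk is computed: the integrand is bounded pointwise in [x] and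
    [y] by functions with an explicit mean, and monotonicity of the integral does the rest. All
    fluctuations go into Gaussian exponentials centred at the true mean, whose means do not depend
    on it; the bounds are thus uniform over the sparse set, and their validity requires only that
    [L] exceed a threshold free of [n] and [s]. *)

Section integral_tools.
Local Open Scope ereal_scope.

Section le_integral_pointwise.
Import HBNNSimple.

(* No measurability is needed: the integral of a nonnegative function is the
   supremum of the integrals of the simple functions below it. *)
Lemma le_integral_pointwise d (T : measurableType d) (R : realType)
    (mu : {measure set T -> \bar R}) (f g : T -> \bar R) :
  (forall x, f x <= g x) -> \int[mu]_x f x <= \int[mu]_x g x.
Proof.
move=> fg.
have maxS (a b : \bar R) : a <= b -> maxe a 0 <= maxe b 0.
  by move=> ab; rewrite ge_max !le_max ab lexx !orbT.
rewrite /integral !patch_setT; apply: leeB.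
  apply: le_ereal_sup => /= _ [h hf <-].
  by exists h => // x; apply: (le_trans (hf x)); rewrite !funeposE; exact: maxS.
apply: le_ereal_sup => /= _ [h hf <-].
by exists h => // x; apply: (le_trans (hf x)); rewrite !funenegE; apply: maxS; rewrite leeN2.
Qed.

End le_integral_pointwise.

(** * Integration against product measures and measures with a density *)

Section nfold_integrals.
Context d (T : measurableType d) (R : realType).
Variable m : {sigma_finite_measure set T -> \bar R}.

Lemma measurable_prod_tnth n (f : 'I_n -> T -> R) :
  (forall i, measurable_fun setT (f i)) ->
  measurable_fun setT (fun t : n.-tuple T => \prod_(i < n) f i (tnth t i))%R.
Proof.
move=> mf; apply: measurable_prod => i _.
exact: (measurableT_comp (mf i) (measurable_tnth i)).
Qed.

Lemma ge0_integral_nfold_prod n (f : 'I_n -> T -> R) :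
  (forall i, measurable_fun setT (f i)) -> (forall i x, (0 <= f i x)%R) ->
  \int[nfold m n]_t (\prod_(i < n) f i (tnth t i))%:E =
  \prod_(i < n) \int[m]_x (f i x)%:E.
Proof.
elim: n f => [|n IH] f mf f0.
  rewrite big_ord0 (eq_measure_integral \d_([tuple] : 0.-tuple T))//.
  rewrite integral_dirac//; first by rewrite diracT mul1e big_ord0.
  apply/measurable_EFinP; under eq_fun do rewrite big_ord0; exact: measurable_cst.
have mF : measurable_fun setT
    (fun t : n.+1.-tuple T => (\prod_(i < n.+1) f i (tnth t i))%:E).
  by apply/measurable_EFinP; exact: measurable_prod_tnth.
have F0 (t : n.+1.-tuple T) : 0 <= (\prod_(i < n.+1) f i (tnth t i))%:E.
  by rewrite lee_fin prodr_ge0.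
pose g (i : 'I_n) := f (lift ord0 i).
have prodE (x : T) (t : n.-tuple T) :
    (\prod_(i < n.+1) f i (tnth (tcons (x, t)) i) =
     f ord0 x * \prod_(i < n) g i (tnth t i))%R.
  rewrite big_ord_recl; congr (_ * _)%R.
  by apply: eq_bigr => i _; rewrite /g /tcons; congr (f _ _); rewrite tnthS.
have mG : measurable_fun setT (fun p : T * n.-tuple T =>
    (\prod_(i < n.+1) f i (tnth (tcons p) i))%:E).
  exact: (measurableT_comp mF (@measurable_tcons _ T n)).
have E := ge0_integral_pushforward (@measurable_tcons _ T n)
  (m \x nfold m n) measurableT mF (fun t _ => F0 t).
(* [nfold m n.+1] unfolds to the pushforward [nfold_step m (nfold m n)], so the integral can be
   pulled back along [tcons] and split by Tonelli. *)
rewrite -[LHS]/(\int[nfold_step m (nfold m n)]_t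
  (\prod_(i < n.+1) f i (tnth t i))%:E).
transitivity (\int[m \x nfold m n]_x
   (\prod_(i < n.+1) f i (tnth (tcons x) i))%:E).
  rewrite preimage_setT in E; rewrite -[RHS]E.
  by refine (@eq_measure_integral _ _ _ setT _ _ _ _).
rewrite (fubini_tonelli1 _ mG (fun p => F0 (tcons p))).
rewrite /fubini_F big_ord_recl -(IH g (fun i => mf (lift ord0 i)) (fun i => f0 (lift ord0 i))) /=.
transitivity (\int[m]_x ((f ord0 x)%:E *
    \int[nfold m n]_t (\prod_(i < n) g i (tnth t i))%:E)).
  apply: eq_integral => x _; rewrite -ge0_integralZl//.
  - by apply: eq_integral => t _; rewrite prodE EFinM.
  - apply/measurable_EFinP; apply: measurable_prod_tnth => i; exact: mf.
  - by move=> t _; rewrite lee_fin prodr_ge0// => i _; exact: f0.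
  - by rewrite lee_fin.
rewrite ge0_integralZr//.
- exact/measurable_EFinP.
- by move=> x _; rewrite lee_fin.
- by apply: integral_ge0 => t _; rewrite lee_fin prodr_ge0// => i _; exact: f0.
Unshelve. all: exact: measurable_tcons. Qed.

End nfold_integrals.

Section density.
Context d (T : measurableType d) (R : realType).
Variables (mu nu : {measure set T -> \bar R}) (g : T -> R).
Hypothesis mg : measurable_fun setT g.
Hypothesis g0 : forall x, (0 <= g x)%R.
Hypothesis nuE : forall A, measurable A -> nu A = \int[mu]_(x in A) (g x)%:E.

Import HBNNSimple.

Let density_nnsfun (h : {nnsfun T >-> R}) :
  \int[nu]_x (h x)%:E = \int[mu]_x ((h x)%:E * (g x)%:E).
Proof.
under [LHS]eq_integral do rewrite fimfunE -fsumEFin//.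
rewrite [LHS]ge0_integral_fsum//; last 2 first.
  - by move=> r; exact/measurable_EFinP/measurableT_comp.
  - by move=> n x _; rewrite EFinM nnfun_muleindic_ge0.
under [RHS]eq_integral.
  move=> x xD; rewrite muleC fimfunE -fsumEFin// ge0_mule_fsumr; last first.
    by move=> r; rewrite EFinM nnfun_muleindic_ge0.
  over.
rewrite [RHS]ge0_integral_fsum//; last 2 first.
  - move=> r; apply: emeasurable_funM; first exact/measurable_EFinP.
    by apply/measurable_EFinP/measurableT_comp.
  - move=> n x _; apply: mule_ge0; first by rewrite lee_fin.
    by rewrite EFinM nnfun_muleindic_ge0.
apply: eq_fsbigr => r _.
rewrite integralZl_indic_nnsfun// integral_indic// setIT nuE//.
have [r0|r0] := ltP r 0%R.
  rewrite preimage_nnfun0// integral_set0 mule0; apply/esym/integral0_eq => x _.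
  by rewrite indic0 mulr0 mule0.
rewrite integral_mkcond.
rewrite -ge0_integralZl//.
- apply: eq_integral => x _; rewrite patchE indicE.
  by case: ifPn => _ /=; rewrite ?mulr1 ?mulr0 ?mule0// muleC.
- apply/(measurable_restrictT _ _).1 => //.
  by apply: measurable_funTS; exact/measurable_EFinP.
- by move=> x _; apply: erestrict_ge0 => t _; rewrite lee_fin.
Qed.

(** Simple functions, then monotone convergence. It turns an integral against a posterior, known
    only by its values on measurable sets, into one against the prior. *)
Lemma ge0_integral_density (f : T -> \bar R) :
  measurable_fun setT f -> (forall x, 0 <= f x) ->
  \int[nu]_x f x = \int[mu]_x (f x * (g x)%:E).
Proof.
move=> mf f0; pose f_ := nnsfun_approx measurableT mf.
transitivity (limn (fun n => \int[nu]_x (f_ n x)%:E)).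
  rewrite -monotone_convergence//=.
  - apply: eq_integral => x _; apply/esym/cvg_lim => //=.
    exact: cvg_nnsfun_approx.
  - by move=> n; exact/measurable_EFinP.
  - by move=> n x _; rewrite lee_fin.
  - by move=> x _ a b ab; rewrite lee_fin//; exact/lefP/nd_nnsfun_approx.
transitivity (limn (fun n => \int[mu]_x ((f_ n x)%:E * (g x)%:E))); last first.
  rewrite -monotone_convergence//=.
  - apply: eq_integral => x _; apply/cvg_lim => //.
    apply: cvgeZr => //; exact: cvg_nnsfun_approx.
  - by move=> n; apply: emeasurable_funM; exact/measurable_EFinP.
  - by move=> n x _; apply: mule_ge0; rewrite lee_fin.
  - move=> x _ a b ab; apply: lee_wpmul2r; rewrite lee_fin//.
    exact/lefP/nd_nnsfun_approx.
by congr (limn _); apply/funext => n; exact: density_nnsfun.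
Qed.

End density.

End integral_tools.

(** * Means under the Gaussian model and bounds of the risk *)

Section gaussian_expectation.
Context {R : realType}.
Implicit Types (n : nat).

Lemma sqrtr_neq0 (s2 : R) : 0 < s2 -> Num.sqrt s2 != 0.
Proof. by move=> s0; rewrite gt_eqF// sqrtr_gt0. Qed.

Lemma normal_pdf_gt0 (m s2 x : R) : 0 < s2 -> 0 < normal_pdf m (Num.sqrt s2) x.
Proof.
move=> s0; rewrite normal_pdfE ?sqrtr_neq0//.
by rewrite mulr_gt0 ?expR_gt0// normal_peak_gt0 ?sqrtr_neq0.
Qed.

Lemma gauss_pdf_gt0 n (theta x : vec R n) s2 : 0 < s2 -> 0 < gauss_pdf theta s2 x.
Proof. by move=> s0; apply: prodr_gt0 => i _; exact: normal_pdf_gt0. Qed.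

Lemma measurable_gauss_pdf n (theta : vec R n) s2 :
  measurable_fun setT (gauss_pdf theta s2).
Proof.
apply: (@measurable_prod_tnth _ (measurableTypeR R) R n
  (fun i => normal_pdf (tnth theta i) (Num.sqrt s2))) => i.
exact: measurable_normal_pdf.
Qed.

Local Open Scope ereal_scope.

Lemma ge0_integral_gauss_coord n (theta : vec R n) s2 (i : 'I_n) (f : R -> R) :
  measurable_fun setT f -> (forall x, (0 <= f x)%R) ->
  \int[@lebesgue_vec R n]_x (gauss_pdf theta s2 x * f (tnth x i))%:E =
  \int[lebesgue_measure]_t
    (normal_pdf (tnth theta i) (Num.sqrt s2) t * f t)%:E.
Proof.
move=> mf f0.
pose h (k : 'I_n) (t : measurableTypeR R) :=
  (normal_pdf (tnth theta k) (Num.sqrt s2) t * if k == i then f t else 1)%R.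
transitivity (\int[@lebesgue_vec R n]_x (\prod_(k < n) h k (tnth x k))%:E).
  apply: eq_integral => x _; rewrite big_split/=; congr (_ * _)%:E.
  by rewrite -big_mkcond/= big_pred1_eq.
rewrite ge0_integral_nfold_prod; last 2 first.
- move=> k; apply: measurable_funM; first exact: measurable_normal_pdf.
  by case: (k == i).
- by move=> k x; rewrite mulr_ge0 ?normal_pdf_ge0//; case: ifP.
rewrite (bigD1 i)//= big1 ?mule1; first by rewrite /h eqxx.
move=> k ki; rewrite -(integral_normal_pdf (tnth theta k) (Num.sqrt s2)).
by apply: eq_integral => x _; rewrite /h (negbTE ki) mulr1.
Qed.

Lemma integral_gauss_pdf n (theta : vec R n) s2 :
  \int[@lebesgue_vec R n]_x (gauss_pdf theta s2 x)%:E = 1.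
Proof.
rewrite (@ge0_integral_nfold_prod _ (measurableTypeR R) R _ n
  (fun i => normal_pdf (tnth theta i) (Num.sqrt s2))); last 2 first.
- by move=> k; exact: measurable_normal_pdf.
- by move=> k x; exact: normal_pdf_ge0.
by rewrite big1// => i _; exact: integral_normal_pdf.
Qed.

Lemma ge0_integrable d (T : measurableType d) (mu : {measure set T -> \bar R})
    (f : T -> R) (c : R) : measurable_fun setT f -> (forall x, (0 <= f x)%R) ->
  \int[mu]_x (f x)%:E = c%:E -> mu.-integrable setT (EFin \o f).
Proof.
move=> mf f0 fc; apply/integrableP; split; first exact/measurable_EFinP.
under eq_integral do rewrite /= ger0_norm//.
by rewrite fc ltry.
Qed.

Lemma integrable_gauss_pdf n (theta : vec R n) s2 :
  (@lebesgue_vec R n).-integrable setT (EFin \o gauss_pdf theta s2).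
Proof.
apply: (@ge0_integrable _ _ _ _ 1).
- exact: measurable_gauss_pdf.
- by move=> x; exact: gauss_pdf_ge0.
- exact: integral_gauss_pdf.
Qed.

(* [U X Y] is integrable with expectation [c] when X ~ N(theta, I) and
   Y ~ N(theta, r I) are independent, the integral being iterated as in
   [risk]. *)
Definition has_mean n r (theta : vec R n) (U : vec R n -> vec R n -> R) (c : R) :=
  exists F : vec R n -> R,
  [/\ forall x, (@lebesgue_vec R n).-integrable setT
        (fun y => (gauss_pdf theta r y * U x y)%:E),
      forall x, \int[@lebesgue_vec R n]_y (gauss_pdf theta r y * U x y)%:E =
        (F x)%:E,
      (@lebesgue_vec R n).-integrable setT
        (fun x => (F x * gauss_pdf theta 1 x)%:E) &
      \int[@lebesgue_vec R n]_x (F x * gauss_pdf theta 1 x)%:E = c%:E].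

Section has_mean_closure.
Variables (n : nat) (r : R) (theta : vec R n).
Notation has_mean := (has_mean r theta).

Lemma eq_has_mean U V a : (forall x y, U x y = V x y) -> has_mean U a ->
  has_mean V a.
Proof.
by move=> UV; rewrite (_ : U = V)//; apply/funext => x; apply/funext.
Qed.

Lemma has_meanD U V a b : has_mean U a -> has_mean V b ->
  has_mean (fun x y => U x y + V x y)%R (a + b).
Proof.
move=> [F [iU UF iF Fa]] [G [iV VG iG Gb]].
exists (fun x => F x + G x)%R; split.
- move=> x; apply: (eq_integrable _ (fun y => (gauss_pdf theta r y * U x y)%:E +
    (gauss_pdf theta r y * V x y)%:E)) => //.
    by move=> y _; rewrite -EFinD -mulrDr.
  exact: integrableD.
- move=> x; under eq_integral do rewrite mulrDr EFinD.
  by rewrite integralD// UF VG.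
- apply: (eq_integrable _ (fun x => (F x * gauss_pdf theta 1 x)%:E +
    (G x * gauss_pdf theta 1 x)%:E)) => //.
    by move=> x _; rewrite -EFinD -mulrDl.
  exact: integrableD.
- under eq_integral do rewrite mulrDl EFinD.
  by rewrite integralD// Fa Gb.
Qed.

Lemma has_meanZ k U a : has_mean U a -> has_mean (fun x y => k * U x y)%R (k * a).
Proof.
move=> [F [iU UF iF Fa]]; exists (fun x => k * F x)%R; split.
- move=> x; apply: (eq_integrable _
    (fun y => k%:E * (gauss_pdf theta r y * U x y)%:E)) => //.
    by move=> y _; rewrite -EFinM mulrCA.
  exact: integrableZl.
- move=> x; under eq_integral do rewrite mulrCA EFinM.
  by rewrite integralZl// UF.
- apply: (eq_integrable _
    (fun x => k%:E * (F x * gauss_pdf theta 1 x)%:E)) => //.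
    by move=> x _; rewrite -EFinM mulrA.
  exact: integrableZl.
- under eq_integral do rewrite -mulrA EFinM.
  by rewrite integralZl// Fa.
Qed.

Lemma has_mean_cst c : has_mean (fun _ _ => c) c.
Proof.
rewrite -[c in X in _ X](mulr1 c).
rewrite (_ : (fun _ _ => c) = (fun _ _ => c * 1)%R); last first.
  by apply/funext => x; apply/funext => y; rewrite mulr1.
apply: has_meanZ; exists (fun=> 1%R); split.
- move=> x; apply: (eq_integrable _ (EFin \o gauss_pdf theta r)) => //.
    by move=> y _ /=; rewrite mulr1.
  exact: integrable_gauss_pdf.
- move=> x; under eq_integral do rewrite mulr1.
  exact: integral_gauss_pdf.
- apply: (eq_integrable _ (EFin \o gauss_pdf theta 1)) => //.
    by move=> y _ /=; rewrite mul1r.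
  exact: integrable_gauss_pdf.
- under eq_integral do rewrite mul1r.
  exact: integral_gauss_pdf.
Qed.

Lemma has_mean_sum (I : Type) (s : seq I) (U : I -> vec R n -> vec R n -> R)
    (c : I -> R) : (forall i, has_mean (U i) (c i)) ->
  has_mean (fun x y => \sum_(i <- s) U i x y)%R (\sum_(i <- s) c i).
Proof.
move=> Uc; elim: s => [|i s IH].
  rewrite big_nil (_ : (fun _ _ => _) = (fun _ _ => 0%R)).
    exact: has_mean_cst.
  by apply/funext => x; apply/funext => y; rewrite big_nil.
rewrite big_cons (_ : (fun _ _ => _) =
  (fun x y => U i x y + \sum_(j <- s) U j x y)%R).
  exact: has_meanD.
by apply/funext => x; apply/funext => y; rewrite big_cons.
Qed.

Lemma has_mean_coord (i : 'I_n) (V : R -> R -> R) (F : R -> R) c :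
  (forall x, measurable_fun setT (V x)) -> (forall x y, 0 <= V x y)%R ->
  measurable_fun setT F -> (forall x, 0 <= F x)%R ->
  (forall x, \int[lebesgue_measure]_y
    (normal_pdf (tnth theta i) (Num.sqrt r) y * V x y)%:E = (F x)%:E) ->
  \int[lebesgue_measure]_x
    (normal_pdf (tnth theta i) (Num.sqrt 1) x * F x)%:E = c%:E ->
  has_mean (fun x y => V (tnth x i) (tnth y i)) c.
Proof.
move=> mV V0 mF F0 VF Fc; exists (fun x => F (tnth x i)).
have E1 x : \int[@lebesgue_vec R n]_y
    (gauss_pdf theta r y * V (tnth x i) (tnth y i))%:E = (F (tnth x i))%:E.
  by rewrite (ge0_integral_gauss_coord theta r i (mV _) (V0 _)) VF.
have E2 : \int[@lebesgue_vec R n]_x (F (tnth x i) * gauss_pdf theta 1 x)%:E = c%:E.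
  rewrite -Fc -ge0_integral_gauss_coord//.
  by apply: eq_integral => x _; rewrite mulrC.
split=> //.
- move=> x; apply: ge0_integrable (E1 x) => //.
    apply: measurable_funM; first exact: measurable_gauss_pdf.
    exact: (measurableT_comp (mV _) (measurable_tnth i)).
  by move=> y; rewrite mulr_ge0 ?gauss_pdf_ge0.
- apply: ge0_integrable E2 => //.
    apply: measurable_funM; last exact: measurable_gauss_pdf.
    exact: (measurableT_comp mF (measurable_tnth i)).
  by move=> y; rewrite mulr_ge0 ?gauss_pdf_ge0.
Qed.

End has_mean_closure.

Section risk_bounds.
Variables (n : nat) (r : R) (theta : vec R n) (phat U : vec R n -> vec R n -> R).
Variable c : R.
Hypothesis Uc : has_mean r theta U c.

(** [le_integral_pointwise] carries the bound through both integrals, so only the majorant [U] must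
    be integrable, not the loss. *)
Lemma risk_le :
  (forall x y, lne ((gauss_pdf theta r y)%:E / (phat x y)%:E) <= (U x y)%:E) ->
  risk r theta phat <= c%:E.
Proof.
move: Uc => [F [iU UF iF <-]] le_U; apply: le_integral_pointwise => x.
rewrite EFinM lee_wpmul2r// ?lee_fin ?gauss_pdf_ge0// -UF.
apply: le_integral_pointwise => y.
by rewrite EFinM lee_wpmul2l// lee_fin gauss_pdf_ge0.
Qed.

Lemma risk_ge :
  (forall x y, (U x y)%:E <= lne ((gauss_pdf theta r y)%:E / (phat x y)%:E)) ->
  c%:E <= risk r theta phat.
Proof.
move: Uc => [F [iU UF iF <-]] ge_U; apply: le_integral_pointwise => x.
rewrite EFinM lee_wpmul2r// ?lee_fin ?gauss_pdf_ge0// -UF.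
apply: le_integral_pointwise => y.
by rewrite EFinM lee_wpmul2l// lee_fin gauss_pdf_ge0.
Qed.

End risk_bounds.

Section product_estimator.
Variables (n : nat) (r : R) (theta : vec R n) (q : R -> R -> R).
Hypotheses (r0 : (0 < r)%R) (q0 : forall x y, (0 < q x y)%R).
Variables (u : 'I_n -> R -> R -> R) (c : 'I_n -> R).
Hypothesis uc :
  forall i, has_mean r theta (fun x y => u i (tnth x i) (tnth y i)) (c i).

Let phat (x y : vec R n) := (\prod_(i < n) q (tnth x i) (tnth y i))%R.

Let lne_phat x y : lne ((gauss_pdf theta r y)%:E / (phat x y)%:E) =
  (\sum_(i < n) ln (normal_pdf (tnth theta i) (Num.sqrt r) (tnth y i) /
                   q (tnth x i) (tnth y i)))%:E.
Proof.
have p0 : (0 < phat x y)%R by apply: prodr_gt0 => i _.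
rewrite inver gt_eqF// -EFinM lne_EFin ?divr_gt0 ?gauss_pdf_gt0//.
rewrite /phat /gauss_pdf -prodf_div; congr (_%:E).
have [//] : (0 < \prod_(i < n) (normal_pdf (tnth theta i) (Num.sqrt r) (tnth y i) /
      q (tnth x i) (tnth y i)) /\
  ln (\prod_(i < n) (normal_pdf (tnth theta i) (Num.sqrt r) (tnth y i) /
      q (tnth x i) (tnth y i))) =
  \sum_(i < n) ln (normal_pdf (tnth theta i) (Num.sqrt r) (tnth y i) /
      q (tnth x i) (tnth y i)))%R.
apply: (big_rec2 (fun a b : R => 0 < a /\ ln a = b)%R); first by rewrite ln1.
move=> i a b _ [b0 <-]; have p : (0 < normal_pdf (tnth theta i) (Num.sqrt r)
    (tnth y i) / q (tnth x i) (tnth y i))%R.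
  by rewrite divr_gt0 ?normal_pdf_gt0.
by rewrite mulr_gt0// lnM.
Qed.

Lemma risk_product_le :
  (forall i x y,
    (ln (normal_pdf (tnth theta i) (Num.sqrt r) y / q x y) <= u i x y)%R) ->
  risk r theta phat <= (\sum_(i < n) c i)%:E.
Proof.
move=> lu; apply: (risk_le (has_mean_sum (index_enum 'I_n) uc)) => x y.
by rewrite lne_phat lee_fin ler_sum.
Qed.

Lemma risk_product_ge :
  (forall i x y,
    (u i x y <= ln (normal_pdf (tnth theta i) (Num.sqrt r) y / q x y))%R) ->
  (\sum_(i < n) c i)%:E <= risk r theta phat.
Proof.
move=> lu; apply: (risk_ge (has_mean_sum (index_enum 'I_n) uc)) => x y.
by rewrite lne_phat lee_fin ler_sum.
Qed.

End product_estimator.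

End gaussian_expectation.

(** * Gaussian exponential moments *)

Section gaussian_moments.
Context {R : realType}.
Implicit Types m t a tau : R.

Lemma normal_pdf_sqrtE m (s2 x : R) : 0 < s2 ->
  normal_pdf m (Num.sqrt s2) x =
  normal_peak (Num.sqrt s2) * expR (- (x - m) ^+ 2 / (2 * s2)).
Proof.
move=> s0; rewrite normal_pdfE ?sqrtr_neq0//; congr (_ * expR (_ / _)).
by rewrite sqr_sqrtr ?(ltW s0)// mulr_natl.
Qed.

Lemma normal_pdf_tilt tau (s2 : R) t : 0 < s2 ->
  normal_pdf 0 (Num.sqrt s2) t * expR (tau * t / s2 - tau ^+ 2 / (2 * s2)) =
  normal_pdf tau (Num.sqrt s2) t.
Proof.
move=> s0; rewrite !normal_pdf_sqrtE// -(mulrA (normal_peak _)) -expRD; congr (_ * expR _).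
by field; rewrite gt_eqF.
Qed.

(** The fraction [a] of the Gaussian exponent is cancelled, which leaves, up to normalisation, a
    Gaussian of variance [s2 / (1 - a)]. *)
Lemma normal_pdf_expR_sqr m (s2 : R) a t : 0 < s2 -> a < 1 ->
  normal_pdf m (Num.sqrt s2) t * expR (a * (t - m) ^+ 2 / (2 * s2)) =
  (Num.sqrt (1 - a))^-1 * normal_pdf m (Num.sqrt (s2 / (1 - a))) t.
Proof.
move=> s0 a1; have b0 : 0 < 1 - a by rewrite subr_gt0.
have sb0 : 0 < s2 / (1 - a) by rewrite divr_gt0.
rewrite !normal_pdf_sqrtE// -(mulrA (normal_peak _)) -expRD mulrA; congr (_ * expR _).
  rewrite /normal_peak -invfM !sqr_sqrtr ?ltW// -sqrtrM ?(ltW b0)//.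
  by congr (Num.sqrt _)^-1; field; rewrite gt_eqF.
by field; rewrite !gt_eqF.
Qed.

Local Open Scope ereal_scope.

Lemma integral_normal_expR_sqr m (s2 : R) a : (0 < s2)%R -> (a < 1)%R ->
  \int[lebesgue_measure]_t (normal_pdf m (Num.sqrt s2) t *
    expR (a * (t - m) ^+ 2 / (2 * s2)))%:E = ((Num.sqrt (1 - a))^-1)%:E.
Proof.
move=> s0 a1; under eq_integral do rewrite normal_pdf_expR_sqr// EFinM.
rewrite ge0_integralZl//=.
- by rewrite integral_normal_pdf mule1.
- by apply/measurable_EFinP; exact: measurable_normal_pdf.
- by move=> x _; rewrite lee_fin normal_pdf_ge0.
Qed.

Lemma integral_normal_tilt tau (s2 : R) : (0 < s2)%R ->
  \int[lebesgue_measure]_t (normal_pdf 0 (Num.sqrt s2) t *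
    expR (tau * t / s2 - tau ^+ 2 / (2 * s2)))%:E = 1.
Proof.
move=> s0; rewrite -(integral_normal_pdf tau (Num.sqrt s2)).
by apply: eq_integral => t _; rewrite normal_pdf_tilt.
Qed.

Lemma measurable_expR_tilt tau (s2 : R) :
  measurable_fun setT (fun t => expR (tau * t / s2 - tau ^+ 2 / (2 * s2)))%R.
Proof.
apply: measurableT_comp => //; apply: measurable_funB => //.
by apply: measurable_funM => //; apply: measurable_funM.
Qed.

Lemma measurable_expR_sqr m (s2 : R) a :
  measurable_fun setT (fun t => expR (a * (t - m) ^+ 2 / (2 * s2)))%R.
Proof.
apply: measurableT_comp => //; apply: measurable_funM => //.
apply: measurable_funM => //; apply: measurable_funX.
exact: measurable_funB.
Qed.

Variables (n : nat) (r : R) (theta : vec R n) (i : 'I_n).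
Hypothesis r0 : (0 < r)%R.

Lemma has_mean_xy (f g : R -> R) c d :
  measurable_fun setT f -> (forall x, 0 <= f x)%R ->
  measurable_fun setT g -> (forall x, 0 <= g x)%R ->
  \int[lebesgue_measure]_x
    (normal_pdf (tnth theta i) (Num.sqrt 1) x * f x)%:E = c%:E ->
  \int[lebesgue_measure]_y
    (normal_pdf (tnth theta i) (Num.sqrt r) y * g y)%:E = d%:E ->
  has_mean r theta (fun x y => f (tnth x i) * g (tnth y i))%R (c * d).
Proof.
move=> mf f0 mg g0 fc gd.
have d0 : (0 <= d)%R.
  rewrite -lee_fin -gd; apply: integral_ge0 => y _.
  by rewrite lee_fin mulr_ge0 ?normal_pdf_ge0.
apply: (@has_mean_coord _ _ _ _ _ (fun s t => f s * g t)%R (fun s => f s * d)%R) => //.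
- by move=> x; apply: measurable_funM.
- by move=> x y; rewrite mulr_ge0.
- by apply: measurable_funM.
- by move=> x; rewrite mulr_ge0.
- move=> x; under eq_integral do rewrite mulrCA EFinM.
  rewrite ge0_integralZl//= ?gd//.
  + apply/measurable_EFinP; apply: measurable_funM => //.
    exact: measurable_normal_pdf.
  + by move=> y _; rewrite lee_fin mulr_ge0 ?normal_pdf_ge0.
  + by rewrite lee_fin.
- under eq_integral do rewrite mulrA EFinM.
  rewrite ge0_integralZr//= ?fc//.
  + apply/measurable_EFinP; apply: measurable_funM => //.
    exact: measurable_normal_pdf.
  + by move=> y _; rewrite lee_fin mulr_ge0 ?normal_pdf_ge0.
Qed.

Lemma has_mean_x (f : R -> R) c :
  measurable_fun setT f -> (forall x, 0 <= f x)%R ->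
  \int[lebesgue_measure]_x
    (normal_pdf (tnth theta i) (Num.sqrt 1) x * f x)%:E = c%:E ->
  has_mean r theta (fun x y => f (tnth x i)) c.
Proof.
move=> mf f0 fc; rewrite -[c]mulr1.
apply: (@eq_has_mean _ _ _ _ (fun x y => f (tnth x i) * cst 1 (tnth y i))%R).
  by move=> x y; rewrite mulr1.
apply: has_mean_xy => //.
by under eq_integral do rewrite mulr1; exact: integral_normal_pdf.
Qed.

Lemma has_mean_y (g : R -> R) c :
  measurable_fun setT g -> (forall x, 0 <= g x)%R ->
  \int[lebesgue_measure]_y
    (normal_pdf (tnth theta i) (Num.sqrt r) y * g y)%:E = c%:E ->
  has_mean r theta (fun x y => g (tnth y i)) c.
Proof.
move=> mg g0 gc; rewrite -[c]mul1r.
apply: (@eq_has_mean _ _ _ _ (fun x y => cst 1 (tnth x i) * g (tnth y i))%R).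
  by move=> x y; rewrite mul1r.
apply: has_mean_xy => //.
by under eq_integral do rewrite mulr1; exact: integral_normal_pdf.
Qed.

(* An upper bound of the squared deviations whose mean is explicit: Gaussian
   exponentials are the only moments computed here. *)
Definition dev (t x y : R) : R :=
  (4 * expR (2^-1 * (x - t) ^+ 2 / (2 * 1)) +
   4 * r * expR (2^-1 * (y - t) ^+ 2 / (2 * r)))%R.

(** [expR z >= z] at [z = w ^+ 2 / (4 * s2)] for the variances [1] and [r], whence the factors [4]
    and [4 * r] in [dev]. *)
Lemma sqr_le_dev (t x y : R) : ((x - t) ^+ 2 + (y - t) ^+ 2 <= dev t x y)%R.
Proof.
apply: lerD.
  have := expR_ge1Dx (2^-1 * (x - t) ^+ 2 / (2 * 1))%R.
  by have := sqr_ge0 (x - t)%R; lra.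
set w := (y - t)%R.
have -> : (2^-1 * w ^+ 2 / (2 * r) = r^-1 * (4^-1 * w ^+ 2))%R.
  by field; rewrite gt_eqF.
have h := expR_ge1Dx (r^-1 * (4^-1 * w ^+ 2))%R.
have {}h : (r^-1 * (4^-1 * w ^+ 2) <= expR (r^-1 * (4^-1 * w ^+ 2)))%R.
  by apply: le_trans h; rewrite lerDr.
have := ler_wpM2l (ltW r0) h; rewrite mulVKf ?gt_eqF//.
by lra.
Qed.

Definition dev_mean : R := (4 * (1 + r) * (Num.sqrt (1 - 2^-1))^-1)%R.

Lemma dev_mean_ge0 : (0 <= dev_mean)%R.
Proof. by rewrite /dev_mean mulr_ge0 ?invr_ge0 ?sqrtr_ge0// mulr_ge0// addr_ge0// ltW. Qed.

Lemma has_mean_dev :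
  has_mean r theta (fun x y => dev (tnth theta i) (tnth x i) (tnth y i)) dev_mean.
Proof.
have h : (2^-1 < 1 :> R)%R by lra.
have -> : dev_mean = (4 * (Num.sqrt (1 - 2^-1))^-1 +
  4 * r * (Num.sqrt (1 - 2^-1))^-1)%R by rewrite /dev_mean; ring.
apply: has_meanD; apply: has_meanZ.
  apply: (@has_mean_x (fun x => expR (2^-1 * (x - _) ^+ 2 / (2 * 1)))%R).
  - exact: measurable_expR_sqr.
  - by move=> x; exact: expR_ge0.
  - exact: integral_normal_expR_sqr.
apply: (@has_mean_y (fun x => expR (2^-1 * (x - _) ^+ 2 / (2 * r)))%R).
- exact: measurable_expR_sqr.
- by move=> x; exact: expR_ge0.
- exact: integral_normal_expR_sqr.
Qed.

End gaussian_moments.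

(** * Integration against the grid prior *)

Section grid_integral.
Context {R : realType}.
Variables r eta : R.
Hypotheses (r0 : 0 < r) (eta0 : 0 < eta) (eta1 : eta < 1).

Local Notation v := (grid_v r).
Local Notation lambda := (grid_spacing r eta).

Lemma grid_v_gt0 : 0 < v.
Proof. by rewrite invr_gt0 addr_gt0// invr_gt0. Qed.

Lemma powR_lt1 (p : R) : 0 < p -> eta `^ p < 1.
Proof.
move=> p0; rewrite /powR gt_eqF// -[ltRHS]expR0 ltr_expR.
by rewrite pmulr_rlt0 ?ln_lt0 ?eta0.
Qed.

Let c0 : 0 <= 1 - eta. Proof. by rewrite subr_ge0 ltW. Qed.

Let c1 : 0 <= eta / 2 * (1 - eta `^ v).
Proof.
by rewrite mulr_ge0 ?divr_ge0 ?(ltW eta0)// subr_ge0 ltW ?powR_lt1 ?grid_v_gt0.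
Qed.

Let atom (sg : R) (j : nat) : {measure set (measurableTypeR R) -> \bar R} :=
  mscale (NngNum (powR_ge0 eta (j%:R * v)))
    \d_(sg * (lambda * j.+1%:R) : measurableTypeR R).

Let branch sg : {measure set (measurableTypeR R) -> \bar R} :=
  mseries (atom sg) 0.

Let grid_measure : {measure set (measurableTypeR R) -> \bar R} :=
  measure_add (mscale (NngNum c0) \d_(0 : measurableTypeR R))
    (mscale (NngNum c1) (measure_add (branch 1) (branch (-1)))).

Let branchE (sg : R) A : branch sg A =
  (\sum_(1 <= j <oo) ((eta `^ ((j%:R - 1) * v))%:E *
     \d_(sg * (lambda * j%:R))%R A))%E.
Proof.
rewrite /branch /= /mseries -[RHS]nneseries_addn.
  apply: eq_eseriesr => j _; rewrite addn1 /atom /mscale/=.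
  by rewrite -natr1 addrK.
by move=> j; rewrite mule_ge0// lee_fin powR_ge0.
Qed.

Let grid_priorE A : grid_prior r eta A = grid_measure A.
Proof.
rewrite /grid_measure [RHS]measure_addE /grid_prior r0 eta0 eta1 /=.
rewrite /mscale/=; congr (_ + _)%E.
rewrite -[X in _ = (_ * X)%E]/(measure_add (branch 1) (branch (-1)) A).
rewrite measure_addE !branchE [in RHS]EFinM -[RHS]muleA; congr (_ * _)%E.
rewrite /grid_pos /grid_neg /pushforward/= -ge0_muleDr//; first last.
- by apply: nneseries_ge0 => j _ _; rewrite mule_ge0// lee_fin powR_ge0.
- by apply: nneseries_ge0 => j _ _; rewrite mule_ge0// lee_fin powR_ge0.
congr (_ * (_ + _))%E; apply: eq_eseriesr => j _; first by rewrite mul1r.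
by rewrite mulN1r.
Qed.

Local Open Scope ereal_scope.

Lemma ge0_integral_grid (f : R -> R) :
  measurable_fun setT f -> (forall x, 0 <= f x)%R ->
  \int[grid_prior r eta]_x (f x)%:E = (1 - eta)%:E * (f 0%R)%:E +
   (eta / 2 * (1 - eta `^ v))%:E *
   \sum_(j <oo) (eta `^ (j%:R * v) * (f (lambda * j.+1%:R) +
                                     f (- (lambda * j.+1%:R))))%:E.
Proof.
move=> mf f0; rewrite (eq_measure_integral grid_measure); last first.
  by move=> A mA _; exact: grid_priorE.
have mF : measurable_fun setT (fun x : measurableTypeR R => (f x)%:E).
  exact/measurable_EFinP.
have F0 (x : measurableTypeR R) : setT x -> 0 <= (f x)%:E.
  by move=> _; rewrite lee_fin.
have intd (a : measurableTypeR R) : \int[\d_a]_x (f x)%:E = (f a)%:E.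
  by rewrite integral_dirac// diracT mul1e.
rewrite ge0_integral_measure_add// !ge0_integral_mscale// intd.
congr (_ + _ * _); rewrite ge0_integral_measure_add//.
rewrite !ge0_integral_measure_series// -nneseriesD.
- apply: eq_eseriesr => j _; rewrite !ge0_integral_mscale// !intd /=.
  by rewrite -!EFinM -EFinD mul1r mulN1r mulrDr.
- by move=> i _ _; apply: integral_ge0.
- by move=> i _ _; apply: integral_ge0.
Qed.

Lemma grid_integral_le (f : R -> R) (B : R) :
  measurable_fun setT f -> (forall x, 0 <= f x)%R ->
  (forall N, (1 - eta) * f 0 + eta / 2 * (1 - eta `^ v) *
     \sum_(0 <= j < N) (eta `^ (j%:R * v) *
        (f (lambda * j.+1%:R) + f (- (lambda * j.+1%:R)))) <= B)%R ->
  \int[grid_prior r eta]_x (f x)%:E <= B%:E.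
Proof.
move=> mf f0 le_B; rewrite ge0_integral_grid//.
rewrite -nneseriesZl; last first.
  by move=> j _; rewrite lee_fin mulr_ge0 ?powR_ge0 ?addr_ge0.
rewrite -EFinM -leeBrDl//; apply: lime_le.
  by apply: is_cvg_nneseries => j _ _; rewrite mule_ge0// lee_fin//
    mulr_ge0 ?powR_ge0 ?addr_ge0.
apply: nearW => N.
under eq_bigr do rewrite -EFinM.
rewrite sumEFin -EFinB lee_fin -mulr_sumr lerBrDl; exact: le_B.
Qed.

Lemma grid_integral_ge_atom0 (f : R -> R) :
  measurable_fun setT f -> (forall x, 0 <= f x)%R ->
  ((1 - eta) * f 0)%:E <= \int[grid_prior r eta]_x (f x)%:E.
Proof.
move=> mf f0; rewrite ge0_integral_grid// EFinM leeDl// mule_ge0//.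
by apply: nneseries_ge0 => j _ _; rewrite lee_fin mulr_ge0 ?powR_ge0 ?addr_ge0.
Qed.

Lemma grid_integral_ge_atom (f : R -> R) (sg : R) (k : nat) :
  measurable_fun setT f -> (forall x, 0 <= f x)%R -> (sg = 1 \/ sg = -1)%R ->
  (eta / 2 * (1 - eta `^ v) * (eta `^ (k%:R * v) *
    f (sg * (lambda * k.+1%:R))))%:E <= \int[grid_prior r eta]_x (f x)%:E.
Proof.
move=> mf f0 sgE; rewrite ge0_integral_grid//.
rewrite -[leLHS]add0e EFinM; apply: leeD.
  by rewrite mule_ge0// lee_fin.
apply: lee_wpmul2l; first by rewrite lee_fin.
have u0 j : 0 <= (eta `^ (j%:R * v) * (f (lambda * j.+1%:R) +
    f (- (lambda * j.+1%:R))))%:E.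
  by rewrite lee_fin mulr_ge0 ?powR_ge0 ?addr_ge0.
apply: (le_trans _ (nneseries_lim_ge k.+1 (fun n _ _ => u0 n))).
rewrite big_nat_recr//= -[leLHS]add0e; apply: leeD.
  by apply: sume_ge0.
rewrite lee_fin ler_wpM2l ?powR_ge0//.
by case: sgE => ->; rewrite ?mul1r ?mulN1r ?lerDl ?lerDr.
Qed.

End grid_integral.

Lemma probability_integral_bounded {R : realType} d (T : measurableType d)
    (P : probability T R) (f : T -> R) (B : R) :
  (forall x, 0 <= f x <= B)%R ->
  (\int[P]_m (f m)%:E = (\int[P]_m f m)%R%:E)%E.
Proof.
move=> fB; rewrite /Rintegral fineK// ge0_fin_numE; last first.
  by apply: integral_ge0 => x _; rewrite lee_fin; case/andP: (fB x).
apply: (@le_lt_trans _ _ (\int[P]_m (cst B%:E m))%E).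
  by apply: le_integral_pointwise => x; rewrite lee_fin; case/andP: (fB x).
rewrite integral_cst// [X in (_ * X)%E](_ : _ = 1%E) ?mule1 ?ltry//.
exact: probability_setT.
Qed.

Lemma mnormalizeE {R : realType} d (T : measurableType d)
    (mu : {measure set T -> \bar R}) (P : probability T R) (c : R) (A : set T) :
  mu setT = c%:E -> 0 < c -> mnormalize mu P A = (mu A * (c^-1)%:E)%E.
Proof. by move=> muT c0; rewrite /mnormalize muT orbF eqe gt_eqF. Qed.

(** * One-dimensional marginals and the posterior of a product prior *)

Section mixtures.
Context {R : realType}.
Variable P : probability (measurableTypeR R) R.

Lemma normal_pdf_sym (m s x : R) : s != 0 -> normal_pdf m s x = normal_pdf x s m.
Proof.
by move=> s0; rewrite !normal_pdfE// /normal_fun -[in RHS]sqrrN opprB.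
Qed.

Lemma measurable_normal_pdf_mean (s2 x : R) : 0 < s2 ->
  measurable_fun setT (fun m => normal_pdf m (Num.sqrt s2) x).
Proof.
move=> s0; rewrite (_ : (fun _ => _) = normal_pdf x (Num.sqrt s2)).
  exact: measurable_normal_pdf.
by apply/funext => m; rewrite normal_pdf_sym ?sqrtr_neq0.
Qed.

(** The marginal density of one coordinate of [X] under the prior [P]; [mix2] is that of a
    coordinate of the pair. *)
Definition mix1 (x : R) : R := \int[P]_m normal_pdf m (Num.sqrt 1) x.

Definition mix2 (r x y : R) : R :=
  \int[P]_m (normal_pdf m (Num.sqrt 1) x * normal_pdf m (Num.sqrt r) y).

Local Open Scope ereal_scope.

Lemma mix1E x : \int[P]_m (normal_pdf m (Num.sqrt 1) x)%:E = (mix1 x)%:E.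
Proof.
apply: (@probability_integral_bounded _ _ _ _ _ (normal_peak (Num.sqrt 1))).
by move=> m; rewrite normal_pdf_ge0 normal_pdf_ub// sqrtr_neq0.
Qed.

Lemma measurable_mix2_integrand (r x y : R) : (0 < r)%R -> measurable_fun setT
  (fun m => normal_pdf m (Num.sqrt 1) x * normal_pdf m (Num.sqrt r) y)%R.
Proof.
by move=> r0; apply: measurable_funM; exact: measurable_normal_pdf_mean.
Qed.

Lemma mix2E (r x y : R) : (0 < r)%R ->
  \int[P]_m (normal_pdf m (Num.sqrt 1) x * normal_pdf m (Num.sqrt r) y)%:E =
  (mix2 r x y)%:E.
Proof.
move=> r0; apply: (@probability_integral_bounded _ _ _ _ _
  (normal_peak (Num.sqrt 1) * normal_peak (Num.sqrt r))%R).
by move=> m; rewrite mulr_ge0 ?normal_pdf_ge0// ler_pM ?normal_pdf_ge0//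
  normal_pdf_ub// sqrtr_neq0.
Qed.

Lemma mix1_ge0 x : (0 <= mix1 x)%R.
Proof.
by rewrite -lee_fin -mix1E; apply: integral_ge0 => m _; rewrite lee_fin normal_pdf_ge0.
Qed.

Lemma mix2_ge0 (r x y : R) : (0 < r)%R -> (0 <= mix2 r x y)%R.
Proof.
move=> r0; rewrite -lee_fin -mix2E//; apply: integral_ge0 => m _.
by rewrite lee_fin mulr_ge0 ?normal_pdf_ge0.
Qed.

Hypothesis mix1_gt0 : forall x, (0 < mix1 x)%R.

(** Prior and likelihoods are products, hence so are the evidence and the predictive integral.
    Positivity of [mix1] makes the evidence positive, so [mnormalize] divides by it and does not
    return its default. *)
Lemma bayes_density_nfold n (r : R) (x y : vec R n) : (0 < r)%R ->
  bayes_density r (nfold P n : probability (vec R n) R) x y =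
  (\prod_(i < n) (mix2 r (tnth x i) (tnth y i) / mix1 (tnth x i)))%R.
Proof.
move=> r0.
pose prior := nfold P n : probability (vec R n) R.
have evE : joint prior x setT = (\prod_(i < n) mix1 (tnth x i))%:E.
  rewrite /joint [LHS](@ge0_integral_nfold_prod _ (measurableTypeR R) R P n
    (fun i m => normal_pdf m (Num.sqrt 1) (tnth x i))).
  - by rewrite -prodEFin; apply: eq_bigr => i _; rewrite mix1E.
  - by move=> i; exact: measurable_normal_pdf_mean.
  - by move=> i m; exact: normal_pdf_ge0.
have ev0 : (0 < \prod_(i < n) mix1 (tnth x i))%R by exact: prodr_gt0.
set ev := (\prod_(i < n) mix1 (tnth x i))%R in evE ev0.
have g0 (theta : vec R n) : (0 <= gauss_pdf theta 1 x / ev)%R.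
  by rewrite divr_ge0 ?gauss_pdf_ge0// ltW.
have mg : measurable_fun setT (fun theta => gauss_pdf theta 1 x / ev)%R.
  by apply: measurable_funM => //; exact: measurable_gauss_pdf_mean.
have postE A : measurable A -> posterior prior x A =
    \int[prior]_(theta in A) (gauss_pdf theta 1 x / ev)%:E.
  move=> mA; rewrite [LHS](mnormalizeE _ _ evE ev0).
  rewrite [X in (X * _)%E](_ : _ =
    \int[prior]_(theta in A) (gauss_pdf theta 1 x)%:E)//.
  under [RHS]eq_integral do rewrite EFinM.
  rewrite ge0_integralZr//.
  - apply: measurable_funTS; apply/measurable_EFinP.
    exact: measurable_gauss_pdf_mean.
  - by move=> t _; rewrite lee_fin gauss_pdf_ge0.
  - by rewrite lee_fin invr_ge0 ltW.
rewrite /bayes_density /Rintegral.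
rewrite (ge0_integral_density mg g0 postE); last 2 first.
- apply/measurable_EFinP; exact: measurable_gauss_pdf_mean.
- by move=> t; rewrite lee_fin gauss_pdf_ge0.
have -> : \int[prior]_t ((gauss_pdf t r y)%:E * (gauss_pdf t 1 x / ev)%:E) =
    (ev^-1)%:E * \int[prior]_t (\prod_(i < n)
      (normal_pdf (tnth t i) (Num.sqrt 1) (tnth x i) *
       normal_pdf (tnth t i) (Num.sqrt r) (tnth y i)))%:E.
  rewrite -ge0_integralZl//.
  - apply: eq_integral => t _; rewrite -!EFinM big_split/=; congr (_%:E).
    by rewrite -/(gauss_pdf t 1 x) -/(gauss_pdf t r y); ring.
  - apply/measurable_EFinP.
    apply: (@measurable_prod_tnth _ (measurableTypeR R) R n
      (fun i m => normal_pdf m (Num.sqrt 1) (tnth x i) *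
        normal_pdf m (Num.sqrt r) (tnth y i))%R) => i.
    exact: measurable_mix2_integrand.
  - move=> t _; rewrite lee_fin; apply: prodr_ge0 => i _.
    by rewrite mulr_ge0 ?normal_pdf_ge0.
  - by rewrite lee_fin invr_ge0 ltW.
rewrite (@ge0_integral_nfold_prod _ (measurableTypeR R) R P n
    (fun i m => normal_pdf m (Num.sqrt 1) (tnth x i) *
        normal_pdf m (Num.sqrt r) (tnth y i))%R); last 2 first.
- by move=> i; exact: measurable_mix2_integrand.
- by move=> i m; rewrite mulr_ge0 ?normal_pdf_ge0.
under eq_bigr do rewrite (mix2E _ _ r0).
by rewrite prodEFin -EFinM /= prodf_div mulrC.
Qed.

End mixtures.

(** * Comparison of the exponents of the two mixtures *)

Section grid_exponents.
Context {R : realType}.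
Variable v : R.

(* With L = - ln eta, the atom [lambda k] of the grid prior has mass of order
   [expR (- L * atom_exp k)]. *)
Definition atom_exp (k : nat) : R := if k is k'.+1 then 1 + k'%:R * v else 0.

(** The second value is taken at [alpha = 2 - (1 - v) / 2], where the pair passes from the first to
    the second nonzero atom; the subtracted [v * alpha ^+ 2] is the exponent of the null atom for
    [X]. The first value is the same difference at [alpha = 1]. *)
Definition grid_rate : R :=
  Num.max (1 - v) (1 + v + ((1 - v) / 2) ^+ 2 - v * (2 - (1 - v) / 2) ^+ 2).

(* The distance from j to the pair {k - 1, k}; both subtractions are truncated
   and at most one is nonzero. *)
Definition grid_dist (k j : nat) : nat := (j - k) + (k.-1 - j).


Lemma grid_rate_ge : 1 - v <= grid_rate.
Proof. by rewrite /grid_rate le_max lexx. Qed.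

Lemma grid_rate_ge2 (u : R) (uE : u = (1 - v) / 2) : 1 + v + u ^+ 2 - v * (2 - u) ^+ 2 <= grid_rate.
Proof. by rewrite /grid_rate le_max -uE lexx orbT. Qed.

Lemma half_gap_itv (u : R) (v0 : 0 < v) (v1 : v < 1) (uE : u = (1 - v) / 2) : 0 < u < 2^-1.
Proof. by rewrite uE; apply/andP; split; lra. Qed.

Lemma sqr_offset_le1 (u : R) (v0 : 0 < v) (v1 : v < 1) (uE : u = (1 - v) / 2) (w : R) : - u <= w -> w <= 1 - u -> w ^+ 2 <= 1.
Proof.
move=> wu w1; case/andP: (half_gap_itv v0 v1 uE) => a b.
have A : 0 <= (1 - w) * (1 + w) by apply: mulr_ge0; lra.
by rewrite -subr_ge0 (_ : 1 - w ^+ 2 = (1 - w) * (1 + w))//; ring.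
Qed.

(** The left side is convex in [w], with leading coefficient [1 - v = 2 * u], so it lies below its
    chord. Its end values are the two arguments of the maximum in [grid_rate], because
    [(1 - u) ^+ 2 = v + u ^+ 2]. *)
Lemma grid_rate_from_atom1 (u : R) (v0 : 0 < v) (v1 : v < 1) (uE : u = (1 - v) / 2) (w : R) : 0 <= w -> w <= 1 - u ->
  1 + w ^+ 2 - v * (1 + w) ^+ 2 <= grid_rate.
Proof.
move=> w0 wu.
pose t := w / (1 - u).
have u1 : 0 < 1 - u by case/andP: (half_gap_itv v0 v1 uE) => a b; lra.
have wE : w = t * (1 - u) by rewrite /t divfK// gt_eqF.
have t0 : 0 <= t by rewrite divr_ge0// ltW.
have t1 : t <= 1 by rewrite ler_pdivrMr// mul1r.
clearbody t; have H1 := grid_rate_ge; have H2 := grid_rate_ge2 uE.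
have {H1} H1 : (1 - t) * (1 - v) <= (1 - t) * grid_rate.
  by apply: ler_wpM2l => //; rewrite subr_ge0.
have {H2} H2 := ler_wpM2l t0 H2.
have vE : v = 1 - 2 * u by rewrite uE; field.
have -> : grid_rate = (1 - t) * grid_rate + t * grid_rate by ring.
apply: le_trans (lerD H1 H2); rewrite -subr_ge0.
rewrite [X in _ <= X](_ : _ = 2 * u * (1 - u) ^+ 2 * (t * (1 - t))).
  case/andP: (half_gap_itv v0 v1 uE) => a _.
  apply: mulr_ge0; last by apply: mulr_ge0; rewrite ?subr_ge0.
  by apply: mulr_ge0; [lra|exact: sqr_ge0].
by rewrite wE vE; ring.
Qed.

(** Here the left end [w = - u], the tie with the first atom, already gives the largest value:
    beyond it the null atom loses weight for [X] faster than the pair exponent grows. *)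
Lemma grid_rate_from_atom2 (u : R) (v0 : 0 < v) (v1 : v < 1) (uE : u = (1 - v) / 2) (w : R) : - u <= w -> w <= 1 - u ->
  1 + v + w ^+ 2 - v * (2 + w) ^+ 2 <= grid_rate.
Proof.
move=> wu w1; apply: le_trans (grid_rate_ge2 uE).
pose t := w + u.
have wE : w = t - u by rewrite /t; ring.
have t0 : 0 <= t by rewrite /t; lra.
have t1 : t <= 1 by rewrite /t; lra.
clearbody t.
have vE : v = 1 - 2 * u by rewrite uE; field.
case/andP: (half_gap_itv v0 v1 uE) => a b.
rewrite -subr_ge0 wE.
rewrite [X in _ <= X](_ : _ =
  t * v * (4 + v) - t * v + 2 * u * (t * (1 - t))); last by rewrite vE; ring.
have A : 0 <= t * v by rewrite mulr_ge0// ltW.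
have B : 0 <= u * (t * (1 - t)).
  by apply: mulr_ge0; [exact: ltW|apply: mulr_ge0; rewrite ?subr_ge0].
nra.
Qed.

(** [k] minimises the exponent of the pair at [xi]. The other two conclusions compare it with the
    exponents of [X]: at the null atom, and at the remaining atoms with a linear slack that makes
    their sum geometric. The minimum for [X] among nonzero atoms is at [k.-1] or [k], hence
    [grid_dist]. The slack [v ^+ 2 * (1 - v)] is below both available ones, [v * (1 - v)] above [k]
    and [v ^+ 2] below [k.-1]. *)
Lemma grid_index (v0 : 0 < v) (v1 : v < 1) (xi : R) : 0 <= xi -> exists k : nat,
  [/\ (xi - k%:R) ^+ 2 <= 1,
      atom_exp k + (xi - k%:R) ^+ 2 - v * xi ^+ 2 <= grid_rate &
      forall i : nat, atom_exp k + (xi - k%:R) ^+ 2 -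
          (atom_exp i.+1 + v * (xi - i.+1%:R) ^+ 2) <=
        grid_rate - v ^+ 2 * (1 - v) * (grid_dist k i.+1)%:R].
Proof.
move=> xi0; pose u := (1 - v) / 2; have uE : u = (1 - v) / 2 by [].
have := half_gap_itv v0 v1 uE; have := uE; move: u uE => u uE _ _; have Hge := grid_rate_ge; case/andP: (half_gap_itv v0 v1 uE) => ua ub.
have cv : v ^+ 2 * (1 - v) <= v.
  by rewrite expr2 -mulrA ler_piMr ?(ltW v0)//; nra.
have cv1 : v ^+ 2 * (1 - v) <= 1 - v.
  rewrite ler_piMl ?subr_ge0 ?(ltW v1)// expr2; nra.
have [xi1|xi1] := leP xi 1.
  exists 0%N; rewrite subr0 /=; split.
  - by rewrite expr_le1.
  - apply: le_trans Hge; rewrite add0r.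
    have : xi ^+ 2 <= 1 by rewrite expr_le1.
    by move=> h; have := ler_wpM2l (ltW (etrans (subr_gt0 _ _) v1)) h; lra.
  - move=> i; rewrite /grid_dist subn0 sub0n addn0.
    have h : xi ^+ 2 <= 1 by rewrite expr_le1.
    have h2 : 0 <= v * (xi - i.+1%:R) ^+ 2 by rewrite mulr_ge0 ?sqr_ge0// ltW.
    have i0 : 0 <= i%:R :> R by [].
    rewrite -natr1.
    have := ler_wpM2r i0 cv; rewrite -natr1 in h2.
    lra.
have xu0 : 0 <= xi + u by lra.
have /andP[k1 k2] := truncn_itv xu0.
(* The nonzero atoms [k] and [k.+1] tie at [xi = k%:R + 1 - u], so truncating [xi + u] picks the
   best nonzero atom; the null atom wins only up to [xi = 1], treated above. *)
set k := Num.truncn (xi + u) in k1 k2 *.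
have : (0 < k)%N.
  by rewrite lt0n; apply/eqP => k0; move: k2; rewrite k0; lra.
case: k k1 k2 => // k k1 k2 _; exists k.+1.
pose w := xi - k.+1%:R; rewrite -/w.
have wE : xi = k.+1%:R + w by rewrite /w; ring.
have wu : - u <= w by rewrite /w; lra.
have w1 : w <= 1 - u by rewrite /w -natr1; move: k2; rewrite -!natr1; lra.
clearbody w.
have ww := sqr_offset_le1 v0 v1 uE wu w1.
have ww' : (1 - v) * w ^+ 2 <= 1 - v by rewrite ler_piMr// subr_ge0 ltW.
have vE : v = 1 - 2 * u by rewrite uE; field.
split=> //.
- have {}wE := wE; rewrite wE /=; case: k k1 k2 wE => [|m] k1 k2 wE.
    rewrite mul0r addr0; apply: (grid_rate_from_atom1 v0 v1 uE) => //; lra.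
  (* At a fixed offset [w], moving further out adds [v] per step to the left term but a quadratic
     amount to [v * xi ^+ 2], so the second atom is the worst. *)
  apply: le_trans (grid_rate_from_atom2 v0 v1 uE wu w1).
  have m0 : 0 <= m%:R :> R by [].
  rewrite -!natr1; set mm := m%:R in m0 *.
  rewrite -subr_ge0.
  rewrite [X in _ <= X](_ : _ = v * (mm * (3 + 2 * w + mm))); last by ring.
  by apply: mulr_ge0; [exact: ltW|apply: mulr_ge0 => //; lra].
- move=> i; rewrite wE /= /grid_dist.
  have [ki|ik] := leqP k i.
    have -> : ((i.+1 - k.+1) + (k.+1.-1 - i.+1) = i - k)%N.
      by rewrite subSS /= (_ : k - i.+1 = 0)%N ?addn0//; apply/eqP;
        rewrite subn_eq0 (leq_trans ki).
    have iE : i%:R = k%:R + (i - k)%N%:R :> R by rewrite -natrD subnKC.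
    have pint : (i - k)%N%:R = 0 :> R \/ 1 <= (i - k)%N%:R :> R.
      case: (i - k)%N => [|p]; [by left|right].
      by rewrite ler1n.
    have p0 : 0 <= (i - k)%N%:R :> R by [].
    rewrite -!natr1 iE; set p := (i - k)%N%:R in pint p0 *.
    set K := k%:R.
    rewrite [leLHS](_ : _ = (1 - v) * w ^+ 2 - v * (p * (p + 1 - 2 * w))); last by ring.
    (* [w <= 1 - u] gives [p + 1 - 2 * w >= p - v], which is at least [1 - v] once the integer [p]
       is nonzero. *)
    have pp : p * (1 - v) <= p * (p + 1 - 2 * w).
      case: pint => [->|p1]; first by rewrite !mul0r.
      by apply: ler_wpM2l => //; lra.
    have vpp := ler_wpM2l (ltW v0) pp.
    have : v ^+ 2 * (1 - v) * p <= v * (p * (1 - v)).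
      rewrite [leRHS](_ : _ = v * (1 - v) * p); last by ring.
      apply: ler_wpM2r => //; apply: ler_wpM2r; first by lra.
      by rewrite expr2 ler_piMr ?ltW.
    lra.
  have -> : ((i.+1 - k.+1) + (k.+1.-1 - i.+1) = k - i.+1)%N.
    by rewrite subSS /= (_ : i - k = 0)%N ?add0n//; apply/eqP;
      rewrite subn_eq0 ltnW.
  have iE : k%:R = i%:R + (k - i.+1)%N%:R + 1 :> R.
    by rewrite -addrA natr1 -natrD addnS -addSn subnKC.
  have pint : (k - i.+1)%N%:R = 0 :> R \/ 1 <= (k - i.+1)%N%:R :> R.
    case: (k - i.+1)%N => [|p]; [by left|right].
    by rewrite ler1n.
  have p0 : 0 <= (k - i.+1)%N%:R :> R by [].
  rewrite -!natr1 iE; set p := (k - i.+1)%N%:R in pint p0 *.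
  set I := i%:R.
  rewrite [leLHS](_ : _ = (1 - v) * w ^+ 2 - v * ((p + 1) * (p + 2 * w))); last by ring.
  (* For [p = 0], the atom just below, the worst offset is [w = - u], with value
     [2 * u * (1 - u) ^+ 2], at most [1 - v = 2 * u]. For [p >= 1] the bound [2 * w >= v - 1]
     suffices. *)
  case: pint => [->|p1].
    rewrite mulr0 subr0 add0r mul1r add0r.
    suff : (1 - v) * w ^+ 2 - v * (2 * w) <= 1 - v by lra.
    have [w0|w0] := leP 0 w.
      have : 0 <= v * (2 * w) by rewrite !mulr_ge0// ltW.
      lra.
    rewrite vE.
    have : w ^+ 2 <= u ^+ 2 by nra.
    have : 0 <= u * (w + u) by apply: mulr_ge0; lra.
    nra.
  have pp : v * p <= (p + 1) * (p + 2 * w).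
    have h : (p + 1) * (p - 1 + v) <= (p + 1) * (p + 2 * w).
      by apply: ler_wpM2l; lra.
    apply: le_trans h; nra.
  have vpp := ler_wpM2l (ltW v0) pp.
  have : v ^+ 2 * (1 - v) * p <= v * (v * p).
    rewrite [leRHS](_ : _ = v ^+ 2 * p); last by ring.
    apply: ler_wpM2r => //; rewrite ler_piMr ?sqr_ge0//; lra.
  lra.
Qed.

Lemma sum_geometric_le (q : R) (M : nat) : 0 <= q -> q < 1 ->
  \sum_(0 <= i < M) q ^+ i <= (1 - q)^-1.
Proof.
move=> q0 q1; rewrite -[leRHS]mul1r ler_pdivlMr ?subr_gt0// mulrC big_mkord.
rewrite -opprB mulNr -subrX1 opprB gerBl exprn_ge0//.
Qed.

(** Cutting at [K = k.-1] leaves one geometric series on each side, the left one read backwards. *)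
Lemma sum_grid_dist (q : R) (k N : nat) : 0 <= q -> q < 1 ->
  \sum_(0 <= i < N) q ^+ grid_dist k i.+1 <= 2 / (1 - q).
Proof.
move=> q0 q1; set K := k.-1.
pose g i := if (i < K)%N then q ^+ (K - i.+1) else q ^+ (i - K).
have g0 i : 0 <= g i by rewrite /g; case: ifP => _; rewrite exprn_ge0.
have le_g i : q ^+ grid_dist k i.+1 <= g i.
  rewrite /g /grid_dist -/K; case: ltnP => iK.
    rewrite (_ : i.+1 - k = 0)%N ?add0n//; apply/eqP; rewrite subn_eq0.
    by rewrite (leq_trans iK)// leq_pred.
  have -> : (K - i.+1 = 0)%N by apply/eqP; rewrite subn_eq0 (leq_trans iK).
  rewrite addn0; apply: ler_wiXn2l => //; first exact: ltW.
  by rewrite /K; case: (k) => [|k']; rewrite ?subn0 ?subSS.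
apply: (@le_trans _ _ (\sum_(0 <= i < K + N) g i)).
  rewrite [leRHS](@big_cat_nat _ _ _ N)//= ?leq_addl//.
  apply: ler_wpDr; first by apply: sumr_ge0 => i _.
  exact: ler_sum.
rewrite (@big_cat_nat _ _ _ K)//= ?leq_addr// mulrDl mul1r.
apply: lerD.
  rewrite big_nat_rev/= add0n; apply: le_trans (sum_geometric_le K q0 q1).
  rewrite !big_nat; apply: ler_sum => i /andP[_ iK].
  rewrite /g ifT; last by rewrite ltn_subrL (leq_ltn_trans _ iK).
  by rewrite -subSn// subSS subKn// ltnW.
rewrite -{1}[K]add0n big_addn addKn; apply: le_trans (sum_geometric_le N q0 q1).
by apply: ler_sum => i _; rewrite /g ltnNge leq_addl/= addnK.
Qed.

End grid_exponents.

(** * Likelihood ratios of the mixtures under a null mean *)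

Section mixture_means.
Context {R : realType}.
Variable P : probability (measurableTypeR R) R.
Local Open Scope ereal_scope.

Lemma measurable_normal_pdf_joint (s2 : R) : (0 < s2)%R ->
  measurable_fun setT (fun p : measurableTypeR R * measurableTypeR R =>
    normal_pdf p.2 (Num.sqrt s2) p.1).
Proof.
move=> s0; under eq_fun do rewrite normal_pdf_sqrtE//.
apply: measurable_funM => //; apply: measurableT_comp => //.
apply: measurable_funM => //; apply: measurableT_comp => //.
by apply: measurable_funX; apply: measurable_funB.
Qed.

Lemma measurable_normal_pdf_inv (m s2 : R) : (0 < s2)%R ->
  measurable_fun setT (fun x => (normal_pdf m (Num.sqrt s2) x)^-1)%R.
Proof.
move=> s0; rewrite (_ : (fun _ => _) = fun x =>
    (normal_peak (Num.sqrt s2))^-1 * expR (1 * (x - m) ^+ 2 / (2 * s2)))%R.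
  by apply: measurable_funM => //; exact: measurable_expR_sqr.
apply/funext => x; rewrite normal_pdf_sqrtE// invfM -expRN; congr (_ * expR _)%R.
by rewrite mul1r mulNr opprK.
Qed.

Lemma measurable_mix1 : measurable_fun setT (mix1 P).
Proof.
apply/measurable_EFinP.
rewrite (_ : EFin \o mix1 P = fun x =>
    \int[P]_m (normal_pdf m (Num.sqrt 1) x)%:E); last first.
  by apply/funext => x /=; rewrite mix1E.
apply: (@measurable_fun_fubini_tonelli_F _ _ (measurableTypeR R)
  (measurableTypeR R) R P (fun p => (normal_pdf p.2 (Num.sqrt 1) p.1)%:E)).
- by apply/measurable_EFinP; exact: measurable_normal_pdf_joint.
- by move=> p; rewrite lee_fin normal_pdf_ge0.
Qed.

Lemma integral_mix1 : \int[lebesgue_measure]_x (mix1 P x)%:E = 1.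
Proof.
under eq_integral do rewrite -mix1E.
rewrite (@fubini_tonelli _ _ (measurableTypeR R) (measurableTypeR R) R
  lebesgue_measure P (fun p => (normal_pdf p.2 (Num.sqrt 1) p.1)%:E)).
- rewrite [LHS](_ : _ = \int[P]_m (cst 1 m)).
    rewrite integral_cst// mul1e; exact: probability_setT.
  by apply: eq_integral => m _; exact: integral_normal_pdf.
- by apply/measurable_EFinP; exact: measurable_normal_pdf_joint.
- by move=> p; rewrite lee_fin normal_pdf_ge0.
Qed.

Variable r : R.
Hypothesis r0 : (0 < r)%R.

Let measurable_joint2 x :
  measurable_fun setT (fun p : measurableTypeR R * measurableTypeR R =>
    (normal_pdf p.2 (Num.sqrt 1) x * normal_pdf p.2 (Num.sqrt r) p.1)%:E).
Proof.
apply/measurable_EFinP; apply: measurable_funM.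
  exact: (measurableT_comp (measurable_normal_pdf_mean x ltr01) measurable_snd).
exact: measurable_normal_pdf_joint.
Qed.

Lemma measurable_mix2 x : measurable_fun setT (mix2 P r x).
Proof.
apply/measurable_EFinP.
rewrite (_ : EFin \o mix2 P r x = fun y =>
    \int[P]_m (normal_pdf m (Num.sqrt 1) x * normal_pdf m (Num.sqrt r) y)%:E).
  apply: (@measurable_fun_fubini_tonelli_F _ _ (measurableTypeR R)
    (measurableTypeR R) R P (fun p =>
      (normal_pdf p.2 (Num.sqrt 1) x * normal_pdf p.2 (Num.sqrt r) p.1)%:E)) => //.
  by move=> p; rewrite lee_fin mulr_ge0 ?normal_pdf_ge0.
by apply/funext => y /=; rewrite mix2E.
Qed.

Lemma integral_mix2 x : \int[lebesgue_measure]_y (mix2 P r x y)%:E = (mix1 P x)%:E.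
Proof.
under eq_integral do rewrite -(mix2E _ _ _ r0).
rewrite (@fubini_tonelli _ _ (measurableTypeR R) (measurableTypeR R) R
  lebesgue_measure P (fun p =>
    (normal_pdf p.2 (Num.sqrt 1) x * normal_pdf p.2 (Num.sqrt r) p.1)%:E)) => //.
- rewrite -mix1E; apply: eq_integral => m _ /=.
  under eq_integral do rewrite EFinM.
  rewrite ge0_integralZl//=.
  + by rewrite integral_normal_pdf mule1.
  + by apply/measurable_EFinP; exact: measurable_normal_pdf.
  + by move=> y _; rewrite lee_fin normal_pdf_ge0.
  + by rewrite lee_fin normal_pdf_ge0.
- by move=> p; rewrite lee_fin mulr_ge0 ?normal_pdf_ge0.
Qed.

Variables (n : nat) (theta : vec R n) (i : 'I_n).

Lemma has_mean_mix1 : tnth theta i = 0%R -> has_mean r theta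
  (fun x y => mix1 P (tnth x i) / normal_pdf 0 (Num.sqrt 1) (tnth x i))%R 1.
Proof.
move=> t0; apply: (@has_mean_x _ _ _ _ _
  (fun x => mix1 P x / normal_pdf 0 (Num.sqrt 1) x)%R).
- apply: measurable_funM; first exact: measurable_mix1.
  exact: measurable_normal_pdf_inv.
- by move=> x; rewrite divr_ge0 ?mix1_ge0 ?normal_pdf_ge0.
- rewrite t0 -integral_mix1; apply: eq_integral => x _.
  by rewrite mulrC divfK// gt_eqF// normal_pdf_gt0.
Qed.

Lemma has_mean_mix2 : tnth theta i = 0%R -> has_mean r theta
  (fun x y => mix2 P r (tnth x i) (tnth y i) /
    (normal_pdf 0 (Num.sqrt 1) (tnth x i) *
     normal_pdf 0 (Num.sqrt r) (tnth y i)))%R 1.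
Proof.
move=> t0; apply: (@has_mean_coord _ _ _ _ _
  (fun x y => mix2 P r x y /
    (normal_pdf 0 (Num.sqrt 1) x * normal_pdf 0 (Num.sqrt r) y))%R
  (fun x => mix1 P x / normal_pdf 0 (Num.sqrt 1) x)%R).
- move=> x; apply: measurable_funM; first exact: measurable_mix2.
  under eq_fun do rewrite invfM.
  by apply: measurable_funM => //; exact: measurable_normal_pdf_inv.
- by move=> x y; rewrite divr_ge0 ?mix2_ge0 ?mulr_ge0 ?normal_pdf_ge0.
- apply: measurable_funM; first exact: measurable_mix1.
  exact: measurable_normal_pdf_inv.
- by move=> x; rewrite divr_ge0 ?mix1_ge0 ?normal_pdf_ge0.
- move=> x; rewrite t0 mulrC EFinM -integral_mix2 -ge0_integralZl//.
  + apply: eq_integral => y _; rewrite -EFinM; congr (_%:E).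
    by field; rewrite !gt_eqF ?normal_pdf_gt0.
  + by apply/measurable_EFinP; exact: measurable_mix2.
  + by move=> y _; rewrite lee_fin mix2_ge0.
  + by rewrite lee_fin invr_ge0 normal_pdf_ge0.
- rewrite t0 -integral_mix1; apply: eq_integral => x _.
  by rewrite mulrC divfK// gt_eqF// normal_pdf_gt0.
Qed.

End mixture_means.

(** * The marginal of X against a single atom of the pair *)

Section grid_loss.
Context {R : realType}.
Variables r eta : R.
Hypotheses (r0 : 0 < r) (eta0 : 0 < eta) (eta1 : eta < 1).

Local Notation v := (grid_v r).
Local Notation lambda := (grid_spacing r eta).
Local Notation L := (- ln eta).
Local Notation P := (grid_prior r eta).

Lemma grid_vE : v = r / (1 + r).
Proof.
rewrite /grid_v -[X in X + _](@mulfV _ r) ?gt_eqF// -[X in _ + X]mul1r -mulrDl.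
by rewrite invfM invrK mulrC addrC.
Qed.

Lemma grid_v_lt1 : v < 1.
Proof. by rewrite grid_vE ltr_pdivrMr ?mul1r ?addr_gt0// ltrDr. Qed.

Lemma grid_vV : v^-1 = 1 + r^-1. Proof. by rewrite invrK. Qed.

Lemma neg_ln_gt0 : 0 < L.
Proof. by rewrite oppr_gt0 ln_lt0 ?eta0. Qed.

Lemma powR_expR (p : R) : eta `^ p = expR (- (L * p)).
Proof. by rewrite /powR gt_eqF// mulNr opprK mulrC. Qed.

Lemma grid_spacing_sqr : lambda ^+ 2 = 2 * v * L.
Proof.
rewrite sqr_sqrtr ln_powR; first by ring.
by rewrite mulNr -mulrN !mulr_ge0 ?(ltW (grid_v_gt0 r0)) ?(ltW neg_ln_gt0).
Qed.

Lemma grid_spacing_gt0 : 0 < lambda.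
Proof.
rewrite lt0r sqrtr_ge0 andbT; apply/eqP => l0.
have := grid_spacing_sqr; rewrite l0 expr0n/= => /esym/eqP.
by rewrite gt_eqF// !mulr_gt0 ?grid_v_gt0 ?neg_ln_gt0.
Qed.

Hypothesis eta_small : expR (- (L * (v ^+ 2 * (1 - v)))) <= 2^-1.

(** As [v ^+ 2 * (1 - v) <= v <= 1], the smallness hypothesis gives [eta <= 1/2] and [eta]^ v <=
    1/2[; thus]1 - eta[and](1 - eta [^ v) / 2] are both at least [1/4]. *)
Lemma grid_atom_ge (f : R -> R) (sg : R) (k : nat) :
  measurable_fun setT f -> (forall x, 0 <= f x) -> sg = 1 \/ sg = -1 ->
  ((expR (- (L * atom_exp v k)) / 4 * f (sg * (lambda * k%:R)))%:E <=
   \int[P]_x (f x)%:E)%E.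
Proof.
move=> mf f0 sgE.
have L0 := neg_ln_gt0; have v0 := grid_v_gt0 r0; have v1 := grid_v_lt1.
have small (p : R) : v ^+ 2 * (1 - v) <= p -> expR (- (L * p)) <= 2^-1.
  move=> cp; apply: le_trans eta_small; rewrite ler_expR lerN2.
  by rewrite ler_wpM2l// ltW.
case: k => [|k] /=.
  rewrite !(mulr0n, mulr0) oppr0 expR0.
  apply: le_trans (grid_integral_ge_atom0 r0 eta0 eta1 mf f0).
  rewrite lee_fin; apply: (@ler_wpM2r _ (f 0) (f0 0)).
  have h : eta <= 2^-1.
    rewrite -(lnK eta0) -[ln eta]opprK -[L]mulr1; apply: small.
    by rewrite expr2; nra.
  lra.
apply: le_trans (grid_integral_ge_atom r0 eta0 eta1 k mf f0 sgE).
rewrite lee_fin [leRHS]mulrA; apply: (ler_wpM2r (f0 _)).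
have h : eta `^ v <= 2^-1.
  by rewrite powR_expR; apply: small; rewrite expr2; nra.
have E : expR (- (L * (1 + k%:R * v))) = eta * eta `^ (k%:R * v).
  rewrite powR_expR -[X in _ = X * _](lnK eta0) -expRD; congr expR; ring.
rewrite E; have := powR_ge0 eta (k%:R * v); move: (eta `^ (k%:R * v)) => c c0.
have ec : 0 <= eta * c by rewrite mulr_ge0// ltW.
rewrite [leRHS](_ : _ = (1 - eta `^ v) / 2 * (eta * c)); last by ring.
rewrite [leLHS](_ : _ = 4^-1 * (eta * c)); last by ring.
apply: ler_wpM2r => //; lra.
Qed.

(** Folds the two signs of the grid onto one: both members of a reflected pair of atoms are
    dominated by the one on the side of [x]. *)
Lemma sqr_abs_sub_le (x l : R) : 0 <= l -> (`|x| - l) ^+ 2 <= (x - l) ^+ 2 /\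
  (`|x| - l) ^+ 2 <= (x + l) ^+ 2.
Proof.
move=> l0; have E : `|x| ^+ 2 = x ^+ 2 by rewrite real_normK ?num_real.
have h1 : 0 <= l * (`|x| - x) by rewrite mulr_ge0// subr_ge0 ler_norm.
have h2 : 0 <= l * (`|x| + x).
  by rewrite mulr_ge0//; have := ler_norm (- x); rewrite normrN; lra.
by split; rewrite -subr_ge0 !(sqrrB, sqrrD) E; lra.
Qed.

(** The point is the form of the bound: up to [L * grid_rate v], its exponent is that of the atom
    [k] in the mixture of the pair evaluated at [y = x], so the two cancel in the loss. The atom is
    found by [grid_index] at [|x| / lambda], the sign being that of [x]. *)
Lemma grid_gauss_le (x : R) : exists (k : nat) (sg : R),
  [/\ sg = 1 \/ sg = -1, (x - sg * (lambda * k%:R)) ^+ 2 <= lambda ^+ 2 &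
     (\int[P]_m (expR (- ((x - m) ^+ 2 / 2)))%:E <=
      (5 * expR (L * grid_rate v - L * atom_exp v k -
        (x - sg * (lambda * k%:R)) ^+ 2 / (2 * v)))%:E)%E].
Proof.
have L0 := neg_ln_gt0; have v0 := grid_v_gt0 r0; have v1 := grid_v_lt1.
have l0 := grid_spacing_gt0; have l2 := grid_spacing_sqr.
pose xi := `|x| / lambda.
have xiE : `|x| = lambda * xi by rewrite /xi mulrC divfK// gt_eqF.
have xi0 : 0 <= xi by rewrite divr_ge0// ltW.
have [k [w1 k0 kj]] := grid_index v0 v1 xi0.
pose sg : R := if 0 <= x then 1 else -1.
have sgE : sg = 1 \/ sg = -1 by rewrite /sg; case: ifP; [left|right].
have sgx : x = sg * `|x|.
  rewrite /sg; case: ifPn => x0; first by rewrite mul1r ger0_norm.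
  by rewrite mulN1r ltr0_norm ?opprK// ltNge.
have sg2 : sg ^+ 2 = 1 by case: sgE => ->; rewrite ?sqrrN expr1n.
have kE : (x - sg * (lambda * k%:R)) ^+ 2 = 2 * v * L * (xi - k%:R) ^+ 2.
  rewrite {1}sgx xiE -mulrBr -mulrBr exprMn sg2 mul1r exprMn l2//.
exists k, sg; split => //.
  by rewrite kE -l2 ler_piMr// sqr_ge0.
have q_le := eta_small; set q := expR (- (L * (v ^+ 2 * (1 - v)))) in q_le.
have q0 : 0 <= q by exact: expR_ge0.
have q1 : q < 1 by lra.
set A := expR (L * grid_rate v - L * atom_exp v k - _).
have AE : A = expR (- (L * (atom_exp v k + (xi - k%:R) ^+ 2 - grid_rate v))).
  rewrite /A kE; congr expR; field; rewrite gt_eqF//.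
have A0 : 0 <= A by exact: expR_ge0.
have mf : measurable_fun setT (fun m : R => expR (- ((x - m) ^+ 2 / 2))).
  apply: measurableT_comp => //; apply: measurableT_comp => //.
  apply: measurable_funM => //; apply: measurable_funX.
  exact: measurable_funB.
apply: (grid_integral_le r0 eta0 eta1) => //.
move=> N.
have at0 : (1 - eta) * expR (- ((x - 0) ^+ 2 / 2)) <= A.
  apply: (@le_trans _ _ (expR (- ((x - 0) ^+ 2 / 2)))).
    by rewrite ler_piMl ?expR_ge0// gerBl ltW.
  have -> : (x - 0) ^+ 2 = 2 * v * L * xi ^+ 2.
    by rewrite subr0 -(real_normK (num_real x)) xiE exprMn l2.
  rewrite AE ler_expR lerN2.
  rewrite [leRHS](_ : _ = L * (v * xi ^+ 2)); last by field.
  by apply: ler_wpM2l; [exact: ltW|lra].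
have atj (i : nat) : eta * eta `^ (i%:R * v) *
    expR (- ((`|x| - lambda * i.+1%:R) ^+ 2 / 2)) <= A * q ^+ grid_dist k i.+1.
  rewrite powR_expR -[X in X * _ * _](lnK eta0) -!expRD AE -expRM_natl -expRD.
  rewrite ler_expR xiE -mulrBr exprMn l2.
  rewrite [leLHS](_ : _ = L * - (atom_exp v i.+1 + v * (xi - i.+1%:R) ^+ 2)); last first.
    by rewrite /=; field.
  rewrite [leRHS](_ : _ = L * (grid_rate v - v ^+ 2 * (1 - v) * (grid_dist k i.+1)%:R -
    (atom_exp v k + (xi - k%:R) ^+ 2))); last by ring.
  by apply: ler_wpM2l; [exact: ltW|have := kj i; lra].
have atj2 (i : nat) : eta / 2 * (1 - eta `^ v) * (eta `^ (i%:R * v) *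
    (expR (- ((x - lambda * i.+1%:R) ^+ 2 / 2)) +
     expR (- ((x - - (lambda * i.+1%:R)) ^+ 2 / 2)))) <=
    A * q ^+ grid_dist k i.+1.
  apply: le_trans (atj i).
  set l := lambda * i.+1%:R.
  have ll : 0 <= l by rewrite mulr_ge0// ltW.
  have [s1 s2] := sqr_abs_sub_le x ll.
  set E := expR (- ((`|x| - l) ^+ 2 / 2)).
  have e1 : expR (- ((x - l) ^+ 2 / 2)) <= E by rewrite ler_expR; lra.
  have e2 : expR (- ((x - - l) ^+ 2 / 2)) <= E by rewrite opprK ler_expR; lra.
  have E0 : 0 <= E by exact: expR_ge0.
  have c0 := powR_ge0 eta (i%:R * v); move: (eta `^ (i%:R * v)) c0 => c c0.
  have d0 : 0 <= 1 - eta `^ v <= 1.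
    by rewrite gerBl powR_ge0 subr_ge0 ltW// powR_lt1.
  move: (1 - eta `^ v) d0 => d /andP[d0 d1].
  have ec : 0 <= eta * c by rewrite mulr_ge0// ltW.
  set e := _ + _.
  have eE : 0 <= e <= 2 * E.
    by rewrite /e addr_ge0 ?expR_ge0//=; lra.
  rewrite [leLHS](_ : _ = (eta * c) * (d * (e / 2))); last by ring.
  apply: ler_wpM2l => //; case/andP: eE => e0 eE.
  apply: (@le_trans _ _ (e / 2)); first by rewrite ler_piMl//; lra.
  lra.
rewrite mulr_sumr.
(* One [A] for the null atom and, as [q <= 1/2], at most four for the others: the factor [5]. *)
apply: (@le_trans _ _ (A + A * (2 / (1 - q)))).
  apply: lerD => //.
  apply: (@le_trans _ _ (\sum_(0 <= i < N) A * q ^+ grid_dist k i.+1)).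
    by apply: ler_sum => i _.
  by rewrite -mulr_sumr; apply: ler_wpM2l => //; exact: sum_grid_dist.
have : 2 / (1 - q) <= 4 by rewrite ler_pdivrMr ?subr_gt0//; lra.
by move=> h; have := ler_wpM2l A0 h; lra.
Qed.

End grid_loss.

(** * Pointwise bounds of the loss of the grid rule *)

Section grid_pointwise.
Context {R : realType}.
Variables r eta : R.
Hypotheses (r0 : 0 < r) (eta0 : 0 < eta) (eta1 : eta < 1).

Local Notation v := (grid_v r).
Local Notation lambda := (grid_spacing r eta).
Local Notation L := (- ln eta).
Local Notation P := (grid_prior r eta).

Lemma measurable_mix1_integrand (x : R) :
  measurable_fun setT (fun m : R => normal_pdf m (Num.sqrt 1) x).
Proof. exact: measurable_normal_pdf_mean. Qed.

Lemma grid_mix1_ge (x : R) :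
  (1 - eta) * normal_pdf 0 (Num.sqrt 1) x <= mix1 P x.
Proof.
rewrite -lee_fin -mix1E.
apply: (grid_integral_ge_atom0 r0 eta0 eta1 (measurable_mix1_integrand x)).
by move=> m; exact: normal_pdf_ge0.
Qed.

Lemma grid_mix2_ge (x y : R) :
  (1 - eta) * (normal_pdf 0 (Num.sqrt 1) x * normal_pdf 0 (Num.sqrt r) y) <=
  mix2 P r x y.
Proof.
rewrite -lee_fin -mix2E//.
apply: (grid_integral_ge_atom0 r0 eta0 eta1 (measurable_mix2_integrand x y r0)).
by move=> m; rewrite mulr_ge0 ?normal_pdf_ge0.
Qed.

Lemma grid_mix1_gt0 (x : R) : 0 < mix1 P x.
Proof.
by apply: lt_le_trans (grid_mix1_ge x); rewrite mulr_gt0 ?subr_gt0 ?normal_pdf_gt0.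
Qed.

Lemma grid_mix2_gt0 (x y : R) : 0 < mix2 P r x y.
Proof.
apply: lt_le_trans (grid_mix2_ge x y).
by rewrite !mulr_gt0 ?subr_gt0 ?normal_pdf_gt0.
Qed.

(** Bounding [mix2] below by its null atom removes [y]. The remaining ratio of [mix1] to the null
    density has mean one, so the [1] of [ln z <= z - 1] cancels and the bound has mean
    [- ln (1 - eta)]. *)
Lemma grid_null_loss_le (x y : R) :
  ln (normal_pdf 0 (Num.sqrt r) y / (mix2 P r x y / mix1 P x)) <=
  mix1 P x / normal_pdf 0 (Num.sqrt 1) x + (- 1 - ln (1 - eta)).
Proof.
set a := normal_pdf 0 _ y; set b := normal_pdf 0 _ x.
have a0 : 0 < a by exact: normal_pdf_gt0.
have b0 : 0 < b by exact: normal_pdf_gt0.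
have e0 : 0 < 1 - eta by rewrite subr_gt0.
have m10 := grid_mix1_gt0 x; have m20 := grid_mix2_gt0 x y.
have h : a / (mix2 P r x y / mix1 P x) <= mix1 P x / b / (1 - eta).
  rewrite [leLHS](_ : _ = mix1 P x * (a / mix2 P r x y)); last first.
    by field; rewrite !gt_eqF.
  rewrite [leRHS](_ : _ = mix1 P x * (b * (1 - eta))^-1); last first.
    by field; rewrite !gt_eqF.
  rewrite ler_pM2l// ler_pdivrMr// ler_pdivlMl ?mulr_gt0//.
  by have := grid_mix2_ge x y; rewrite -/a -/b; lra.
apply: le_trans (_ : ln (mix1 P x / b / (1 - eta)) <= _).
  by rewrite ler_ln// posrE !divr_gt0.
rewrite ln_div ?posrE ?divr_gt0// addrA lerD2r.
have := @le_ln1Dx R (mix1 P x / b - 1).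
rewrite addrCA subrr addr0; apply.
by rewrite ltrBrDl subrr divr_gt0.
Qed.

(** The mirror image: the null atom bounds [mix1] below, and the ratio of mean one is now that of
    the pair. *)
Lemma grid_null_loss_ge (x y : R) :
  ln (1 - eta) + 1 + -1 * (mix2 P r x y /
    (normal_pdf 0 (Num.sqrt 1) x * normal_pdf 0 (Num.sqrt r) y)) <=
  ln (normal_pdf 0 (Num.sqrt r) y / (mix2 P r x y / mix1 P x)).
Proof.
set a := normal_pdf 0 _ y; set b := normal_pdf 0 _ x.
have a0 : 0 < a by exact: normal_pdf_gt0.
have b0 : 0 < b by exact: normal_pdf_gt0.
have e0 : 0 < 1 - eta by rewrite subr_gt0.
have m10 := grid_mix1_gt0 x; have m20 := grid_mix2_gt0 x y.
pose z := mix2 P r x y / (b * a).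
have z0 : 0 < z by rewrite divr_gt0// mulr_gt0.
have h : (1 - eta) / z <= a / (mix2 P r x y / mix1 P x).
  rewrite [leLHS](_ : _ = a / mix2 P r x y * ((1 - eta) * b)); last first.
    by rewrite /z invf_div; field; rewrite gt_eqF.
  rewrite [leRHS](_ : _ = a / mix2 P r x y * mix1 P x); last first.
    by field; rewrite !gt_eqF.
  by rewrite ler_pM2l ?divr_gt0//; exact: grid_mix1_ge.
apply: le_trans (_ : ln ((1 - eta) / z) <= _); last first.
  by rewrite ler_ln// posrE ?divr_gt0 ?mulr_gt0.
rewrite ln_div ?posrE// -addrA lerD2l mulN1r -/z.
have := @le_ln1Dx R (z - 1); rewrite addrCA subrr addr0 => H.
have {}H : ln z <= z - 1 by apply: H; rewrite ltrBrDl subrr.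
lra.
Qed.

(* [y - x = (y - t) - (x - t)], so the deviations of both observations control
   the quadratic in [y - x]. *)
Lemma quad_le_dev (l t x y : R) : 0 <= l ->
  (2 * l * `|y - x| + (y - x) ^+ 2) / (2 * r) <=
  l / (2 * r) + (l + 1) / r * dev r t x y.
Proof.
move=> l0; have := sqr_le_dev r0 t x y; move: (dev r t x y) => d hd.
have h1 : 2 * `|y - x| <= 1 + (y - x) ^+ 2.
  rewrite -[X in _ <= 1 + X](real_normK (num_real _)) -subr_ge0.
  by rewrite [X in _ <= X](_ : _ = (1 - `|y - x|) ^+ 2) ?sqr_ge0//; ring.
have h2 : (y - x) ^+ 2 <= 2 * d.
  have := sqr_ge0 ((y - t) + (x - t)).
  have : (y - x) ^+ 2 + ((y - t) + (x - t)) ^+ 2 = 2 * ((x - t) ^+ 2 + (y - t) ^+ 2).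
    by ring.
  lra.
rewrite ler_pdivrMr ?mulr_gt0//.
rewrite [leRHS](_ : _ = l + (l + 1) * (2 * d)); last by field; rewrite gt_eqF.
have h3 := ler_wpM2l l0 h1.
have h4 : (l + 1) * (y - x) ^+ 2 <= (l + 1) * (2 * d) by apply: ler_wpM2l => //; lra.
lra.
Qed.

Hypothesis eta_small : expR (- (L * (v ^+ 2 * (1 - v)))) <= 2^-1.

(** [k] depends on [x] alone, and [t] enters only through the peak of its density, so no knowledge
    of the mean is needed. After the cancellation at [y = x] the remainder is a quadratic in
    [y - x], of slope at most [lambda / r] because the chosen atom is within [lambda] of [x]. *)
Lemma grid_loss_le (t x y : R) :
  ln (normal_pdf t (Num.sqrt r) y / (mix2 P r x y / mix1 P x)) <=
  L * grid_rate v + ln 20 +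
    (2 * lambda * `|y - x| + (y - x) ^+ 2) / (2 * r).
Proof.
have [k [sg [sgE dle]]] := grid_gauss_le r0 eta0 eta1 eta_small x.
set mk := sg * (lambda * k%:R) in dle *.
set B := expR (L * grid_rate v - _ - _) => gle.
have v0 := grid_v_gt0 r0.
pose p1 := normal_peak (Num.sqrt 1 : R); pose pr := normal_peak (Num.sqrt r).
have p10 : 0 < p1 by exact/normal_peak_gt0/sqrtr_neq0.
have pr0 : 0 < pr by exact/normal_peak_gt0/sqrtr_neq0.
have m1le : mix1 P x <= p1 * (5 * B).
  rewrite -lee_fin -mix1E EFinM.
  apply: le_trans (lee_wpmul2l _ gle); last by rewrite lee_fin ltW.
  rewrite -ge0_integralZl//.
  - apply: le_integral_pointwise => m.
    rewrite -EFinM lee_fin normal_pdf_sqrtE// /p1 ler_pM2l//.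
    by rewrite mulr1 mulNr.
  - apply/measurable_EFinP; apply: measurableT_comp => //.
    apply: measurableT_comp => //; apply: measurable_funM => //.
    by apply: measurable_funX; apply: measurable_funB.
  - by rewrite lee_fin ltW.
pose Q := expR (- (L * atom_exp v k)) / 4 *
  (p1 * expR (- (x - mk) ^+ 2 / (2 * 1)) * (pr * expR (- (y - mk) ^+ 2 / (2 * r)))).
have m2ge : Q <= mix2 P r x y.
  rewrite -lee_fin -mix2E//.
  apply: le_trans (grid_atom_ge r0 eta0 eta1 eta_small k
    (measurable_mix2_integrand x y r0) _ sgE).
    by rewrite lee_fin /Q !normal_pdf_sqrtE.
  by move=> m; rewrite mulr_ge0 ?normal_pdf_ge0.
have Q0 : 0 < Q by rewrite !mulr_gt0 ?expR_gt0// invr_gt0.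
have B0 : 0 < B by exact: expR_gt0.
have ptle : normal_pdf t (Num.sqrt r) y <= pr.
  by rewrite normal_pdf_ub// sqrtr_neq0.
have pt0 : 0 < normal_pdf t (Num.sqrt r) y by exact: normal_pdf_gt0.
have m10 := grid_mix1_gt0 x; have m20 := grid_mix2_gt0 x y.
set W := _ / (2 * r).
have ratio : normal_pdf t (Num.sqrt r) y / (mix2 P r x y / mix1 P x) <=
    pr * (p1 * (5 * B)) / Q.
  rewrite [leLHS](_ : _ = normal_pdf t (Num.sqrt r) y * mix1 P x * (mix2 P r x y)^-1).
    apply: ler_pM; last by rewrite lef_pV2 ?posrE.
    - by rewrite ltW// mulr_gt0.
    - by rewrite invr_ge0 ltW.
    - by apply: ler_pM => //; exact: ltW.
  by field; rewrite !gt_eqF.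
(* [20 = 4 * 5], from [grid_atom_ge] and [grid_gauss_le]; the exponents in [x] cancel through
   [v^-1 = 1 + r^-1]. *)
have QE : pr * (p1 * (5 * B)) / Q = 20 * expR (L * grid_rate v +
     ((y - mk) ^+ 2 - (x - mk) ^+ 2) / (2 * r)).
  rewrite /Q -!mulrA.
  rewrite [LHS](_ : _ = 20 * (B / (expR (- (L * atom_exp v k)) *
     expR (- (x - mk) ^+ 2 / (2 * 1)) * expR (- (y - mk) ^+ 2 / (2 * r))))).
    rewrite -!expRD -expRN -expRD; congr (_ * expR _).
    have -> : (x - mk) ^+ 2 / (2 * v) = (x - mk) ^+ 2 / 2 * (1 + r^-1).
      by rewrite invfM mulrA grid_vV.
    by field; rewrite gt_eqF.
  by field; rewrite !gt_eqF ?expR_gt0.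
apply: le_trans (_ : ln (pr * (p1 * (5 * B)) / Q) <= _).
  by rewrite ler_ln// posrE ?divr_gt0// !mulr_gt0.
rewrite QE lnM ?posrE ?expR_gt0// expRK addrA [ln 20 + _]addrC lerD2l /W.
rewrite ler_wpM2r// ?invr_ge0 ?mulr_ge0 ?(ltW r0)//.
have -> : (y - mk) ^+ 2 - (x - mk) ^+ 2 =
    2 * ((x - mk) * (y - x)) + (y - x) ^+ 2 by ring.
rewrite lerD2r -mulrA ler_pM2l//.
apply: le_trans (ler_norm _) _; rewrite normrM ler_wpM2r//.
rewrite -(ler_pXn2r (n := 2))// ?nnegrE ?sqrtr_ge0//.
by rewrite real_normK ?num_real.
Qed.

End grid_pointwise.

(** * Lower bound of the loss at the tie of the first two atoms *)

Section grid_worst_case.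
Context {R : realType}.

(** Young's inequality with weight [kappa]: an observation is replaced by its mean at a relative
    cost [kappa], the deviation being paid with the factor [kappa^-1]. *)
Lemma sqr_sub_ge (kappa a b c : R) : 0 < kappa ->
  (1 - kappa) * (b - c) ^+ 2 - kappa^-1 * (a - b) ^+ 2 <= (a - c) ^+ 2.
Proof.
move=> k0; have := sqr_ge0 (kappa * (b - c) + (a - b)).
have k0' : 0 < kappa^-1 by rewrite invr_gt0.
move=> /(mulr_ge0 (ltW k0')).
rewrite (_ : kappa^-1 * (kappa * (b - c) + (a - b)) ^+ 2 =
  kappa * (b - c) ^+ 2 + 2 * ((b - c) * (a - b)) + kappa^-1 * (a - b) ^+ 2).
  move=> h; have := sqr_ge0 (a - b); rewrite (_ : (a - c) ^+ 2 = (b - c) ^+ 2 +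
    2 * ((b - c) * (a - b)) + (a - b) ^+ 2); last by ring.
  lra.
by field; rewrite gt_eqF.
Qed.

Lemma sqr_sub_le (kappa a b c : R) : 0 < kappa ->
  (a - c) ^+ 2 <= (1 + kappa) * (b - c) ^+ 2 + (1 + kappa^-1) * (a - b) ^+ 2.
Proof.
move=> k0; have := sqr_ge0 (kappa * (b - c) - (a - b)).
have k0' : 0 < kappa^-1 by rewrite invr_gt0.
move=> /(mulr_ge0 (ltW k0')).
rewrite (_ : kappa^-1 * (kappa * (b - c) - (a - b)) ^+ 2 =
  kappa * (b - c) ^+ 2 - 2 * ((b - c) * (a - b)) + kappa^-1 * (a - b) ^+ 2).
  move=> h; rewrite (_ : (a - c) ^+ 2 = (b - c) ^+ 2 +
    2 * ((b - c) * (a - b)) + (a - b) ^+ 2); last by ring.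
  lra.
by field; rewrite gt_eqF.
Qed.

Variables r eta : R.
Hypotheses (r0 : 0 < r) (eta0 : 0 < eta) (eta1 : eta < 1).

Local Notation v := (grid_v r).
Local Notation lambda := (grid_spacing r eta).
Local Notation L := (- ln eta).
Local Notation P := (grid_prior r eta).

(* At this mean the first two grid points contribute equally to the joint
   mixture of [(X, Y)]. *)
Definition worst_mean : R := lambda * ((3 + v) / 2).

(** The common pair exponent of the two tied atoms: [1 + ((1 + v) / 2) ^+ 2 = 1 + v + ((1 - v) / 2)
    ^+ 2]. *)
Definition worst_exp : R := 1 + ((1 + v) / 2) ^+ 2.

(** The difference of the two sides is [i * (i - 1)], which vanishes exactly at the two tied
    atoms. *)
Lemma worst_exp_le (i : nat) :
  worst_exp <= 1 + i%:R * v + ((3 + v) / 2 - i.+1%:R) ^+ 2.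
Proof.
rewrite -natr1 /worst_exp -subr_ge0.
rewrite [X in _ <= X](_ : _ = i%:R * (i%:R - 1)); last by field.
by case: i => [|i]; rewrite ?mul0r// mulr_ge0// -natr1 addrK.
Qed.

(** Only the quadratic is shrunk by [1 - kappa], not the prior exponents [1 + i * v]. The leftover,
    at least [i * kappa * v], yields a geometric series with sum at most [2]; the null atom adds one
    more term, hence [3]. *)
Lemma grid_gauss_worst_le (kappa : R) : 0 < kappa -> kappa < 1 ->
  expR (- (L * (kappa * v))) <= 2^-1 ->
  (\int[P]_m (expR (- ((1 - kappa) * (worst_mean - m) ^+ 2 / (2 * v))))%:E <=
   (3 * expR (- (L * ((1 - kappa) * worst_exp))))%:E)%E.
Proof.
move=> k0 k1; set q := expR _ => q_le.
have L0 := neg_ln_gt0 eta0 eta1; have v0 := grid_v_gt0 r0; have v1 := grid_v_lt1 r0.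
have l2 := grid_spacing_sqr r0 eta0 eta1.
have q0 : 0 <= q by exact: expR_ge0.
have q1 : q < 1 by lra.
set A := expR (- (L * ((1 - kappa) * worst_exp))).
have A0 : 0 <= A by exact: expR_ge0.
apply: (grid_integral_le r0 eta0 eta1) => [||N].
- apply: measurableT_comp => //; apply: measurableT_comp => //.
  apply: measurable_funM => //; apply: measurable_funM => //.
  apply: measurable_funX; exact: measurable_funB.
- by move=> x; exact: expR_ge0.
pose f (m : R) := expR (- ((1 - kappa) * (worst_mean - m) ^+ 2 / (2 * v))).
rewrite -/(f 0) -[X in _ + _ * X <= _]/(\sum_(0 <= j < N) (eta `^ (j%:R * v) *
  (f (lambda * j.+1%:R) + f (- (lambda * j.+1%:R))))).
have fE (c : R) : f (lambda * c) = expR (- (L * ((1 - kappa) * ((3 + v) / 2 - c) ^+ 2))).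
  rewrite /f /worst_mean -mulrBr exprMn l2; congr expR.
  by field; rewrite gt_eqF.
have at0 : (1 - eta) * f 0 <= A.
  apply: (@le_trans _ _ (f 0)).
    by rewrite ler_piMl ?expR_ge0// gerBl ltW.
  rewrite -[0](mulr0 lambda) fE ler_expR lerN2 ler_wpM2l ?(ltW L0)//.
  apply: ler_wpM2l; first by rewrite subr_ge0 ltW.
  rewrite /worst_exp -subr_ge0 [X in _ <= X](_ : _ = 1 + v); last by field.
  by rewrite addr_ge0// ltW.
have atj (i : nat) : eta * eta `^ (i%:R * v) * f (lambda * i.+1%:R) <= A * q ^+ i.
  rewrite (powR_expR eta0) -[X in X * _ * _](lnK eta0) fE -!expRD /A -expRM_natl -expRD.
  rewrite ler_expR.
  rewrite [leLHS](_ : _ = L * - (1 + i%:R * v + (1 - kappa) * ((3 + v) / 2 - i.+1%:R) ^+ 2)); last by ring.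
  rewrite [leRHS](_ : _ = L * - ((1 - kappa) * worst_exp + i%:R * (kappa * v))); last by ring.
  apply: ler_wpM2l; first exact: ltW.
  have := worst_exp_le i; have i0 : 0 <= i%:R :> R by [].
  have k1' : 0 <= 1 - kappa by rewrite subr_ge0 ltW.
  move=> /(ler_wpM2l k1').
  have : 0 <= kappa * 1 by rewrite mulr1 ltW.
  lra.
have atj2 (i : nat) : eta / 2 * (1 - eta `^ v) * (eta `^ (i%:R * v) *
    (f (lambda * i.+1%:R) + f (- (lambda * i.+1%:R)))) <= A * q ^+ i.
  apply: le_trans (atj i).
  set l := lambda * i.+1%:R.
  have ll : 0 <= l by rewrite mulr_ge0 ?sqrtr_ge0.
  have w0 : 0 <= worst_mean by rewrite !mulr_ge0 ?sqrtr_ge0// addr_ge0// ltW.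
  have e2 : f (- l) <= f l.
    rewrite /f ler_expR lerN2 ler_wpM2r ?invr_ge0 ?mulr_ge0 ?(ltW v0)//.
    rewrite ler_wpM2l ?subr_ge0 ?(ltW k1)// opprK.
    by have := mulr_ge0 w0 ll; rewrite sqrrB sqrrD; lra.
  have E0 : 0 <= f l by exact: expR_ge0.
  have E1 : 0 <= f (- l) by exact: expR_ge0.
  move: (f l) (f (- l)) e2 E0 E1 => a b ba a0 b0.
  have c0 := powR_ge0 eta (i%:R * v); move: (eta `^ (i%:R * v)) c0 => c c0.
  have d0 : 0 <= 1 - eta `^ v <= 1.
    by rewrite gerBl powR_ge0 subr_ge0 ltW// powR_lt1.
  move: (1 - eta `^ v) d0 => d /andP[d0 d1].
  have ec : 0 <= eta * c by rewrite mulr_ge0// ltW.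
  rewrite [leLHS](_ : _ = (eta * c) * (d * ((a + b) / 2))); last by ring.
  apply: ler_wpM2l => //.
  by apply: (@le_trans _ _ ((a + b) / 2)); [rewrite ler_piMl//; lra|lra].
rewrite mulr_sumr.
apply: (@le_trans _ _ (A + A * (1 - q)^-1)).
  apply: lerD => //.
  apply: (@le_trans _ _ (\sum_(0 <= i < N) A * q ^+ i)).
    by apply: ler_sum => i _.
  by rewrite -mulr_sumr; apply: ler_wpM2l => //; exact: sum_geometric_le.
have : (1 - q)^-1 <= 2 by rewrite -[leRHS]invrK lef_pV2 ?posrE ?invr_gt0 ?subr_gt0//; lra.
by move=> h; have := ler_wpM2l A0 h; lra.
Qed.

Definition worst_rate : R :=
  1 + v + ((1 - v) / 2) ^+ 2 - v * (2 - (1 - v) / 2) ^+ 2.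

Lemma worst_rateE : worst_rate = worst_exp - v * ((3 + v) / 2) ^+ 2.
Proof. by rewrite /worst_rate /worst_exp; field. Qed.

(** The mixture of the pair is moved to the worst mean by [sqr_sub_ge]; that of [X] is reduced to
    its null atom, with [x ^+ 2] controlled by [sqr_sub_le]. Both moves together cost [kappa] times
    [worst_exp + v * ((3 + v) / 2) ^+ 2], at most [6 * kappa]. In [ln 6], the [3] comes from
    [grid_gauss_worst_le] and the [2] from [1 - eta >= 1/2]. *)
Lemma grid_loss_ge (kappa x y : R) : 0 < kappa -> kappa < 1 -> eta <= 2^-1 ->
  expR (- (L * (kappa * v))) <= 2^-1 ->
  L * (worst_rate - 6 * kappa) - ln 6 +
    - ((1 + 2 / kappa) * (1 + r^-1)) * dev r worst_mean x y <=
  ln (normal_pdf worst_mean (Num.sqrt r) y / (mix2 P r x y / mix1 P x)).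
Proof.
move=> k0 k1 eta2 q_le.
have G := grid_gauss_worst_le k0 k1 q_le.
set t := worst_mean in G *.
set A := expR _ in G.
have L0 := neg_ln_gt0 eta0 eta1; have v0 := grid_v_gt0 r0; have v1 := grid_v_lt1 r0.
have l2 := grid_spacing_sqr r0 eta0 eta1.
pose p1 := normal_peak (Num.sqrt 1 : R); pose pr := normal_peak (Num.sqrt r).
have p10 : 0 < p1 by exact/normal_peak_gt0/sqrtr_neq0.
have pr0 : 0 < pr by exact/normal_peak_gt0/sqrtr_neq0.
have A0 : 0 < A by exact: expR_gt0.
pose D := expR (kappa^-1 * ((x - t) ^+ 2 / 2 + (y - t) ^+ 2 / (2 * r))).
have D0 : 0 < D by exact: expR_gt0.
have m2le : mix2 P r x y <= p1 * pr * D * (3 * A).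
  rewrite -lee_fin -mix2E// EFinM.
  apply: le_trans (lee_wpmul2l _ G); last by rewrite lee_fin !mulr_ge0// ltW.
  rewrite -ge0_integralZl//.
  - apply: le_integral_pointwise => m.
    rewrite -EFinM lee_fin !normal_pdf_sqrtE// -/p1 -/pr.
    rewrite [leLHS](_ : _ = p1 * pr * (expR (- (x - m) ^+ 2 / (2 * 1)) *
      expR (- (y - m) ^+ 2 / (2 * r)))); last by ring.
    rewrite -[leRHS]mulrA ler_pM2l ?mulr_gt0// -!expRD ler_expR.
    have := sqr_sub_ge x t m k0; have := sqr_sub_ge y t m k0.
    rewrite mulr1 [(2 * v)^-1]invfM [(2 * r)^-1]invfM grid_vV.
    have ri : 0 <= r^-1 by rewrite invr_ge0 ltW.
    move=> /(ler_wpM2r ri); move: (r^-1) => ri' ; lra.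
  - apply/measurable_EFinP; apply: measurableT_comp => //.
    apply: measurableT_comp => //; apply: measurable_funM => //.
    apply: measurable_funM => //; apply: measurable_funX.
    exact: measurable_funB.
  - by rewrite lee_fin !mulr_ge0// ltW.
have m1ge : 2^-1 * (p1 * expR (- (x - 0) ^+ 2 / (2 * 1))) <= mix1 P x.
  apply: le_trans (grid_mix1_ge r0 eta0 eta1 x); rewrite normal_pdf_sqrtE//.
  rewrite ler_wpM2r//; last by lra.
  by rewrite mulr_ge0 ?expR_ge0// ltW.
have m10 := grid_mix1_gt0 r0 eta0 eta1 x.
have m20 := grid_mix2_gt0 r0 eta0 eta1 x y.
have pt0 : 0 < normal_pdf t (Num.sqrt r) y by exact: normal_pdf_gt0.
set lo := 2^-1 * _ in m1ge.
have lo0 : 0 < lo by rewrite !mulr_gt0 ?expR_gt0.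
have ratio : normal_pdf t (Num.sqrt r) y * lo / (p1 * pr * D * (3 * A)) <=
    normal_pdf t (Num.sqrt r) y / (mix2 P r x y / mix1 P x).
  rewrite [leRHS](_ : _ = normal_pdf t (Num.sqrt r) y * mix1 P x / mix2 P r x y).
    apply: ler_pM.
    - by rewrite ltW// mulr_gt0.
    - by rewrite invr_ge0 ltW// !mulr_gt0.
    - by apply: ler_wpM2l => //; exact: ltW.
    - by rewrite lef_pV2 ?posrE// !mulr_gt0.
  by field; rewrite !gt_eqF.
apply: le_trans (_ : ln (normal_pdf t (Num.sqrt r) y * lo / (p1 * pr * D * (3 * A))) <= _); last first.
  have num0 : 0 < normal_pdf t (Num.sqrt r) y * lo by exact: mulr_gt0.
  by rewrite ler_ln// posrE ?divr_gt0// !mulr_gt0.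
have -> : normal_pdf t (Num.sqrt r) y * lo / (p1 * pr * D * (3 * A)) =
   expR (- (y - t) ^+ 2 / (2 * r) - x ^+ 2 / 2 - kappa^-1 * ((x - t) ^+ 2 / 2 +
     (y - t) ^+ 2 / (2 * r)) + L * ((1 - kappa) * worst_exp)) / 6.
  rewrite !expRD !expRN -/D /lo subr0 mulr1 normal_pdf_sqrtE// -/pr.
  rewrite (_ : - x ^+ 2 / 2 = - (x ^+ 2 / 2)); last by rewrite mulNr.
  rewrite expRN.
  rewrite (_ : expR (L * ((1 - kappa) * worst_exp)) = A^-1); last by rewrite -expRN opprK.
  by field; rewrite !gt_eqF ?expR_gt0.
rewrite ln_div ?posrE ?expR_gt0// expRK [leLHS]addrAC lerD2r.
have hx := sqr_sub_le x t 0 k0; rewrite !subr0 in hx.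
have tE : t ^+ 2 = 2 * v * L * ((3 + v) / 2) ^+ 2 by rewrite exprMn l2.
have hd := sqr_le_dev r0 t x y.
have X0 := sqr_ge0 (x - t); have Y0 := sqr_ge0 (y - t).
move: (dev r t x y) ((x - t) ^+ 2) ((y - t) ^+ 2) hd X0 Y0 hx => d X Y hd X0 Y0 hx.
have ri : 0 <= r^-1 by rewrite invr_ge0 ltW.
have ki : 0 <= kappa^-1 by rewrite invr_ge0 ltW.
have E6 : worst_exp + v * ((3 + v) / 2) ^+ 2 <= 6.
  rewrite /worst_exp; nra.
rewrite worst_rateE.
rewrite tE in hx.
have LE : L * (worst_exp - v * ((3 + v) / 2) ^+ 2 - 6 * kappa) <=
  L * ((1 - kappa) * worst_exp - (1 + kappa) * v * ((3 + v) / 2) ^+ 2).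
  apply: ler_wpM2l; first exact: ltW.
  have := ler_wpM2l (ltW k0) E6; lra.
have Xd : (1 + 2 * kappa^-1) * (1 + r^-1) * (X + Y) <= (1 + 2 * kappa^-1) * (1 + r^-1) * d.
  apply: ler_wpM2l => //; apply: mulr_ge0; lra.
rewrite [(2 * r)^-1]invfM.
have a1 := mulr_ge0 ri X0; have a2 := mulr_ge0 ri Y0.
have a3 := mulr_ge0 ki X0; have a4 := mulr_ge0 ki Y0.
have a5 := mulr_ge0 ki a1; have a6 := mulr_ge0 ki a2.
move: (v * _) LE hx => vv LE hx.
lra.
Qed.

End grid_worst_case.

(** * Maximal risk of the grid rule *)

Section grid_max_risk.
Context {R : realType}.

Lemma sum_sparse_le n (theta : vec R n) (s : nat) (a b : R) :
  sparse s theta -> 0 <= a -> 0 <= b ->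
  \sum_(i < n) (if tnth theta i == 0 then a else b) <= s%:R * b + n%:R * a.
Proof.
move=> hs a0 b0.
apply: (@le_trans _ _ (\sum_(i < n) ((if tnth theta i != 0 then b else 0) + a))).
  by apply: ler_sum => i _; case: eqP => _ /=; rewrite ?add0r// lerDl.
rewrite big_split/= -big_mkcond/= !sumr_const card_ord.
rewrite -[a *+ _]mulr_natl -[b *+ _]mulr_natl lerD2r.
rewrite ler_wpM2r// ler_nat; apply: leq_trans hs.
by rewrite /norm0 cardsE.
Qed.

Variables r eta : R.
Hypotheses (r0 : 0 < r) (eta0 : 0 < eta) (eta1 : eta < 1).

Local Notation v := (grid_v r).
Local Notation lambda := (grid_spacing r eta).
Local Notation L := (- ln eta).
Local Notation P := (grid_prior r eta).

Let q (x y : R) : R := mix2 P r x y / mix1 P x.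

Let q0 x y : 0 < q x y.
Proof. by rewrite divr_gt0 ?grid_mix1_gt0 ?grid_mix2_gt0. Qed.

Lemma grid_bayes_density n : bayes_density r (product_grid_prior r eta n) =
  fun x y => \prod_(i < n) q (tnth x i) (tnth y i).
Proof.
apply/funext => x; apply/funext => y.
exact: (bayes_density_nfold (grid_mix1_gt0 r0 eta0 eta1) x y r0).
Qed.

Lemma neg_ln1B_ge0 : 0 <= - ln (1 - eta).
Proof. by rewrite oppr_ge0 ln_le0// gerBl ltW. Qed.

(** With [eta = s / n], it makes [n] null coordinates cost at most [2 * s] in total, which is
    negligible against [s * L]. *)
Lemma neg_ln1B_le : eta <= 2^-1 -> - ln (1 - eta) <= 2 * eta.
Proof.
move=> e2; have h : 0 < 1 - eta by rewrite subr_gt0.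
rewrite -lnV ?posrE//.
have := @le_ln1Dx R ((1 - eta)^-1 - 1); rewrite addrCA subrr addr0 => H.
apply: le_trans (H _) _; first by rewrite ltrBrDl subrr invr_gt0.
rewrite lerBlDl -[leLHS]mul1r ler_pdivrMr//.
have := mulr_ge0 (ltW eta0) (_ : 0 <= 2^-1 - eta); rewrite subr_ge0 => /(_ e2).
lra.
Qed.

Lemma grid_max_risk_le n s :
  expR (- (L * (v ^+ 2 * (1 - v)))) <= 2^-1 ->
  (max_risk r (@sparse R n s) (bayes_density r (product_grid_prior r eta n)) <=
   (s%:R * (L * grid_rate v + ln 20 + (lambda / (2 * r) +
      (lambda + 1) / r * dev_mean r)) + n%:R * - ln (1 - eta))%:E)%E.
Proof.
move=> eta_small; rewrite grid_bayes_density; apply: ge_ereal_sup => _ [theta hs <-].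
set K := L * _ + _ + _.
have v0 := grid_v_gt0 r0; have v1 := grid_v_lt1 r0.
have lr : 0 <= (lambda + 1) / r by rewrite divr_ge0 ?addr_ge0 ?sqrtr_ge0// ltW.
have K0 : 0 <= K.
  rewrite /K addr_ge0//; last first.
    rewrite addr_ge0//; last by rewrite mulr_ge0// dev_mean_ge0.
    by rewrite divr_ge0 ?sqrtr_ge0// mulr_ge0// ltW.
  rewrite addr_ge0 ?ln_ge0//; last by rewrite ler1n.
  rewrite mulr_ge0 ?(ltW (neg_ln_gt0 eta0 eta1))//.
  by apply: le_trans (grid_rate_ge v); rewrite subr_ge0 ltW.
pose u (i : 'I_n) (x y : R) := if tnth theta i == 0
  then mix1 P x / normal_pdf 0 (Num.sqrt 1) x + (- 1 - ln (1 - eta))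
  else L * grid_rate v + ln 20 + (lambda / (2 * r) +
    (lambda + 1) / r * dev r (tnth theta i) x y).
pose c (i : 'I_n) := if tnth theta i == 0 then - ln (1 - eta) else K.
have uc i : has_mean r theta (fun x y => u i (tnth x i) (tnth y i)) (c i).
  rewrite /u /c; case: eqP => ti.
    have E : - ln (1 - eta) = 1 + (- 1 - ln (1 - eta)) by ring.
    rewrite [X in has_mean _ _ _ X]E.
    by apply: has_meanD; [exact: has_mean_mix1|exact: has_mean_cst].
  apply: has_meanD; first exact: has_mean_cst.
  apply: has_meanD; first exact: has_mean_cst.
  by apply: has_meanZ; exact: has_mean_dev.
apply: (le_trans (risk_product_le r0 q0 uc _)).
  move=> i x y; rewrite /u /q; case: eqP => [->|_].
    exact: grid_null_loss_le.
  apply: (le_trans (grid_loss_le r0 eta0 eta1 eta_small _ x y)).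
  by rewrite lerD2l; apply: quad_le_dev => //; exact: sqrtr_ge0.
rewrite lee_fin; apply: sum_sparse_le => //; exact: neg_ln1B_ge0.
Qed.

Lemma grid_max_risk_ge n s (kappa : R) : (s <= n)%N ->
  0 < kappa -> kappa < 1 -> eta <= 2^-1 ->
  expR (- (L * (kappa * v))) <= 2^-1 ->
  ((s%:R * (L * (worst_rate r - 6 * kappa) - ln 6 -
       (1 + 2 / kappa) * (1 + r^-1) * dev_mean r) + n%:R * ln (1 - eta))%:E <=
   max_risk r (@sparse R n s) (bayes_density r (product_grid_prior r eta n)))%E.
Proof.
move=> sn k0 k1 eta2 q_le.
set K := L * _ - _ - _.
pose theta : vec R n := [tuple if (i < s)%N then worst_mean r eta else 0 | i < n].
have w0 : worst_mean r eta != 0.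
  rewrite gt_eqF// mulr_gt0 ?grid_spacing_gt0// divr_gt0// addr_gt0//.
  exact: grid_v_gt0.
have thetaE i : tnth theta i = if (i < s)%N then worst_mean r eta else 0.
  by rewrite tnth_mktuple.
clearbody theta.
have hs : sparse s theta.
  rewrite /sparse/= /norm0 cardsE.
  rewrite (eq_card (B := [pred i : 'I_n | (i < s)%N])).
    rewrite -sum1_card/= -(big_ord_widen n (fun=> 1%N))// sum1_card card_ord.
    exact: leqnn.
  move=> i; rewrite !inE -[LHS]/(tnth theta i != 0) thetaE.
  by case: ifP => _; [exact: w0|rewrite eqxx].
apply: (@le_trans _ _ (risk r theta (bayes_density r (product_grid_prior r eta n)))); last first.
  by apply: ereal_sup_ubound; exists theta.
rewrite grid_bayes_density.
pose u (i : 'I_n) (x y : R) := if (i < s)%N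
  then L * (worst_rate r - 6 * kappa) - ln 6 +
    - ((1 + 2 / kappa) * (1 + r^-1)) * dev r (worst_mean r eta) x y
  else ln (1 - eta) + 1 + -1 * (mix2 P r x y /
    (normal_pdf 0 (Num.sqrt 1) x * normal_pdf 0 (Num.sqrt r) y)).
pose c (i : 'I_n) := if (i < s)%N then K else ln (1 - eta).
have uc i : has_mean r theta (fun x y => u i (tnth x i) (tnth y i)) (c i).
  rewrite /u /c; have := thetaE i; case: ifP => _ ti.
    have E : K = L * (worst_rate r - 6 * kappa) - ln 6 +
        - ((1 + 2 / kappa) * (1 + r^-1)) * dev_mean r by rewrite /K; ring.
    rewrite E; apply: has_meanD; first exact: has_mean_cst.
    by apply: has_meanZ; rewrite -ti; exact: has_mean_dev.
  have E : ln (1 - eta) = ln (1 - eta) + 1 + -1 * 1 by ring.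
  rewrite [X in has_mean _ _ _ X]E.
  apply: has_meanD; first exact: has_mean_cst.
  by apply: has_meanZ; exact: has_mean_mix2.
apply: le_trans (risk_product_ge r0 q0 uc _).
  rewrite lee_fin.
  apply: (@le_trans _ _ (\sum_(i < n) ((if (i < s)%N then K else 0) + ln (1 - eta)))).
    rewrite big_split/= -big_mkcond/= -(big_ord_widen n (fun=> K))// !sumr_const.
    by rewrite !card_ord -[K *+ _]mulr_natl -[ln (1 - eta) *+ n]mulr_natl.
  have := neg_ln1B_ge0 => h.
  rewrite /c; apply: ler_sum => i _; case: ifP => _; rewrite ?add0r//.
  by rewrite gerDl -oppr_ge0.
move=> i x y; rewrite /u /q thetaE; case: ifP => _.
  exact: grid_loss_ge.
exact: grid_null_loss_ge.
Qed.

End grid_max_risk.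

(** * An upper bound of the minimax risk *)

(* The prediction mixes the two densities that are good when the mean is null,
   resp. not null; the weights are those of a Bayes rule with uniform slab, the
   factor [a < 1] making the weight of the slab integrable under a null mean. *)
Section threshold_predictor.
Context {R : realType}.
Variables r eta a : R.
Hypotheses (r0 : 0 < r) (eta0 : 0 < eta) (eta1 : eta < 1).
Hypotheses (a0 : 0 < a) (a1 : a < 1).

Local Notation v := (grid_v r).
Local Notation lambda := (grid_spacing r eta).
Local Notation L := (- ln eta).

(** Written in the shape of [integral_normal_expR_sqr], so that its mean under a null coordinate is
    [eta / Num.sqrt (1 - a)]. *)
Definition slab_odds (x : R) : R := eta * expR (a * (x - 0) ^+ 2 / (2 * 1)).

Definition threshold_pdf (x y : R) : R :=
  (normal_pdf 0 (Num.sqrt r) y + slab_odds x * normal_pdf x (Num.sqrt r) y) /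
  (1 + slab_odds x).

Lemma slab_odds_gt0 x : 0 < slab_odds x.
Proof. by rewrite mulr_gt0 ?expR_gt0. Qed.

Lemma slab_odds1_gt0 x : 0 < 1 + slab_odds x.
Proof. by rewrite addr_gt0 ?slab_odds_gt0. Qed.

Lemma threshold_pdf_gt0 x y : 0 < threshold_pdf x y.
Proof.
rewrite divr_gt0 ?slab_odds1_gt0// addr_gt0 ?normal_pdf_gt0//.
by rewrite mulr_gt0 ?slab_odds_gt0 ?normal_pdf_gt0.
Qed.

Lemma measurable_slab_odds : measurable_fun setT slab_odds.
Proof. by apply: measurable_funM => //; exact: measurable_expR_sqr. Qed.

Lemma measurable_threshold_pdf :
  measurable_fun setT (fun p : measurableTypeR R * measurableTypeR R =>
    threshold_pdf p.1 p.2).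
Proof.
have m1 : measurable_fun setT (fun x => (1 + slab_odds x)^-1).
  rewrite (_ : (fun _ => _) = fun x => expR (- ln (1 + slab_odds x))).
    apply: measurableT_comp => //; apply: measurableT_comp => //.
    apply: (measurableT_comp (@measurable_ln R)); apply: measurable_funD => //.
    exact: measurable_slab_odds.
  by apply/funext => x; rewrite expRN lnK ?posrE ?slab_odds1_gt0.
apply: measurable_funM; last exact: (measurableT_comp m1 measurable_fst).
apply: measurable_funD.
  exact: (measurableT_comp (measurable_normal_pdf _ _) measurable_snd).
apply: measurable_funM; first exact: (measurableT_comp measurable_slab_odds measurable_fst).
have -> : (fun p : measurableTypeR R * measurableTypeR R =>
    normal_pdf p.1 (Num.sqrt r) p.2) = (fun p => normal_pdf p.2 (Num.sqrt r) p.1) \o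
    (fun p => (p.2, p.1)) by [].
apply: measurableT_comp; first exact: measurable_normal_pdf_joint.
by apply/measurable_fun_pairP; split; [exact: measurable_snd|exact: measurable_fst].
Qed.

Lemma integral_threshold_pdf x :
  (\int[lebesgue_measure]_y (threshold_pdf x y)%:E = 1)%E.
Proof.
have mn m : measurable_fun setT (fun y : R => (normal_pdf m (Num.sqrt r) y)%:E).
  by apply/measurable_EFinP; exact: measurable_normal_pdf.
have n0 m y : (0 <= (normal_pdf m (Num.sqrt r) y)%:E)%E.
  by rewrite lee_fin normal_pdf_ge0.
have g0 : (0 <= (slab_odds x)%:E)%E by rewrite lee_fin ltW// slab_odds_gt0.
rewrite /threshold_pdf; under eq_integral do rewrite mulrC EFinM EFinD EFinM.
have gn m : measurable_fun setT
    (fun y : R => ((slab_odds x)%:E * (normal_pdf m (Num.sqrt r) y)%:E)%E).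
  exact: measurable_funeM.
have gn0 m y : (0 <= (slab_odds x)%:E * (normal_pdf m (Num.sqrt r) y)%:E)%E.
  by rewrite mule_ge0.
have I1 : (\int[lebesgue_measure]_y
    ((slab_odds x)%:E * (normal_pdf x (Num.sqrt r) y)%:E) = (slab_odds x)%:E)%E.
  rewrite ge0_integralZl//=; first by rewrite integral_normal_pdf mule1.
  exact: mn.
have I2 : (\int[lebesgue_measure]_y ((normal_pdf 0 (Num.sqrt r) y)%:E +
    (slab_odds x)%:E * (normal_pdf x (Num.sqrt r) y)%:E) =
    (1 + slab_odds x)%:E)%E.
  rewrite ge0_integralD//=.
  - by rewrite I1 integral_normal_pdf.
  - exact: mn.
  - exact: gn.
rewrite ge0_integralZl//=.
- by rewrite I2 -EFinM mulVf// gt_eqF// slab_odds1_gt0.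
- by apply: emeasurable_funD; [exact: mn|exact: gn].
- by move=> y _; rewrite adde_ge0.
- by rewrite lee_fin invr_ge0 ltW// slab_odds1_gt0.
Qed.

Definition threshold_density n (x y : vec R n) : R :=
  \prod_(i < n) threshold_pdf (tnth x i) (tnth y i).

Lemma predictive_threshold_density n : predictive_density (@threshold_density n).
Proof.
split.
- apply: measurable_prod => i _.
  have -> : (fun xy : vec R n * vec R n => threshold_pdf (tnth xy.1 i) (tnth xy.2 i)) =
    (fun p => threshold_pdf p.1 p.2) \o (fun xy : vec R n * vec R n =>
      (tnth xy.1 i : measurableTypeR R, tnth xy.2 i : measurableTypeR R)) by [].
  apply: measurableT_comp; first exact: measurable_threshold_pdf.
  apply/measurable_fun_pairP; split.
    exact: (measurableT_comp (measurable_tnth i) measurable_fst).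
  exact: (measurableT_comp (measurable_tnth i) measurable_snd).
- by move=> x y; apply: prodr_ge0 => i _; exact/ltW/threshold_pdf_gt0.
- move=> x; rewrite /threshold_density.
  rewrite (@ge0_integral_nfold_prod _ (measurableTypeR R) R _ n
    (fun i => threshold_pdf (tnth x i))).
  + by rewrite big1// => i _; exact: integral_threshold_pdf.
  + move=> i; exact: (measurableT_comp measurable_threshold_pdf
      (measurable_pair1 (tnth x i))).
  + by move=> i y; exact/ltW/threshold_pdf_gt0.
Qed.

Lemma threshold_null_loss_le x y :
  ln (normal_pdf 0 (Num.sqrt r) y / threshold_pdf x y) <= slab_odds x.
Proof.
have g0 := slab_odds_gt0 x; have g1 := slab_odds1_gt0 x.
have p0 := normal_pdf_gt0 0 y r0; have px := normal_pdf_gt0 x y r0.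
have H : ln (1 + slab_odds x) <= slab_odds x.
  by apply: le_ln1Dx; apply: lt_trans g0; rewrite ltrN10.
apply: le_trans H.
rewrite ler_ln ?posrE ?divr_gt0 ?threshold_pdf_gt0//.
rewrite ler_pdivrMr ?threshold_pdf_gt0// /threshold_pdf mulrC divfK ?gt_eqF//.
  by rewrite lerDl mulr_ge0// ltW.
by rewrite addr_gt0// mulr_gt0.
Qed.

(** The cases split at [|x| = lambda]. Below it the null component has weight at least [1/2], and
    predicting from [0] costs about [lambda ^+ 2 / (2 * r) = L * (1 - v)]. Above it the slab
    component is accurate, and its weight costs at most [L - a * lambda ^+ 2 / 2 = L * (1 - a * v)]
    up to [ln 2]. The two costs meet as [a] tends to [1]. *)
Lemma threshold_loss_le t x y :
  ln (normal_pdf t (Num.sqrt r) y / threshold_pdf x y) <=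
  L * (1 - a * v) + ln 2 + (2 * lambda * `|y - x| + (y - x) ^+ 2) / (2 * r).
Proof.
have g0 := slab_odds_gt0 x; have g1 := slab_odds1_gt0 x.
have L0 := neg_ln_gt0 eta0 eta1; have v0 := grid_v_gt0 r0; have v1 := grid_v_lt1 r0.
have l2 := grid_spacing_sqr r0 eta0 eta1.
have l0 : 0 <= lambda by exact: sqrtr_ge0.
have pt := normal_pdf_gt0 t y r0.
have p0 := normal_pdf_gt0 0 y r0; have px := normal_pdf_gt0 x y r0.
pose pr := normal_peak (Num.sqrt r).
have pr0 : 0 < pr by exact/normal_peak_gt0/sqrtr_neq0.
have ptle : normal_pdf t (Num.sqrt r) y <= pr.
  by rewrite normal_pdf_ub// sqrtr_neq0.
have av : a * v <= 1.
  by rewrite -[leRHS]mul1r ler_pM// ltW.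
have gE : slab_odds x = expR (- (L - a * x ^+ 2 / 2)).
  rewrite /slab_odds -[X in X * _](lnK eta0) -expRD subr0; congr expR.
  by field.
have key (c : R) : (expR c)^-1 * pr / 2 <= threshold_pdf x y ->
    ln (normal_pdf t (Num.sqrt r) y / threshold_pdf x y) <= c + ln 2.
  move=> h; have e0 := expR_gt0 c.
  have h0 : 0 < (expR c)^-1 * pr / 2 by rewrite divr_gt0// mulr_gt0// invr_gt0.
  have -> : c + ln 2 = ln (pr / ((expR c)^-1 * pr / 2)).
    rewrite (_ : pr / _ = expR c * 2).
      by rewrite lnM ?posrE// expRK.
    by field; rewrite !gt_eqF.
  have tp := threshold_pdf_gt0 x y.
  rewrite ler_ln ?posrE; [|exact: divr_gt0|exact: divr_gt0].
  apply: ler_pM => //; first exact: ltW.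
    by rewrite invr_ge0 ltW.
  by rewrite lef_pV2 ?posrE.
rewrite addrAC; apply: key.
have [xl|xl] := leP (x ^+ 2) (lambda ^+ 2).
  have g_le1 : slab_odds x <= 1.
    rewrite gE -[leRHS]expR0 ler_expR oppr_le0 subr_ge0 ler_pdivrMr//.
    apply: (@le_trans _ _ (1 * lambda ^+ 2)).
      by apply: ler_pM => //; [exact: ltW|exact: sqr_ge0|exact: ltW].
    by rewrite mul1r l2; have := ler_wpM2l (ltW L0) (ltW v1); lra.
  apply: (@le_trans _ _ (normal_pdf 0 (Num.sqrt r) y / 2)); last first.
    rewrite /threshold_pdf ler_pM ?invr_ge0 ?(ltW p0)//.
      by rewrite lerDl mulr_ge0// ltW.
    by rewrite lef_pV2 ?posrE//; lra.
  rewrite ler_pM2r ?invr_gt0// normal_pdf_sqrtE// -/pr mulrC ler_pM2l//.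
  have nE : - (y - 0) ^+ 2 / (2 * r) = - (y ^+ 2 / (2 * r)) by rewrite subr0 mulNr.
  rewrite -expRN ler_expR nE lerN2.
  have xl' : `|x| <= lambda.
    rewrite -(ler_pXn2r (n := 2))// ?nnegrE ?normr_ge0//.
    by rewrite real_normK ?num_real.
  have hxy : x * (y - x) <= lambda * `|y - x|.
    by apply: le_trans (ler_norm _) _; rewrite normrM ler_wpM2r.
  have yE : y ^+ 2 = x ^+ 2 + 2 * (x * (y - x)) + (y - x) ^+ 2 by ring.
  have y2 : y ^+ 2 <= lambda ^+ 2 + (2 * lambda * `|y - x| + (y - x) ^+ 2).
    by rewrite yE; lra.
  apply: le_trans (ler_wpM2r _ y2) _; first by rewrite invr_ge0 mulr_ge0// ltW.
  rewrite mulrDl lerD2r l2.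
  rewrite [leLHS](_ : _ = L * (v * r^-1)); last by field; rewrite gt_eqF.
  apply: ler_wpM2l; first exact: ltW.
  have -> : v * r^-1 = 1 - v.
    have : v * v^-1 = 1 by rewrite mulfV// gt_eqF.
    by rewrite grid_vV; lra.
  by have := ler_wpM2r (ltW v0) (ltW a1); lra.
apply: (@le_trans _ _ (slab_odds x * normal_pdf x (Num.sqrt r) y / (1 + slab_odds x))); last first.
  by rewrite /threshold_pdf ler_pM2r ?invr_gt0// lerDr ltW.
have gi : (1 + slab_odds x) <= slab_odds x * (2 * expR (L * (1 - a * v))).
  have ge : 1 <= slab_odds x * expR (L * (1 - a * v)).
    rewrite gE -expRD -[leLHS]expR0 ler_expR.
    have := ler_wpM2l (ltW a0) (ltW xl); rewrite l2; lra.
  have e1 : 1 <= expR (L * (1 - a * v)).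
    by rewrite -[leLHS]expR0 ler_expR mulr_ge0 ?(ltW L0)// subr_ge0.
  have := ler_wpM2l (ltW g0) e1; lra.
rewrite expRD invfM normal_pdf_sqrtE// -/pr.
set E := expR (L * _) in gi *; have E0 : 0 < E by exact: expR_gt0.
have lower : E^-1 / 2 <= slab_odds x / (1 + slab_odds x).
  rewrite ler_pdivlMr// -invfM mulrC ler_pdivrMr ?mulr_gt0//.
  by rewrite [E * 2]mulrC.
have tail : (expR ((2 * lambda * `|y - x| + (y - x) ^+ 2) / (2 * r)))^-1 <=
    expR (- (y - x) ^+ 2 / (2 * r)).
  rewrite -expRN ler_expR mulNr lerN2 ler_wpM2r ?invr_ge0 ?mulr_ge0 ?(ltW r0)//.
  by rewrite lerDr !mulr_ge0.
rewrite [leLHS](_ : _ = (E^-1 / 2) *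
  (pr * (expR ((2 * lambda * `|y - x| + (y - x) ^+ 2) / (2 * r)))^-1)); last by ring.
rewrite [leRHS](_ : _ = slab_odds x / (1 + slab_odds x) *
  (pr * expR (- (y - x) ^+ 2 / (2 * r)))); last by ring.
apply: ler_pM => //.
- by rewrite mulr_ge0 ?invr_ge0 ?(ltW E0).
- by rewrite mulr_ge0 ?invr_ge0 ?expR_ge0 ?(ltW pr0).
- by rewrite ler_pM2l.
Qed.

Lemma minimax_risk_le n s :
  (minimax_risk r (@sparse R n s) <=
   (s%:R * (L * (1 - a * v) + ln 2 + (lambda / (2 * r) +
      (lambda + 1) / r * dev_mean r)) +
    n%:R * (eta * (Num.sqrt (1 - a))^-1))%:E)%E.
Proof.
apply: (@le_trans _ _ (max_risk r (@sparse R n s) (@threshold_density n))).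
  apply: ereal_inf_lbound; exists (@threshold_density n) => //.
  exact: predictive_threshold_density.
apply: ge_ereal_sup => _ [theta hs <-].
set K := L * _ + _ + _.
have v0 := grid_v_gt0 r0; have v1 := grid_v_lt1 r0.
have lr : 0 <= (lambda + 1) / r by rewrite divr_ge0 ?addr_ge0 ?sqrtr_ge0// ltW.
have K0 : 0 <= K.
  rewrite /K addr_ge0//; last first.
    rewrite addr_ge0//; last by rewrite mulr_ge0// dev_mean_ge0.
    by rewrite divr_ge0 ?sqrtr_ge0// mulr_ge0// ltW.
  rewrite addr_ge0 ?ln_ge0//; last by rewrite ler1n.
  rewrite mulr_ge0 ?(ltW (neg_ln_gt0 eta0 eta1))// subr_ge0.
  by rewrite -[leRHS]mul1r ler_pM// ltW.
set N := eta * (Num.sqrt (1 - a))^-1.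
have N0 : 0 <= N by rewrite mulr_ge0 ?invr_ge0 ?sqrtr_ge0// ltW.
pose u (i : 'I_n) (x y : R) := if tnth theta i == 0 then slab_odds x
  else L * (1 - a * v) + ln 2 + (lambda / (2 * r) +
    (lambda + 1) / r * dev r (tnth theta i) x y).
pose c (i : 'I_n) := if tnth theta i == 0 then N else K.
have uc i : has_mean r theta (fun x y => u i (tnth x i) (tnth y i)) (c i).
  rewrite /u /c; case: eqP => ti.
    apply: has_meanZ.
    apply: (@has_mean_x _ _ _ _ _ (fun x => expR (a * (x - 0) ^+ 2 / (2 * 1)))) => //.
    - exact: measurable_expR_sqr.
    - by rewrite ti; exact: integral_normal_expR_sqr.
  apply: has_meanD; first exact: has_mean_cst.
  apply: has_meanD; first exact: has_mean_cst.
  by apply: has_meanZ; exact: has_mean_dev.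
apply: (le_trans (risk_product_le r0 threshold_pdf_gt0 uc _)).
  move=> i x y; rewrite /u; case: eqP => [->|_].
    exact: threshold_null_loss_le.
  apply: (le_trans (threshold_loss_le _ x y)).
  by rewrite lerD2l; apply: quad_le_dev => //; exact: sqrtr_ge0.
by rewrite lee_fin; apply: sum_sparse_le.
Qed.

End threshold_predictor.

(** * Gibbs' inequality against a finite uniform prior *)

Section finite_prior_lower_bound.
Context {R : realType}.
Variables (n : nat) (r : R) (I : finType) (theta : I -> vec R n) (theta0 : vec R n).
Hypotheses (r0 : 0 < r) (I0 : (0 < #|I|)%N).

Definition pair_density (k : I) (x y : vec R n) : R :=
  gauss_pdf (theta k) 1 x * gauss_pdf (theta k) r y.

(** A sum and not an average: the factor [#|I|^-1] of the uniform prior is kept apart. *)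
Definition pair_mixture (x y : vec R n) : R := \sum_k pair_density k x y.

Lemma pair_density_gt0 k x y : 0 < pair_density k x y.
Proof. by rewrite mulr_gt0 ?gauss_pdf_gt0. Qed.

Lemma pair_mixture_gt0 x y : 0 < pair_mixture x y.
Proof.
have /card_gt0P[k _] := I0; rewrite /pair_mixture (bigD1 k)//=.
rewrite ltr_pwDl ?pair_density_gt0//; apply: sumr_ge0 => j _.
exact/ltW/pair_density_gt0.
Qed.

Let weight k x y : R := pair_density k x y / pair_mixture x y.

Let weight_ge0 k x y : 0 <= weight k x y.
Proof. by rewrite divr_ge0 ?ltW ?pair_density_gt0 ?pair_mixture_gt0. Qed.

Let sum_weight x y : \sum_k weight k x y = 1.
Proof. by rewrite -mulr_suml divff// gt_eqF// pair_mixture_gt0. Qed.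

Let measurable_pair_density k : measurable_fun setT
  (fun p : vec R n * vec R n => pair_density k p.1 p.2).
Proof.
apply: measurable_funM.
  exact: (measurableT_comp (measurable_gauss_pdf _ _) measurable_fst).
exact: (measurableT_comp (measurable_gauss_pdf _ _) measurable_snd).
Qed.

Let measurable_weight k : measurable_fun setT
  (fun p : vec R n * vec R n => weight k p.1 p.2).
Proof.
apply: measurable_funM; first exact: measurable_pair_density.
rewrite (_ : (fun _ => _) = fun p => expR (- ln (pair_mixture p.1 p.2))).
  apply: measurableT_comp => //; apply: measurableT_comp => //.
  apply: (measurableT_comp (@measurable_ln R)).
  by apply: measurable_sum => k'; exact: measurable_pair_density.
by apply/funext => p; rewrite expRN lnK ?posrE ?pair_mixture_gt0.
Qed.

Variable phat : vec R n -> vec R n -> R.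
Hypothesis phatP : predictive_density phat.

Local Open Scope ereal_scope.

Let measurable_phatW k : measurable_fun setT
  (fun p : vec R n * vec R n => (phat p.1 p.2 * weight k p.1 p.2)%:E).
Proof.
case: phatP => mp _ _; apply/measurable_EFinP; exact: measurable_funM.
Qed.

Let phatW_ge0 k (p : vec R n * vec R n) :
  0 <= (phat p.1 p.2 * weight k p.1 p.2)%:E.
Proof. by case: phatP => _ p0 _; rewrite lee_fin mulr_ge0. Qed.

(** The mean posterior weight of [k] when [y] is drawn from [phat x]; [b k] averages it further over
    [x] drawn with mean [theta0]. Both families sum to one over [k]. *)
Let G k x := \int[@lebesgue_vec R n]_y (phat x y * weight k x y)%:E.

Let measurable_G k : measurable_fun setT (G k).
Proof.
exact: (@measurable_fun_fubini_tonelli_F _ _ _ _ _ (@lebesgue_vec R n) _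
  (measurable_phatW k) (phatW_ge0 k)).
Qed.

Let G_ge0 k x : 0 <= G k x.
Proof. by apply: integral_ge0 => y _; exact: (phatW_ge0 k (x, y)). Qed.

Let measurable_phat x : measurable_fun setT (phat x).
Proof.
case: phatP => mp _ _; exact: (measurableT_comp mp (measurable_pair1 x)).
Qed.

Let measurable_weight_x k x : measurable_fun setT (weight k x).
Proof. exact: (measurableT_comp (measurable_weight k) (measurable_pair1 x)). Qed.

Let sum_G x : \sum_k G k x = 1.
Proof.
case: phatP => _ p0 p1; rewrite -(p1 x) -ge0_integral_sum//.
- by apply: eq_integral => y _; rewrite sumEFin -mulr_sumr sum_weight mulr1.
- by move=> k; apply/measurable_EFinP; apply: measurable_funM.
- by move=> k y _; exact: (phatW_ge0 k (x, y)).
Qed.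

Let G_fin k x : G k x = (fine (G k x))%:E.
Proof.
rewrite fineK// ge0_fin_numE//; apply: (@le_lt_trans _ _ 1); last exact: ltry.
rewrite -(sum_G x) (bigD1 k)//= leeDl//.
by apply: sume_ge0 => j _; exact: G_ge0.
Qed.

Let b k := \int[@lebesgue_vec R n]_x (fine (G k x) * gauss_pdf theta0 1 x)%:E.

Let G0 k x : (0 <= fine (G k x) * gauss_pdf theta0 1 x)%R.
Proof. by rewrite mulr_ge0 ?gauss_pdf_ge0// fine_ge0. Qed.

Let mG k : measurable_fun setT (fun x => fine (G k x) * gauss_pdf theta0 1 x)%R.
Proof.
apply: measurable_funM; last exact: measurable_gauss_pdf.
by apply: measurableT_comp => //; exact: measurable_G.
Qed.

Let sum_b : \sum_k b k = 1.
Proof.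
rewrite -(integral_gauss_pdf theta0 1) -ge0_integral_sum//.
- apply: eq_integral => x _; rewrite sumEFin -mulr_suml; congr (_%:E).
  rewrite (_ : \sum_k fine (G k x) = 1)%R ?mul1r//.
  apply/EFin_inj; rewrite -sumEFin -[RHS](sum_G x).
  by apply: eq_bigr => k _; rewrite -G_fin.
- by move=> k; apply/measurable_EFinP.
- by move=> k x _; rewrite lee_fin.
Qed.

Let b_fin k : b k = (fine (b k))%:E.
Proof.
have b0 j : 0 <= b j by apply: integral_ge0 => x _; rewrite lee_fin.
rewrite fineK// ge0_fin_numE//; apply: (@le_lt_trans _ _ 1); last exact: ltry.
by rewrite -sum_b (bigD1 k)//= leeDl// sume_ge0.
Qed.

Let N : R := #|I|%:R.

Let N0 : (0 < N)%R. Proof. by rewrite ltr0n. Qed.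

(* The means of [W] under the members of the family sum up to [N], because
   [pair_mixture * W / N] is a probability density. *)
Let W x y : R := (phat x y * (N * gauss_pdf theta0 1 x / pair_mixture x y))%R.

Let gauss_W k x y : (gauss_pdf (theta k) r y * W x y =
  N * gauss_pdf theta0 1 x / gauss_pdf (theta k) 1 x *
    (phat x y * weight k x y))%R.
Proof.
rewrite /W /weight /pair_density; field.
by rewrite !gt_eqF ?pair_mixture_gt0 ?gauss_pdf_gt0.
Qed.

Let has_mean_W k : has_mean r (theta k) W (N * fine (b k)).
Proof.
case: phatP => _ p0 _.
have c0 x : (0 <= N * gauss_pdf theta0 1 x / gauss_pdf (theta k) 1 x)%R.
  by rewrite divr_ge0 ?mulr_ge0 ?gauss_pdf_ge0// ltW.
have E1 x : \int[@lebesgue_vec R n]_y (gauss_pdf (theta k) r y * W x y)%:E =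
    (N * gauss_pdf theta0 1 x / gauss_pdf (theta k) 1 x * fine (G k x))%:E.
  under eq_integral do rewrite gauss_W EFinM.
  rewrite ge0_integralZl//.
  - by rewrite [RHS]EFinM -G_fin.
  - by apply/measurable_EFinP; apply: measurable_funM.
  - by move=> y _; exact: (phatW_ge0 k (x, y)).
  - by rewrite lee_fin.
have E2 x : (N * gauss_pdf theta0 1 x / gauss_pdf (theta k) 1 x * fine (G k x) *
    gauss_pdf (theta k) 1 x = N * (fine (G k x) * gauss_pdf theta0 1 x))%R.
  by field; rewrite gt_eqF ?gauss_pdf_gt0.
have E3 : \int[@lebesgue_vec R n]_x
    (N * (fine (G k x) * gauss_pdf theta0 1 x))%:E = (N * fine (b k))%:E.
  under eq_integral do rewrite EFinM.
  rewrite ge0_integralZl//.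
  - by rewrite [RHS]EFinM -b_fin.
  - exact/measurable_EFinP.
  - by move=> x _; rewrite lee_fin.
  - by rewrite lee_fin ltW.
exists (fun x => N * gauss_pdf theta0 1 x / gauss_pdf (theta k) 1 x *
  fine (G k x))%R; split=> //.
- move=> x; apply: ge0_integrable (E1 x).
    rewrite (_ : (fun _ => _) = (fun y => N * gauss_pdf theta0 1 x /
      gauss_pdf (theta k) 1 x * (phat x y * weight k x y)))%R; last first.
      by apply/funext => y; rewrite gauss_W.
    by apply: measurable_funM => //; apply: measurable_funM.
  by move=> y; rewrite gauss_W mulr_ge0// mulr_ge0.
- rewrite (_ : (fun _ => _) = EFin \o
    (fun x => N * (fine (G k x) * gauss_pdf theta0 1 x))%R); last first.
    by apply/funext => x /=; rewrite E2.
  apply: ge0_integrable E3; first by apply: measurable_funM.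
  by move=> x; rewrite mulr_ge0// ltW.
- by under eq_integral do rewrite E2.
Qed.

(** An estimator is a density in [y] only; multiplying it by the density of [X] at [theta0] gives a
    joint density to set against the mixture. Using [theta0] in place of the marginal of [X] loses
    their divergence but keeps the ratio explicit. *)
Lemma average_le_max_risk (Theta : set (vec R n))
    (U : I -> vec R n -> vec R n -> R) (c : I -> R) :
  (forall k, Theta (theta k)) ->
  (forall k, has_mean r (theta k) (U k) (c k)) ->
  (forall k x y, U k x y <= ln (gauss_pdf (theta k) r y *
     (N * gauss_pdf theta0 1 x / pair_mixture x y)))%R ->
  ((\sum_k c k) / N)%:E <= max_risk r Theta phat.
Proof.
move=> thP Uc U_le; case: phatP => _ p0 _.
have le_k k : (c k + (1 + -1 * (N * fine (b k))))%:E <= max_risk r Theta phat.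
  apply: (@le_trans _ _ (risk r (theta k) phat)); last first.
    by apply: ereal_sup_ubound; exists (theta k).
  apply: (risk_ge (U := fun x y => U k x y + (1 + -1 * W x y))%R).
    apply: has_meanD => //; apply: has_meanD; first exact: has_mean_cst.
    by apply: has_meanZ; exact: has_mean_W.
  move=> x y; have g0 := gauss_pdf_gt0 (theta k) y r0.
  have h0 : (0 < N * gauss_pdf theta0 1 x / pair_mixture x y)%R.
    by rewrite divr_gt0 ?pair_mixture_gt0 ?mulr_gt0 ?gauss_pdf_gt0.
  (* Where [phat] vanishes the quotient is [+oo] and the bound is trivial. *)
  have := p0 x y; rewrite le_eqVlt => /predU1P[<-|px].
    by rewrite inver eqxx gt0_muley ?lte_fin//= leey.
  rewrite inver gt_eqF// -EFinM lne_EFin ?divr_gt0// lee_fin.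
  have W0 : (0 < W x y)%R by rewrite mulr_gt0.
  have -> : (gauss_pdf (theta k) r y / phat x y =
     gauss_pdf (theta k) r y * (N * gauss_pdf theta0 1 x / pair_mixture x y) / W x y)%R.
    by rewrite /W; field; rewrite !gt_eqF ?pair_mixture_gt0 ?gauss_pdf_gt0.
  rewrite ln_div ?posrE//; last exact: mulr_gt0.
  apply: lerD; first exact: U_le.
  have := @le_ln1Dx R (W x y - 1); rewrite addrCA subrr addr0 => H.
  have {}H : (ln (W x y) <= W x y - 1)%R by apply: H; rewrite ltrBrDl subrr.
  by rewrite mulN1r; lra.
(* The corrections [1 - N * fine (b k)] sum to zero, so some member does at least as well as the
   average; no sum of extended-real risks has to be formed. *)
have [k hk] : exists k, ((\sum_k c k) / N <= c k + (1 + -1 * (N * fine (b k))))%R.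
  apply: contrapT => /forallNP nok.
  have lt_k k : (c k + (1 + -1 * (N * fine (b k))) < (\sum_k c k) / N)%R.
    by rewrite ltNge; apply/negP; exact: nok.
  have sb : (\sum_k fine (b k) = 1)%R.
    apply/EFin_inj; rewrite -sumEFin -[RHS]sum_b.
    by apply: eq_bigr => k _; rewrite -b_fin.
  have /card_gt0P[k0 _] := I0.
  have : (\sum_k (c k + (1 + -1 * (N * fine (b k)))) < \sum_(k : I) (\sum_k c k) / N)%R.
    apply: ltr_sum => //; by apply/hasP; exists k0; rewrite ?mem_index_enum.
  rewrite sumr_const -[X in (_ < X)%R]mulr_natr divfK ?gt_eqF//.
  rewrite !big_split/= -mulr_sumr -mulr_sumr sb sumr_const -/N.
  by rewrite mulr1 mulN1r subrr addr0 ltxx.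
by apply: le_trans (le_k k); rewrite lee_fin.
Qed.

End finite_prior_lower_bound.

(** * Independent blocks with one spike each *)

Section spike_blocks.
Context {R : realType}.
Variables (n s m : nat) (r tau : R).
Hypotheses (r0 : 0 < r) (m0 : (0 < m)%N) (smn : (s * m <= n)%N) (tau0 : 0 <= tau).

Let lt_code (b : 'I_s) (j : 'I_m) : (b * m + j < n)%N.
Proof.
apply: leq_trans smn; apply: (@leq_trans (b.+1 * m)%N).
  by rewrite mulSn addnC ltn_add2r.
by rewrite leq_mul2r ltn_ord orbT.
Qed.

(** Only the first [s * m] coordinates belong to blocks; the others stay null. *)
Definition block_index (b : 'I_s) (j : 'I_m) : 'I_n := Ordinal (lt_code b j).

Lemma block_index_inj b j b' j' : block_index b j = block_index b' j' ->
  b = b' /\ j = j'.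
Proof.
move=> /(congr1 val)/= E; split; apply: val_inj => /=.
  by have := congr1 (divn^~ m) E; rewrite /= !divnMDl// !divn_small// !addn0.
by have := congr1 (modn^~ m) E; rewrite /= !modnMDl !modn_small.
Qed.

Definition spike_support (f : {ffun 'I_s -> 'I_m}) : {set 'I_n} :=
  [set block_index b (f b) | b : 'I_s].

Definition spike (f : {ffun 'I_s -> 'I_m}) : vec R n :=
  [tuple if i \in spike_support f then tau else 0 | i < n].

Definition null_mean : vec R n := [tuple 0 | i < n].

Lemma tnth_spike f i : tnth (spike f) i = if i \in spike_support f then tau else 0.
Proof. by rewrite tnth_mktuple. Qed.

Lemma mem_spike_support f b j : (block_index b j \in spike_support f) = (j == f b).
Proof.
apply/imsetP/eqP => [[b' _ /block_index_inj[-> ->]]//|->].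
by exists b.
Qed.

Lemma sparse_spike f : sparse s (spike f).
Proof.
rewrite /sparse/= /norm0; apply: (@leq_trans #|spike_support f|).
  apply: subset_leq_card; apply/fintype.subsetP => i; rewrite inE tnth_spike.
  by case: ifP => // _; rewrite eqxx.
by rewrite -[leqRHS]card_ord; exact: leq_imset_card.
Qed.

(** The likelihood ratio of the mean [tau] to the mean [0] for one observation of variance [s2]. *)
Definition tilt (s2 t : R) : R := expR (tau * t / s2 - tau ^+ 2 / (2 * s2)).

Lemma gauss_pdf_spike f (s2 : R) x : 0 < s2 ->
  gauss_pdf (spike f) s2 x =
  gauss_pdf null_mean s2 x * \prod_b tilt s2 (tnth x (block_index b (f b))).
Proof.
move=> s20; rewrite /gauss_pdf.
rewrite (eq_bigr (fun i : 'I_n => normal_pdf (tnth null_mean i) (Num.sqrt s2) (tnth x i) *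
    (if i \in spike_support f then tilt s2 (tnth x i) else 1))); last first.
  move=> i _; rewrite tnth_spike tnth_mktuple; case: ifP => _; rewrite ?mulr1//.
  by rewrite normal_pdf_tilt.
rewrite big_split/= -big_mkcond/= big_imset//=.
by move=> b b' _ _ /block_index_inj[].
Qed.

Definition lratio (x y : vec R n) (i : 'I_n) : R :=
  tilt 1 (tnth x i) * tilt r (tnth y i).

Lemma lratio_gt0 x y i : 0 < lratio x y i.
Proof. by rewrite mulr_gt0 ?expR_gt0. Qed.

(** Placements are functions from blocks to positions, so the sum over them of products of
    likelihood ratios is an expanded product of block sums. *)
Lemma spike_mixture x y : pair_mixture r spike x y =
  gauss_pdf null_mean 1 x * gauss_pdf null_mean r y *
  \prod_(b < s) \sum_(j < m) lratio x y (block_index b j).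
Proof.
rewrite bigA_distr_bigA/= /pair_mixture mulr_sumr; apply: eq_bigr => f _.
rewrite /pair_density !gauss_pdf_spike// /lratio big_split/=; ring.
Qed.

Lemma spike_likelihood f x y :
  gauss_pdf (spike f) r y * (#|{ffun 'I_s -> 'I_m}|%:R * gauss_pdf null_mean 1 x /
    pair_mixture r spike x y) =
  \prod_(b < s) (tilt r (tnth y (block_index b (f b))) * m%:R /
     \sum_(j < m) lratio x y (block_index b j)).
Proof.
have [/card_gt0P[j0 _]] : (0 < #|'I_m|)%N by rewrite card_ord.
have p0 : 0 < \prod_(b < s) \sum_(j < m) lratio x y (block_index b j).
  apply: prodr_gt0 => b _; rewrite (bigD1 j0)//=.
  rewrite ltr_pwDl ?lratio_gt0//; apply: sumr_ge0 => j _; exact/ltW/lratio_gt0.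
rewrite prodf_div big_split/= prodr_const card_ord.
rewrite gauss_pdf_spike// spike_mixture card_ffun !card_ord natrX.
by field; rewrite !gt_eqF ?gauss_pdf_gt0.
Qed.

Hypothesis tau2 : tau ^+ 2 = 2 * grid_v r * ln m%:R.

Let spread : R := tau * (1 + 2 / r).

Let gain : R := tau ^+ 2 / (2 * r) - ln 2 - spread.

(** [tau ^+ 2 * (1 + r^-1) = 2 * ln m] makes the likelihood ratio at the true position equal to [m]
    when both observations sit at [tau]. The block sum divided by [m] is then of order one up to
    deviations, and what remains is [tilt r Y], about [expR (tau ^+ 2 / (2 * r))]. The coefficient
    [spread] counts the deviation of [Y] twice: in the block sum and in [tilt r Y]. *)
Lemma spike_block_ge (X Y S : R) : 0 <= S ->
  gain + (- spread * dev r tau X Y + - m%:R^-1 * S) <=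
  ln (tilt r Y * m%:R / (tilt 1 X * tilt r Y + S)).
Proof.
move=> S0; have mr : 0 < m%:R :> R by rewrite ltr0n.
have t1 : 0 < tilt 1 X by exact: expR_gt0.
have t2 : 0 < tilt r Y by exact: expR_gt0.
have ES : 0 < tilt 1 X * tilt r Y + S by rewrite ltr_pwDl// mulr_gt0.
set e := tilt 1 X * tilt r Y in ES *.
have e0 : 0 < e by exact: mulr_gt0.
pose h := tau * (`|X - tau| + `|Y - tau| / r).
have h0 : 0 <= h by rewrite mulr_ge0// addr_ge0// divr_ge0// ltW.
have v0 := grid_v_gt0 r0.
have t2v : tau ^+ 2 + tau ^+ 2 / r = 2 * ln m%:R.
  have : grid_v r * (1 + r^-1) = 1 by rewrite -grid_vV mulfV// gt_eqF.
  rewrite tau2 => E; rewrite [LHS](_ : _ = 2 * ln m%:R * (grid_v r * (1 + r^-1))).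
    by rewrite E mulr1.
  by ring.
have em : e / m%:R <= expR h.
  have -> : e / m%:R = expR (tau * (X - tau) + tau * (Y - tau) / r).
    rewrite /e /tilt -expRD -[in LHS](lnK (x := m%:R)) ?posrE// -expRN -expRD.
    congr expR.
    rewrite [RHS](_ : _ = tau * X + tau * Y / r - (tau ^+ 2 + tau ^+ 2 / r)); last by ring.
    rewrite t2v [LHS](_ : _ = tau * X + tau * Y / r -
      2^-1 * (tau ^+ 2 + tau ^+ 2 / r) - ln m%:R); last by field; rewrite gt_eqF.
    by rewrite t2v; field; rewrite gt_eqF.
  rewrite ler_expR /h [leRHS]mulrDr lerD//; first by rewrite ler_wpM2l// ler_norm.
  by rewrite [leRHS]mulrA ler_wpM2r ?invr_ge0 ?(ltW r0)// ler_wpM2l// ler_norm.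
have e1 : 1 <= expR h by rewrite -[leLHS]expR0 ler_expR.
(* The sum is majorised by a product so that its logarithm becomes linear in [S]. *)
have step : (e + S) / m%:R <= 2 * expR h * expR (m%:R^-1 * S).
  have s1 : 1 + m%:R^-1 * S <= expR (m%:R^-1 * S) by exact: expR_ge1Dx.
  have mS : 0 <= m%:R^-1 * S by rewrite mulr_ge0// invr_ge0 ltW.
  apply: (@le_trans _ _ (2 * expR h * (1 + m%:R^-1 * S))); last first.
    by rewrite ler_pM2l// mulr_gt0 ?expR_gt0.
  rewrite mulrDl [S / _]mulrC.
  have := ler_wpM2r mS e1; lra.
have -> : tilt r Y * m%:R / (e + S) = tilt r Y / ((e + S) / m%:R).
  by field; rewrite !gt_eqF.
rewrite ln_div ?posrE//; last by rewrite divr_gt0.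
have : ln ((e + S) / m%:R) <= ln 2 + h + m%:R^-1 * S.
  apply: le_trans (_ : ln (2 * expR h * expR (m%:R^-1 * S)) <= _).
    by rewrite ler_ln ?posrE ?divr_gt0 ?mulr_gt0 ?expR_gt0.
  by rewrite !lnM ?posrE ?mulr_gt0 ?expR_gt0// !expRK.
rewrite expRK.
have hd := sqr_le_dev r0 tau X Y.
move: (dev r tau X Y) hd => d hd.
have absle (z : R) : `|z| <= 1 + z ^+ 2.
  rewrite -(real_normK (num_real z)); have := sqr_ge0 (`|z| - 1); have := normr_ge0 z.
  rewrite sqrrB; lra.
have ax := absle (X - tau); have ay := absle (Y - tau).
have X2 := sqr_ge0 (X - tau); have Y2 := sqr_ge0 (Y - tau).
have ri : 0 <= r^-1 by rewrite invr_ge0 ltW.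
have ny : - `|Y - tau| <= Y - tau by rewrite lerNl -normrN ler_norm.
have yr : tau * Y / r - tau ^+ 2 / (2 * r) >=
    tau ^+ 2 / (2 * r) - tau * (`|Y - tau| / r).
  have := ler_wpM2l (mulr_ge0 tau0 ri) ny.
  rewrite [(2 * r)^-1]invfM; lra.
have hs : h + tau * (`|Y - tau| / r) <= spread * (1 + d).
  rewrite /h /spread -mulrDr -mulrA ler_wpM2l//.
  have dx : `|X - tau| <= 1 + d by lra.
  have dy : `|Y - tau| <= 1 + d by lra.
  have := ler_wpM2r ri dy; lra.
rewrite /gain; lra.
Qed.

Lemma has_mean_lratio f i : i \notin spike_support f ->
  has_mean r (spike f) (fun x y => lratio x y i) 1.
Proof.
move=> nif; have ti : tnth (spike f) i = 0 by rewrite tnth_spike (negbTE nif).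
rewrite -[1 in X in has_mean _ _ _ X](mulr1 1).
apply: (@has_mean_xy _ _ _ _ _ (tilt 1) (tilt r)).
- exact: measurable_expR_tilt.
- by move=> x; exact: expR_ge0.
- exact: measurable_expR_tilt.
- by move=> x; exact: expR_ge0.
- by rewrite ti; exact: integral_normal_tilt.
- by rewrite ti; exact: integral_normal_tilt.
Qed.

Lemma minimax_risk_ge :
  ((s%:R * (gain - spread * dev_mean r - 1))%:E <=
   minimax_risk r (@sparse R n s))%E.
Proof.
have mr : 0 < m%:R :> R by rewrite ltr0n.
apply: le_ereal_inf_tmp => _ [phat hphat <-].
(* The true position is left out: the other ratios of its block are at null coordinates, so each has
   mean one, and their sum over [m] accounts for the final [- 1]. *)
pose other (f : {ffun 'I_s -> 'I_m}) b j (z : R) : R := if j == f b :> 'I_m then 0 else z.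
pose U (f : {ffun 'I_s -> 'I_m}) (x y : vec R n) := \sum_(b < s)
  (gain + (- spread * dev r (tnth (spike f) (block_index b (f b)))
      (tnth x (block_index b (f b))) (tnth y (block_index b (f b))) +
   - m%:R^-1 * \sum_(j < m) other f b j (lratio x y (block_index b j)))).
pose c (f : {ffun 'I_s -> 'I_m}) : R := \sum_(b < s)
  (gain + (- spread * dev_mean r + - m%:R^-1 * \sum_(j < m) other f b j 1)).
have card0 : (0 < #|{ffun 'I_s -> 'I_m}|)%N by rewrite card_ffun !card_ord expn_gt0 m0.
apply: le_trans (average_le_max_risk (theta := spike) (theta0 := null_mean)
  r0 card0 hphat (U := U) (c := c) sparse_spike _ _).
- rewrite lee_fin ler_pdivlMr ?ltr0n// mulr_natr -sumr_const; apply: ler_sum => f _.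
  rewrite mulr_natl -[X in _ *+ X]card_ord -sumr_const; apply: ler_sum => b _.
  rewrite -addrA lerD2l mulNr lerD2l mulNr lerN2 ler_pdivrMl// mulr1.
  rewrite -[X in _ <= X%:R]card_ord -sumr_const; apply: ler_sum => j _.
  by rewrite /other; case: ifP.
- move=> f; apply: has_mean_sum => b.
  apply: has_meanD; first exact: has_mean_cst.
  apply: has_meanD; first by apply: has_meanZ; exact: has_mean_dev.
  apply: has_meanZ; apply: has_mean_sum => j; rewrite /other; case: ifPn => jf.
    exact: has_mean_cst.
  by apply: has_mean_lratio; rewrite mem_spike_support.
- move=> f x y; rewrite spike_likelihood.
  have lnprod (F : 'I_s -> R) : (forall b, 0 < F b) ->
      ln (\prod_b F b) = \sum_b ln (F b).
    move=> F0; have [//] : 0 < \prod_b F b /\ ln (\prod_b F b) = \sum_b ln (F b).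
    apply: (big_rec2 (fun a b : R => 0 < a /\ ln a = b)); first by rewrite ln1.
    by move=> i a b _ [b0 <-]; rewrite mulr_gt0// lnM ?posrE.
  have S0 b : 0 <= \sum_(j < m) other f b j (lratio x y (block_index b j)).
    by apply: sumr_ge0 => j _; rewrite /other; case: ifP => // _; exact/ltW/lratio_gt0.
  have SE b : \sum_(j < m) lratio x y (block_index b j) =
      lratio x y (block_index b (f b)) +
      \sum_(j < m) other f b j (lratio x y (block_index b j)).
    rewrite (bigD1 (f b))//= [in RHS](bigD1 (f b))//= /other eqxx add0r.
    by congr (_ + _); apply: eq_bigr => j /negbTE ->.
  rewrite lnprod; last first.
    move=> b; rewrite SE divr_gt0 ?mulr_gt0 ?expR_gt0//.
    by rewrite ltr_pwDl ?lratio_gt0.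
  apply: ler_sum => b _; rewrite SE tnth_spike mem_spike_support eqxx.
  exact: spike_block_ge.
Qed.

End spike_blocks.

(** * The grid rule as a predictive density *)

Section grid_predictive.
Context {R : realType}.
Variables r eta : R.
Hypotheses (r0 : 0 < r) (eta0 : 0 < eta) (eta1 : eta < 1).
Local Notation P := (grid_prior r eta).

Lemma measurable_mix2_joint : measurable_fun setT
  (fun p : measurableTypeR R * measurableTypeR R => mix2 P r p.1 p.2).
Proof.
apply/measurable_EFinP.
rewrite (_ : EFin \o _ = fun p : measurableTypeR R * measurableTypeR R =>
    (\int[P]_m (normal_pdf m (Num.sqrt 1) p.1 * normal_pdf m (Num.sqrt r) p.2)%:E)%E).
  apply: (@measurable_fun_fubini_tonelli_F _ _
    (measurableTypeR R * measurableTypeR R)%type (measurableTypeR R) R P (fun q =>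
      (normal_pdf q.2 (Num.sqrt 1) q.1.1 * normal_pdf q.2 (Num.sqrt r) q.1.2)%:E)).
    apply/measurable_EFinP; apply: measurable_funM.
      have -> : (fun q : measurableTypeR R * measurableTypeR R * measurableTypeR R =>
          normal_pdf q.2 (Num.sqrt 1) q.1.1) =
        (fun p => normal_pdf p.2 (Num.sqrt 1) p.1) \o (fun q => (q.1.1, q.2)) by [].
      apply: measurableT_comp; first exact: measurable_normal_pdf_joint.
      apply/measurable_fun_pairP; split; last exact: measurable_snd.
      exact: (measurableT_comp measurable_fst measurable_fst).
    have -> : (fun q : measurableTypeR R * measurableTypeR R * measurableTypeR R =>
        normal_pdf q.2 (Num.sqrt r) q.1.2) =
      (fun p => normal_pdf p.2 (Num.sqrt r) p.1) \o (fun q => (q.1.2, q.2)) by [].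
    apply: measurableT_comp; first exact: measurable_normal_pdf_joint.
    apply/measurable_fun_pairP; split; last exact: measurable_snd.
    exact: (measurableT_comp measurable_snd measurable_fst).
  by move=> q; rewrite lee_fin mulr_ge0 ?normal_pdf_ge0.
by apply/funext => p /=; rewrite mix2E.
Qed.

Lemma predictive_grid_density n :
  predictive_density (bayes_density r (product_grid_prior r eta n)).
Proof.
have m1 := grid_mix1_gt0 r0 eta0 eta1.
have mq : measurable_fun setT (fun p : measurableTypeR R * measurableTypeR R =>
    mix2 P r p.1 p.2 / mix1 P p.1).
  apply: measurable_funM; first exact: measurable_mix2_joint.
  rewrite (_ : (fun _ => _) = (fun x => expR (- ln (mix1 P x))) \o fst).
    apply: measurableT_comp; last exact: measurable_fst.
    apply: measurableT_comp => //; apply: measurableT_comp => //.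
    exact: (measurableT_comp (@measurable_ln R) (measurable_mix1 P)).
  by apply/funext => p /=; rewrite expRN lnK ?posrE.
have q0 x y : 0 <= mix2 P r x y / mix1 P x.
  by rewrite divr_ge0 ?mix2_ge0// ltW.
rewrite grid_bayes_density//; split.
- apply: measurable_prod => i _.
  have -> : (fun xy : vec R n * vec R n =>
      mix2 P r (tnth xy.1 i) (tnth xy.2 i) / mix1 P (tnth xy.1 i)) =
    (fun p => mix2 P r p.1 p.2 / mix1 P p.1) \o (fun xy : vec R n * vec R n =>
      (tnth xy.1 i : measurableTypeR R, tnth xy.2 i : measurableTypeR R)) by [].
  apply: measurableT_comp; first exact: mq.
  apply/measurable_fun_pairP; split.
    exact: (measurableT_comp (measurable_tnth i) measurable_fst).
  exact: (measurableT_comp (measurable_tnth i) measurable_snd).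
- by move=> x y; apply: prodr_ge0 => i _.
- move=> x.
  rewrite (@ge0_integral_nfold_prod _ (measurableTypeR R) R _ n
    (fun i y => mix2 P r (tnth x i) y / mix1 P (tnth x i))).
  + rewrite big1// => i _; under eq_integral do rewrite mulrC EFinM.
    rewrite ge0_integralZl//=.
    * by rewrite integral_mix2// -EFinM mulVf// gt_eqF.
    * by apply/measurable_EFinP; exact: measurable_mix2.
    * by move=> y _; rewrite lee_fin mix2_ge0.
    * by rewrite lee_fin invr_ge0 ltW.
  + move=> i; apply: measurable_funM => //; exact: measurable_mix2.
  + by move=> i y.
Qed.

End grid_predictive.

(** * Bounds uniform in n and s for large L *)

Section asymptotic_bounds.
Context {R : realType}.
Variable r : R.
Hypothesis r0 : 0 < r.

Local Notation v := (grid_v r).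
Local Notation D := (dev_mean r).

(** Absorbs every remainder: these are affine in the grid spacing or the spike height [l], and
    [l <= e * L + e^-1] for any [e > 0]. The threshold depends on [c] and [d] only. *)
Lemma affine_sqrt_le (c d : R) : 0 <= c -> 0 < d -> exists2 L0 : R, 0 < L0 &
  forall L l : R, L0 <= L -> l ^+ 2 <= 2 * L -> c * (1 + l) <= d * L.
Proof.
move=> c0 d0; pose e := d / (2 * c + 1).
have cc : 0 < 2 * c + 1 by lra.
have e0 : 0 < e by rewrite divr_gt0.
exists (2 * (c * (1 + e^-1)) / d + 1).
  by rewrite ltr_wpDl// divr_ge0 ?(ltW d0)// !mulr_ge0// addr_ge0// invr_ge0 ltW.
move=> L l hL hl.
have h1 : 2 * (c * (1 + e^-1)) <= d * L.
  rewrite mulrC -[leRHS]mulrC -ler_pdivrMr// [_ * 2]mulrC; lra.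
have le : l <= e * L + e^-1.
  have := sqr_ge0 (e * l - 1) => /(mulr_ge0 (ltW (_ : 0 < e^-1))).
  rewrite invr_gt0 => /(_ e0).
  rewrite (_ : e^-1 * (e * l - 1) ^+ 2 = e * l ^+ 2 - 2 * l + e^-1); last first.
    by field; rewrite gt_eqF.
  have := ler_wpM2l (ltW e0) hl.
  have : 0 < e^-1 by rewrite invr_gt0.
  lra.
have ce : 2 * (c * e) <= d.
  rewrite /e mulrA mulrA ler_pdivrMr//; have := mulr_ge0 c0 (ltW d0); lra.
have L1 : 0 <= L.
  have := le_trans (sqr_ge0 l) hl; lra.
have := ler_wpM2r L1 ce; have := ler_wpM2l c0 le; lra.
Qed.

Lemma expR_neg_le_half (p : R) : 0 < p -> exists2 L0 : R, 0 < L0 &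
  forall L, L0 <= L -> expR (- (L * p)) <= 2^-1.
Proof.
move=> p0; exists (ln 2 / p) => [|L hL].
  by rewrite divr_gt0// ln_gt0// ltr1n.
rewrite expRN lef_pV2 ?posrE ?expR_gt0// -[leLHS](lnK (x := 2)) ?posrE//.
by rewrite ler_expR -ler_pdivrMr.
Qed.

Lemma eta_itv (n s : nat) : (1 <= s <= n)%N -> 0 < - ln (s%:R / n%:R : R) ->
  0 < s%:R / n%:R :> R /\ s%:R / n%:R < 1 :> R.
Proof.
move=> /andP[s1 sn] L0; have n0 : (0 < n)%N by exact: leq_trans sn.
have e0 : 0 < s%:R / n%:R :> R by rewrite divr_gt0 ?ltr0n.
split=> //; rewrite ltNge; apply/negP => e1.
have := ln_ge0 e1; lra.
Qed.

Local Notation eta n s := (s%:R / n%:R : R).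
Local Notation L n s := (- ln (eta n s)).

Lemma minimax_risk_asymp_ge (d : R) : 0 < d -> exists2 L0 : R, 0 < L0 &
  forall n s : nat, (1 <= s <= n)%N -> L0 <= L n s ->
  ((s%:R * (L n s * (1 - v - d)))%:E <= minimax_risk r (@sparse R n s))%E.
Proof.
move=> d0; have v0 := grid_v_gt0 r0; have v1 := grid_v_lt1 r0.
have D0 := dev_mean_ge0 r0.
have ln2 : 0 <= ln 2 :> R by rewrite ln_ge0// ler1n.
have ri : 0 <= r^-1 by rewrite invr_ge0 ltW.
have c0 : 0 <= (1 + 2 / r) * (1 + D) by rewrite mulr_ge0 ?addr_ge0// mulr_ge0.
pose c := 2 * ln 2 + 1 + (1 + 2 / r) * (1 + D).
have cc : 0 <= c by rewrite /c; lra.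
have [L0 L00 HL] := affine_sqrt_le cc d0.
exists L0 => // n s sn hL.
have LL : 0 < L n s by exact: lt_le_trans hL.
have [e0 e1] := eta_itv sn LL.
have /andP[s1 sn'] := sn.
have n0 : (0 < n)%N by exact: leq_trans sn'.
pose m := (n %/ s)%N.
have m0 : (0 < m)%N by rewrite divn_gt0.
have smn : (s * m <= n)%N by rewrite mulnC leq_trunc_div.
(* Rounding the block length down loses at most a factor two, hence a mere [ln 2] in [L]. *)
have nsm : (n <= 2 * (s * m))%N.
  have := ltn_ceil n s1; rewrite -/m mulSn => h.
  apply: leq_trans (ltnW h) _; rewrite mul2n -addnn [(m * s)%N]mulnC leq_add2r.
  by rewrite leq_pmulr.
have nR : 0 < n%:R :> R by rewrite ltr0n.
have sR : 0 < s%:R :> R by rewrite ltr0n.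
have mR : 0 < m%:R :> R by rewrite ltr0n.
have lnm : ln m%:R <= L n s.
  rewrite -lnV ?posrE// ler_ln ?posrE ?invr_gt0//.
  by rewrite invf_div ler_pdivlMr// -natrM ler_nat mulnC.
have lnm2 : L n s <= ln 2 + ln m%:R.
  have m2 : 0 < 2 * m%:R :> R by rewrite mulr_gt0.
  rewrite -lnV ?posrE// -lnM ?posrE// ler_ln ?posrE ?invr_gt0//.
  by rewrite invf_div ler_pdivrMr// -!natrM ler_nat -mulnA [(m * s)%N]mulnC.
have lnm0 : 0 <= ln m%:R :> R by rewrite ln_ge0// ler1n.
pose tau := Num.sqrt (2 * v * ln m%:R).
have tau0 : 0 <= tau by exact: sqrtr_ge0.
have tau2 : tau ^+ 2 = 2 * v * ln m%:R by rewrite sqr_sqrtr// !mulr_ge0// ltW.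
apply: le_trans (minimax_risk_ge r0 m0 smn tau0 tau2).
rewrite lee_fin ler_wpM2l ?(ltW sR)//.
have tL : tau ^+ 2 <= 2 * L n s.
  rewrite tau2; have := ler_wpM2r lnm0 (ltW v1); lra.
have := HL _ _ hL tL.
have vr : v / r = 1 - v.
  have : v * v^-1 = 1 by rewrite mulfV// gt_eqF.
  by rewrite grid_vV; lra.
rewrite tau2 (_ : 2 * v * ln m%:R / (2 * r) = (v / r) * ln m%:R); last first.
  by field; rewrite gt_eqF.
rewrite vr /c.
have v1' : 0 <= 1 - v by lra.
have := ler_wpM2l v1' lnm2.
have : 0 <= v * ln 2 by rewrite mulr_ge0// ltW.
have : 0 <= tau * (2 * ln 2 + 1) by rewrite mulr_ge0//; lra.
move: (L n s) (ln m%:R) => l lm.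
have : 0 <= (1 + 2 / r) * D by rewrite mulr_ge0// addr_ge0// mulr_ge0.
move: c0.
lra.
Qed.

Lemma minimax_risk_asymp_le (d : R) : 0 < d -> exists2 L0 : R, 0 < L0 &
  forall n s : nat, (1 <= s <= n)%N -> L0 <= L n s ->
  (minimax_risk r (@sparse R n s) <= (s%:R * (L n s * (1 - v + d)))%:E)%E.
Proof.
move=> d0; have v0 := grid_v_gt0 r0; have v1 := grid_v_lt1 r0.
have D0 := dev_mean_ge0 r0.
have ln2 : 0 <= ln 2 :> R by rewrite ln_ge0// ler1n.
have ri : 0 <= r^-1 by rewrite invr_ge0 ltW.
(* [a] stays fixed: [1 - a <= d / 2] uses half of the margin, and the null cost
   [(Num.sqrt (1 - a))^-1] is a constant absorbed in [c]. The minimum with [1] keeps [a]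
   positive. *)
pose a := 1 - Num.min d 1 / 2.
have md : 0 < Num.min d 1 by rewrite lt_min d0 ltr01.
have md1 : Num.min d 1 <= 1 by rewrite ge_min lexx orbT.
have mdd : Num.min d 1 <= d by rewrite ge_min lexx.
have a0 : 0 < a by rewrite /a; lra.
have a1 : a < 1 by rewrite /a; lra.
have ad : 1 - a <= d / 2 by rewrite /a; lra.
pose c := ln 2 + r^-1 + r^-1 * D + (Num.sqrt (1 - a))^-1.
have s0 : 0 <= (Num.sqrt (1 - a))^-1 by rewrite invr_ge0 sqrtr_ge0.
have rD : 0 <= r^-1 * D by rewrite mulr_ge0.
have cc : 0 <= c by rewrite /c; lra.
have d2 : 0 < d / 2 by lra.
have [L0 L00 HL] := affine_sqrt_le cc d2.
exists L0 => // n s sn hL.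
have LL : 0 < L n s by exact: lt_le_trans hL.
have [e0 e1] := eta_itv sn LL.
have /andP[s1 sn'] := sn.
have sR : 0 <= s%:R :> R by [].
have nR : n%:R != 0 :> R by rewrite pnatr_eq0 -lt0n (leq_trans s1).
apply: le_trans (minimax_risk_le r0 e0 e1 a0 a1 n s) _.
rewrite lee_fin [X in _ + X](_ : _ = s%:R * (Num.sqrt (1 - a))^-1); last first.
  by rewrite mulrA [n%:R * _]mulrC divfK.
rewrite -mulrDr ler_wpM2l//.
have l2 := grid_spacing_sqr r0 e0 e1.
have l0 : 0 <= grid_spacing r (eta n s) by exact: sqrtr_ge0.
have tL : grid_spacing r (eta n s) ^+ 2 <= 2 * L n s.
  by rewrite l2; have := ler_wpM2r (ltW LL) (ltW v1); lra.
have := HL _ _ hL tL; rewrite /c.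
move: (grid_spacing r _) l0 (L n s) LL => l l0 LR LR0 {HL hL l2 tL}.
have h1 : LR * (1 - a * v) <= LR * (1 - v + d / 2).
  apply: ler_wpM2l; first exact: ltW.
  have := ler_wpM2r (ltW v0) ad; have := ler_wpM2l (ltW d2) (ltW v1); lra.
have := mulr_ge0 l0 ln2; have := mulr_ge0 l0 s0; have := mulr_ge0 l0 ri.
rewrite [(2 * r)^-1]invfM; lra.
Qed.

Lemma grid_risk_asymp_le (d : R) : 0 < d -> exists2 L0 : R, 0 < L0 &
  forall n s : nat, (1 <= s <= n)%N -> L0 <= L n s ->
  (max_risk r (@sparse R n s) (bayes_density r (product_grid_prior r (eta n s) n)) <=
   (s%:R * (L n s * (grid_rate v + d)))%:E)%E.
Proof.
move=> d0; have v0 := grid_v_gt0 r0; have v1 := grid_v_lt1 r0.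
have D0 := dev_mean_ge0 r0.
have ln20 : 0 <= ln 20 :> R by rewrite ln_ge0// ler1n.
have ri : 0 <= r^-1 by rewrite invr_ge0 ltW.
pose c := ln 20 + r^-1 + r^-1 * D + 2.
have rD : 0 <= r^-1 * D by rewrite mulr_ge0.
have cc : 0 <= c by rewrite /c; lra.
have [L0 L00 HL] := affine_sqrt_le cc d0.
have p0 : 0 < v ^+ 2 * (1 - v) by rewrite mulr_gt0 ?exprn_gt0// subr_gt0.
have [L1 L10 HL1] := expR_neg_le_half p0.
have [L2 L20 HL2] := expR_neg_le_half (@ltr01 R).
exists (L0 + L1 + L2); first by rewrite !addr_gt0.
move=> n s sn hL.
have LL : 0 < L n s by lra.
have [e0 e1] := eta_itv sn LL.
have /andP[s1 sn'] := sn.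
have sR : 0 <= s%:R :> R by [].
have nR : n%:R != 0 :> R by rewrite pnatr_eq0 -lt0n (leq_trans s1).
have es : expR (- (L n s * (v ^+ 2 * (1 - v)))) <= 2^-1 by apply: HL1; lra.
have eh : eta n s <= 2^-1.
  have := HL2 (L n s); rewrite mulr1 opprK lnK ?posrE//; apply; lra.
apply: le_trans (grid_max_risk_le r0 e0 e1 n s es) _.
rewrite lee_fin.
have h2 : n%:R * - ln (1 - eta n s) <= s%:R * 2.
  apply: (@le_trans _ _ (n%:R * (2 * eta n s))).
    by rewrite ler_wpM2l//; exact: neg_ln1B_le.
  by rewrite mulrCA [n%:R * _]mulrC divfK// mulrC.
apply: le_trans (lerD (lexx _) h2) _.
rewrite -mulrDr ler_wpM2l//.
have l2 := grid_spacing_sqr r0 e0 e1.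
have l0 : 0 <= grid_spacing r (eta n s) by exact: sqrtr_ge0.
have tL : grid_spacing r (eta n s) ^+ 2 <= 2 * L n s.
  by rewrite l2; have := ler_wpM2r (ltW LL) (ltW v1); lra.
have hL0 : L0 <= L n s by lra.
have := HL _ _ hL0 tL; rewrite /c.
move: (grid_spacing r _) l0 (L n s) LL => l l0 LR LR0 {HL HL1 HL2 hL hL0 l2 tL}.
have := mulr_ge0 l0 ln20; have := mulr_ge0 l0 ri.
rewrite [(2 * r)^-1]invfM; lra.
Qed.

Lemma grid_risk_asymp_ge (d : R) : 0 < d -> exists2 L0 : R, 0 < L0 &
  forall n s : nat, (1 <= s <= n)%N -> L0 <= L n s ->
  ((s%:R * (L n s * (grid_rate v - d)))%:E <=
   max_risk r (@sparse R n s) (bayes_density r (product_grid_prior r (eta n s) n)))%E.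
Proof.
move=> d0; have v0 := grid_v_gt0 r0; have v1 := grid_v_lt1 r0.
have D0 := dev_mean_ge0 r0.
have ln6 : 0 <= ln 6 :> R by rewrite ln_ge0// ler1n.
have ri : 0 <= r^-1 by rewrite invr_ge0 ltW.
have [L3 L30 HL3] := minimax_risk_asymp_ge d0.
(* Chosen so that the loss [6 * kappa] uses at most half of the margin [d]. *)
pose kappa := Num.min d 1 / 12.
have md : 0 < Num.min d 1 by rewrite lt_min d0 ltr01.
have md1 : Num.min d 1 <= 1 by rewrite ge_min lexx orbT.
have mdd : Num.min d 1 <= d by rewrite ge_min lexx.
have k0 : 0 < kappa by rewrite /kappa; lra.
have k1 : kappa < 1 by rewrite /kappa; lra.
have kd : 6 * kappa <= d / 2 by rewrite /kappa; lra.
pose C := (1 + 2 / kappa) * (1 + r^-1) * D.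
have C0 : 0 <= C.
  apply: mulr_ge0 => //; apply: mulr_ge0; apply: addr_ge0 => //.
  by rewrite divr_ge0// ltW.
pose c := ln 6 + C + 2.
have cc : 0 <= c by rewrite /c; lra.
have d2 : 0 < d / 2 by lra.
have [L0 L00 HL] := affine_sqrt_le cc d2.
have kv : 0 < kappa * v by exact: mulr_gt0.
have [L1 L10 HL1] := expR_neg_le_half kv.
have [L2 L20 HL2] := expR_neg_le_half (@ltr01 R).
exists (L0 + L1 + L2 + L3); first by rewrite !addr_gt0.
move=> n s sn hL.
have LL : 0 < L n s by lra.
have [e0 e1] := eta_itv sn LL.
have /andP[s1 sn'] := sn.
have sR : 0 <= s%:R :> R by [].
have nR : n%:R != 0 :> R by rewrite pnatr_eq0 -lt0n (leq_trans s1).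
have [le_w|/ltW w_le] := leP (1 - v) (worst_rate r).
  have -> : grid_rate v = worst_rate r by rewrite /grid_rate -/(worst_rate r) max_r.
  have es : expR (- (L n s * (kappa * v))) <= 2^-1 by apply: HL1; lra.
  have eh : eta n s <= 2^-1.
    have := HL2 (L n s); rewrite mulr1 opprK lnK ?posrE//; apply; lra.
  apply: le_trans (grid_max_risk_ge r0 e0 e1 sn' k0 k1 eh es).
  rewrite lee_fin -/C.
  have h2 : s%:R * - 2 <= n%:R * ln (1 - eta n s).
    rewrite mulrN lerNl -mulrN.
    apply: (@le_trans _ _ (n%:R * (2 * eta n s))).
      by rewrite ler_wpM2l//; exact: neg_ln1B_le.
    by rewrite mulrCA [n%:R * _]mulrC divfK// mulrC.
  apply: le_trans (lerD (lexx _) h2).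
  rewrite -mulrDr ler_wpM2l//.
  have hL0 : L0 <= L n s by lra.
  have t0 : 0 ^+ 2 <= 2 * L n s by rewrite expr0n/=; lra.
  have := HL _ _ hL0 t0; rewrite /c.
  move: (L n s) LL => LR LR0 {HL HL1 HL2 HL3 hL hL0 t0 es eh}.
  have := ler_wpM2l (ltW LR0) kd; lra.
(* When the tie is not the worse of the two points, the grid rule, being an estimator, is bounded
   below by the minimax risk. The value [1 - v] thus needs no computation at [alpha = 1]. *)
have -> : grid_rate v = 1 - v by rewrite /grid_rate -/(worst_rate r) max_l.
apply: (@le_trans _ _ (minimax_risk r (@sparse R n s))).
  by apply: HL3 => //; lra.
apply: ereal_inf_lbound; exists (bayes_density r (product_grid_prior r (eta n s) n)) => //.
exact: predictive_grid_density.
Qed.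

Lemma grid_rateE : grid_rate v = (1 - v) * (1 + Num.max (h_const r) 0).
Proof.
have v1 := grid_v_lt1 r0.
have r1 : 1 + r != 0 by rewrite gt_eqF// addr_gt0.
rewrite /grid_rate (_ : 1 + v + _ - _ = (1 - v) * (1 + h_const r)); last first.
  rewrite /h_const grid_vE// -exprVn; field.
  by rewrite r1.
have p0 : 0 <= 1 - v by rewrite subr_ge0 ltW.
rewrite -{1}[1 - v]mulr1 -maxr_pMr//; congr (_ * _).
by rewrite addr_maxr addr0 maxC.
Qed.

End asymptotic_bounds.

(** * From two-sided bounds to the ratio of the risks *)

Lemma ratio_close {R : realType} (p c d x M m : R) : 0 < p -> 0 <= c -> 0 < x ->
  d <= p / 2 ->
  x * (p - d) <= m -> m <= x * (p + d) ->
  x * (p * (1 + c) - d) <= M -> M <= x * (p * (1 + c) + d) ->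
  `|M / m - (1 + c)| <= 2 * d * (2 + c) / p.
Proof.
move=> p0 c0 x0 dp h1 h2 h3 h4.
(* [d <= p / 2] keeps the denominator away from zero. *)
have xp : x * (p / 2) <= m.
  by apply: le_trans h1; rewrite ler_wpM2l ?(ltW x0)//; lra.
have m0 : 0 < m by apply: lt_le_trans xp; rewrite !mulr_gt0// invr_gt0.
have -> : M / m - (1 + c) = (M - (1 + c) * m) / m by field; rewrite gt_eqF.
rewrite normrM [X in _ * X]gtr0_norm ?invr_gt0// ler_pdivrMr//.
have B : `|M - (1 + c) * m| <= x * d * (2 + c).
  have c1 : 0 <= 1 + c by lra.
  have := ler_wpM2l c1 h1; have := ler_wpM2l c1 h2.
  by rewrite ler_norml => *; apply/andP; split; lra.
apply: le_trans B _.
have d0 : 0 <= d.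
  have := le_trans h1 h2; rewrite ler_pM2l//; lra.
have := ler_wpM2l (_ : 0 <= 2 * d * (2 + c) / p) xp.
rewrite divr_ge0 ?mulr_ge0 ?(ltW p0)//; last by lra.
move=> /(_ isT); apply: le_trans; rewrite le_eqVlt; apply/orP; left; apply/eqP.
by field; rewrite gt_eqF.
Qed.

Theorem theorem1p1 (R : realType) (r : R) (r_gt0 : 0 < r) (s : nat -> nat)
    (s_bounds : forall n : nat, (1 <= n)%N -> (1 <= s n <= n)%N)
    (eta_to0 : (fun n : nat => (s n)%:R / n%:R : R) @ \oo --> (0 : R)) :
  exists2 e : nat -> R, e @ \oo --> (0 : R) &
    \forall n \near \oo,
      max_risk r (@sparse R n (s n))
        (bayes_density r (product_grid_prior r ((s n)%:R / n%:R) n)) =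
      (minimax_risk r (@sparse R n (s n)) *
        (1 + Num.max (h_const r) 0 + e n)%:E)%E.
Proof.
pose eta n : R := (s n)%:R / n%:R.
pose M n := max_risk r (@sparse R n (s n))
  (bayes_density r (product_grid_prior r (eta n) n)).
pose m n := minimax_risk r (@sparse R n (s n)).
pose h := Num.max (h_const r) 0; pose p := 1 - grid_v r.
have h0 : 0 <= h by rewrite /h le_max lexx orbT.
have p0 : 0 < p by rewrite subr_gt0 grid_v_lt1.
have eventually_large (L0 : R) : \forall n \near \oo, (0 < n)%N /\ L0 <= - ln (eta n).
  near=> n.
  have n0 : (0 < n)%N by near: n; exists 1%N.
  have /andP[s1 _] := s_bounds _ n0.
  (* Positivity of [eta n] keeps [ln] away from its default value at [0]. *)
  have e0 : 0 < eta n by rewrite divr_gt0 ?ltr0n.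
  split=> //; rewrite lerNr -(expRK (- L0)) ler_ln ?posrE ?expR_gt0//.
  have : `|0 - eta n| <= expR (- L0).
    by near: n; move/cvgrPdist_le : eta_to0; apply; exact: expR_gt0.
  by rewrite sub0r normrN gtr0_norm.
have bounds (d : R) : 0 < d -> \forall n \near \oo, exists x : R,
    [/\ 0 < x, (((x * (p - d))%:E <= m n) /\ (m n <= (x * (p + d))%:E))%E &
     (((x * (p * (1 + h) - d))%:E <= M n) /\
      (M n <= (x * (p * (1 + h) + d))%:E))%E].
  move=> d0.
  have [L1 L10 H1] := minimax_risk_asymp_ge r_gt0 d0.
  have [L2 L20 H2] := minimax_risk_asymp_le r_gt0 d0.
  have [L3 L30 H3] := grid_risk_asymp_ge r_gt0 d0.
  have [L4 L40 H4] := grid_risk_asymp_le r_gt0 d0.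
  near=> n.
  have [n0 hL] : (0 < n)%N /\ L1 + L2 + L3 + L4 <= - ln (eta n).
    by near: n; exact: eventually_large.
  have sn := s_bounds _ n0; have /andP[s1 _] := sn.
  exists ((s n)%:R * - ln (eta n)); rewrite -!mulrA -(grid_rateE r_gt0).
  split.
  - by rewrite mulr_gt0 ?ltr0n//; lra.
  - by split; [apply: H1 | apply: H2] => //; rewrite -/(eta n); lra.
  - by split; [apply: H3 | apply: H4] => //; rewrite -/(eta n); lra.
have fin_between (a b : R) (z : \bar R) : (a%:E <= z)%E -> (z <= b%:E)%E ->
    [/\ z = (fine z)%:E, a <= fine z & fine z <= b].
  by case: z => [z| |]//; rewrite !lee_fin.
(* The exact relative error. It has this meaning only once both risks are finite and the minimax
   risk is positive, which holds for large [n]. *)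
exists (fun n => fine (M n) / fine (m n) - (1 + h)).
  apply/cvgrPdist_le => eps eps0.
  pose d := Num.min (p / 2) (eps * p / (2 * (2 + h))).
  have h2 : 0 < 2 + h by lra.
  have d0 : 0 < d by rewrite lt_min !divr_gt0 ?mulr_gt0.
  have dp : d <= p / 2 by rewrite ge_min lexx.
  have de : 2 * d * (2 + h) / p <= eps.
    rewrite ler_pdivrMr//.
    have : d <= eps * p / (2 * (2 + h)) by rewrite ge_min lexx orbT.
    by rewrite ler_pdivlMr ?mulr_gt0//; lra.
  near=> n.
  have [x [x0 [m1 m2] [M1 M2]]] : exists x : R,
    [/\ 0 < x, (((x * (p - d))%:E <= m n) /\ (m n <= (x * (p + d))%:E))%E &
     (((x * (p * (1 + h) - d))%:E <= M n) /\
      (M n <= (x * (p * (1 + h) + d))%:E))%E].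
    by near: n; exact: bounds.
  have [_ {}m1 {}m2] := fin_between _ _ _ m1 m2.
  have [_ {}M1 {}M2] := fin_between _ _ _ M1 M2.
  rewrite sub0r normrN; apply: le_trans de.
  exact: ratio_close p0 h0 x0 dp m1 m2 M1 M2.
(* The bounds at the single margin [p / 2] already give finiteness of both risks and positivity of
   the minimax risk, so the identity is an equality of reals. *)
have p2 : 0 < p / 2 by rewrite divr_gt0.
near=> n.
have [x [x0 [m1 m2] [M1 M2]]] : exists x : R,
  [/\ 0 < x, (((x * (p - p / 2))%:E <= m n) /\ (m n <= (x * (p + p / 2))%:E))%E &
   (((x * (p * (1 + h) - p / 2))%:E <= M n) /\
    (M n <= (x * (p * (1 + h) + p / 2))%:E))%E].
  by near: n; exact: bounds.
have [mE {}m1 {}m2] := fin_between _ _ _ m1 m2.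
have [ME _ _] := fin_between _ _ _ M1 M2.
have m0 : 0 < fine (m n) by apply: lt_le_trans m1; rewrite mulr_gt0//; lra.
rewrite -/(M n) -/(m n) -/h [LHS]ME [X in (X * _)%E]mE -EFinM; congr (_%:E).
move: (fine (M n)) (fine (m n)) m0 => a b b0.
by rewrite [1 + h + _]addrC subrK mulrC divfK// gt_eqF.
Unshelve. all: by end_near. Qed.
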